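(* Let $a_1,a_2,a_3\in\mathbb N$ and $w=a_1+a_2+a_3$. The coefficient $c_{2-w}$ of $(4\pi\tau_2)^{2-w}$ in the Laurent polynomial part of the constant Fourier mode of $C_{a_1,a_2,a_3}$ is a linear combination, with rational coefficients, of products of two odd zeta values whose weights add up to $2w-2$; that is, there exist $\gamma_k\in\mathbb Q$ such that $$c_{2-w}=\sum_{k=1}^{w-3}\tfrac12\,\gamma_k\,\zeta(2k+1)\,\zeta(2w-2k-3).$$
   Context: Here $\mathbb N$ is the set of positive integers and $\tau=\tau_1+i\tau_2$ with $\tau_1\in\mathbb R$, $\tau_2>0$. For $a_1,a_2,a_3\in\mathbb N$, $$C_{a_1,a_2,a_3}(\tau)=\sum\ \prod_{r=1}^{3}\left(\frac{\tau_2}{\pi|m_r+n_r\tau|^2}\right)^{a_r},$$ the absolutely convergent sum being over all $(m_r,n_r)\in\mathbb Z^2\setminus\{(0,0)\}$, $r=1,2,3$, with $m_1+m_2+m_3=0$ and $n_1+n_2+n_3=0$. The constant Fourier mode is $C^{(0)}_{a_1,a_2,a_3}(\tau_2)=\int_0^1C_{a_1,a_2,a_3}(\tau_1+i\tau_2)\,d\tau_1$. It decomposes uniquely as $C^{(0)}_{a_1,a_2,a_3}(\tau_2)=\mathcal L(\tau_2)+\mathcal E(\tau_2)$ with $\mathcal E$ exponentially decaying as $\tau_2\to\infty$ and $\mathcal L$ a Laurent polynomial in $\tau_2$ of the form $$\mathcal L(\tau_2)=c_w(-4\pi\tau_2)^w+\sum_{k=1}^{w-1}c_{w-2k-1}\frac{\zeta(2k+1)}{(4\pi\tau_2)^{2k+1-w}}+\frac{c_{2-w}}{(4\pi\tau_2)^{w-2}},$$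 where $c_w$ and the $c_{w-2k-1}$ are rational. This defines $c_{2-w}$ (the exponents $w$, $w-2k-1$, $2-w$ are pairwise distinct). An empty sum is $0$; $\zeta(s)$ is the Riemann zeta function and has weight $s$. *)

(* Defs.v *)
From HB Require Import structures.
From mathcomp Require Import all_boot all_order all_algebra.
From mathcomp Require Import all_classical all_reals all_analysis.
From mathcomp Require Import complex.

Set Implicit Arguments.
Unset Strict Implicit.
Unset Printing Implicit Defensive.

Import Order.TTheory GRing.Theory Num.Theory.
Import numFieldNormedType.Exports.

Local Open Scope classical_set_scope.
Local Open Scope ring_scope.
Local Open Scope complex_scope.

(* The Riemann zeta function at an integer s >= 2. *)
Definition zeta (R : realType) (s : nat) : R :=
  limn (series (fun n : nat => n.+1%:R ^- s : R)).

(* tau_2 / (pi |m + n tau|^2) for p = (m, n) *)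
Definition propagator (R : realType) (tau : R[i])
    (p : int * int) : R :=
  complex.Im tau /
  (pi * ComplexField.Normc.normc (p.1%:~R + p.2%:~R * tau) ^+ 2).

(* Addition on int * int is componentwise. *)
Definition momenta : set ((int * int) * (int * int) * (int * int)) :=
  [set p | [/\ p.1.1 != 0, p.1.2 != 0, p.2 != 0 &
               p.1.1 + p.1.2 + p.2 = 0]].

(* The terms are nonnegative for Im tau > 0, so their absolutely convergent
   sum is the supremum of the finite partial sums, computed by esum. *)
Definition modular_graph_C (R : realType) (a1 a2 a3 : nat)
    (tau : R[i]) : R :=
  fine (\esum_(p in momenta)
    (propagator tau p.1.1 ^+ a1 * propagator tau p.1.2 ^+ a2 *
     propagator tau p.2 ^+ a3)%:E).

Definition constant_mode (R : realType) (a1 a2 a3 : nat) (t2 : R) : R :=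
  Rintegral lebesgue_measure `[0, 1]
    (fun t1 : R => modular_graph_C a1 a2 a3 (t1 +i* t2)).

Definition exp_decaying (R : realType) (f : R -> R) : Prop :=
  exists e K : R, 0 < e /\
    \forall t \near +oo, `|f t| <= K * expR (- (e * t)).

(* The rational coefficients are c j for j = w and j = w - 2k - 1; the
   coefficient d of (4 pi t)^(2 - w) is real. *)
Definition laurent_poly (R : realType) (w : nat) (c : int -> rat) (d : R)
    (t : R) : R :=
  ratr (c w%:Z) * (- (4 * pi * t)) ^+ w
  + \sum_(1 <= k < w)
      ratr (c (w%:Z - (2 * k)%:Z - 1)) *
      (zeta R (2 * k + 1) / (4 * pi * t) ^ ((2 * k + 1)%:Z - w%:Z))
  + d / (4 * pi * t) ^ (w%:Z - 2).

(* d is the coefficient c_(2-w), w = a1 + a2 + a3, of the Laurent polynomial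
   part of the constant Fourier mode; the exponents being pairwise distinct,
   at most one d satisfies this. *)
Definition is_c_2_minus_w (R : realType) (a1 a2 a3 : nat) (d : R) : Prop :=
  exists c : int -> rat,
    exp_decaying (fun t : R =>
      constant_mode a1 a2 a3 t - laurent_poly (a1 + a2 + a3) c d t).

(* Main.v *)
(* Let p_r = (m_r, n_r) and sum over m first, for fixed n with n_1 + n_2 + n_3 = 0.
   After multiplication by t^(w-2), every contribution is p(t) + O(1/t) for a
   polynomial p, and p(0) determines c_(2-w).

   If all n_r are nonzero, the sum over m is the double integral of
   (x^2+N_1^2)^-a_1 (y^2+N_2^2)^-a_2 ((x+y)^2+N_3^2)^-a_3, N_r = n_r t, up to a
   factor 1 + O(1/t). For a_r = 1 the integral is pi^2 / (|N_1 N_2 N_3| (|N_1| +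
   |N_2| + |N_3|)), which near the plane N_1 + N_2 + N_3 = 0 is the sum over the
   three pairs j, k of pi^2 sg(N_j N_k) / (N_j N_k (N_i^2 - (N_j - N_k)^2)), and
   the operators -(1 / (2 a N_r)) d/dN_r raise the exponents. On the plane this
   leaves rational combinations of sg(n_j n_k) n_j^-p n_k^-q with p, q >= 2 and
   p + q = 2w - 2, whose sum over all of Z^2 is 4 zeta(p) zeta(q) for odd p, q
   and 0 for even p, q. The omitted points n_j + n_k = 0 leave a multiple of
   zeta(2w-2).

   If exactly one n_r vanishes, the sum over m unfolds the integral over tau_1 to
   the line and leaves a sum over k = m_r of k^(-2a_r) times a convolution. Its
   contribution to p(0) comes from the replacement of a sum over k by an integral,
   and cancels that multiple of zeta(2w-2). The term n = 0 is a constant times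
   t^(2w-2). *)
Require Import Defs.
From mathcomp Require Import all_boot all_order all_algebra.
From mathcomp Require Import all_classical all_reals all_analysis.
From mathcomp Require Import measurable_realfun complex ring lra zify.

Set Implicit Arguments.
Unset Strict Implicit.
Unset Printing Implicit Defensive.

Import Order.TTheory GRing.Theory Num.Theory.
Import numFieldNormedType.Exports.

Local Open Scope classical_set_scope.
Local Open Scope ring_scope.

(** * Signed sums and zeta values *)

(** The Laurent expansion is supplied by the hypothesis; what has to be computed is p(0), which an
    O(1/t) remainder determines uniquely. This is why crude estimates suffice. On the plane the
    double integral is homogeneous of degree 2 - 2w, so each term with all n_r nonzero is an exact
    constant times t^(2-2w), and a relative error O(1/t) cannot reach the constant term. All lattice
    terms are nonnegative, so sums and integrals are interchanged by Tonelli alone; signs appear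
    only in the closed forms. Raising an exponent differentiates in a single N_r and leaves the
    plane N_1 + N_2 + N_3 = 0, so the closed form must be known on an open neighbourhood of it. The
    multiples of zeta(2w-2) cancel exactly for a structural reason: the last partial fraction of
    k^(-2c) / (k^2 + M^2), integrated over k, obeys the same differential recursion as one plane
    summand at z = 0. Both multiples are therefore values of one rational function at (1, -1, 0),
    with opposite signs. *)

Section SignedSums.
Variable R : realType.

(* Absolutely convergent signed sums, as differences of two nonnegative ones. *)
Definition has_sum (T : choiceType) (f : T -> R) (s : R) : Prop :=
  exists u v : T -> R, exists su sv : R,
    [/\ (forall x, 0 <= u x) /\ (forall x, 0 <= v x),
        (\esum_(x in [set: T]) (u x)%:E = su%:E)%E,
        (\esum_(x in [set: T]) (v x)%:E = sv%:E)%E,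
        forall x, f x = u x - v x & s = su - sv].

(** The upper bound is checked on finite partial sums; the same bound with the factor [c^-1] gives
    the lower one. *)
Lemma esumZl (T : choiceType) (f : T -> R) (c s : R) :
  0 <= c -> (forall x, 0 <= f x) ->
  (\esum_(x in [set: T]) (f x)%:E = s%:E)%E ->
  (\esum_(x in [set: T]) (c * f x)%:E = (c * s)%:E)%E.
Proof.
move=> c0 f0 fs.
have [->|cn0] := eqVneq c 0.
  by rewrite mul0r esum1// => i _; rewrite mul0r.
have cp : 0 < c by rewrite lt_def cn0.
have le (g : T -> R) (d r : R) : 0 <= d -> (forall x, 0 <= g x) ->
   (\esum_(x in [set: T]) (g x)%:E = r%:E)%E ->
   (\esum_(x in [set: T]) (d * g x)%:E <= (d * r)%:E)%E.
  move=> d0 g0 gr; apply: ge_ereal_sup => /= _ [X [finX XI] <-].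
  have -> : (\sum_(x \in X) (d * g x)%:E = d%:E * \sum_(x \in X) (g x)%:E)%E.
    rewrite !fsbig_finite//= ge0_sume_distrr//.
    by move=> i _; rewrite lee_fin.
  rewrite EFinM lee_wpmul2l ?lee_fin// -gr.
  by apply: ereal_sup_ubound; exists X.
apply/eqP; rewrite eq_le le//=.
have [r er] : exists r, (\esum_(x in [set: T]) (c * f x)%:E = r%:E)%E.
  have := le _ _ _ c0 f0 fs.
  have : (0 <= \esum_(x in [set: T]) (c * f x)%:E)%E.
    by apply: esum_ge0 => x _; rewrite lee_fin mulr_ge0.
  by case: (\esum_(x in _) _)%E => [r| |]// _ _; exists r.
rewrite er lee_fin.
have cf0 x : 0 <= c * f x by rewrite mulr_ge0.
have := le _ c^-1 r (ltW _) cf0 er; rewrite invr_gt0 => /(_ cp).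
under eq_esum do rewrite mulrA mulVf// mul1r.
by rewrite fs lee_fin ler_pdivlMl.
Qed.

Lemma has_sum_nneg (T : choiceType) (f : T -> R) s :
  (forall x, 0 <= f x) -> (\esum_(x in [set: T]) (f x)%:E = s%:E)%E ->
  has_sum f s.
Proof.
move=> f0 fs; exists f, (fun=> 0), s, 0; split; [by split|by []| | |].
- exact: esum1.
- by move=> x; rewrite subr0.
- by rewrite subr0.
Qed.

(** The way back from signed sums: f + v = u relates nonnegative functions only, so the chosen
    decomposition does not matter. *)
Lemma has_sum_esum (T : choiceType) (f : T -> R) s :
  (forall x, 0 <= f x) -> has_sum f s ->
  (\esum_(x in [set: T]) (f x)%:E = s%:E)%E.
Proof.
move=> f0 [u [v [su [sv [[u0 v0] us vs fE sE]]]]].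
have : (\esum_(x in [set: T]) (f x)%:E +
        \esum_(x in [set: T]) (v x)%:E = su%:E)%E.
  rewrite -esumD; try by move=> x _; rewrite lee_fin.
  by rewrite -us; apply: eq_esum => x _; rewrite -EFinD fE subrK.
rewrite vs sE; have : (0 <= \esum_(x in [set: T]) (f x)%:E)%E.
  by apply: esum_ge0 => x _; rewrite lee_fin.
case: (\esum_(x in _) _)%E => [r| |]// _; rewrite -EFinD => -[<-].
by rewrite addrK.
Qed.

Lemma eq_has_sum (T : choiceType) (f g : T -> R) s t :
  f =1 g -> s = t -> has_sum f s -> has_sum g t.
Proof. by move=> /funext -> ->. Qed.

Lemma has_sumD (T : choiceType) (f g : T -> R) s t :
  has_sum f s -> has_sum g t -> has_sum (fun x => f x + g x) (s + t).
Proof.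
move=> [u [v [su [sv [[u0 v0] us vs fE ->]]]]].
move=> [u' [v' [su' [sv' [[u'0 v'0] us' vs' gE ->]]]]].
exists (fun x => u x + u' x), (fun x => v x + v' x), (su + su'), (sv + sv').
split.
- by split=> x; rewrite addr_ge0.
- under eq_esum do rewrite EFinD.
  by rewrite esumD; [rewrite us us'|move=> *; rewrite lee_fin..].
- under eq_esum do rewrite EFinD.
  by rewrite esumD; [rewrite vs vs'|move=> *; rewrite lee_fin..].
- by move=> x; rewrite fE gE; ring.
- by ring.
Qed.

Lemma has_sumN (T : choiceType) (f : T -> R) s :
  has_sum f s -> has_sum (fun x => - f x) (- s).
Proof.
move=> [u [v [su [sv [[u0 v0] us vs fE ->]]]]].
exists v, u, sv, su; split => //; last by rewrite opprB.
by move=> x; rewrite fE opprB.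
Qed.

Lemma has_sumB (T : choiceType) (f g : T -> R) s t :
  has_sum f s -> has_sum g t -> has_sum (fun x => f x - g x) (s - t).
Proof. by move=> fs /has_sumN gt; exact: has_sumD. Qed.

Lemma has_sumZ (T : choiceType) (f : T -> R) c s :
  has_sum f s -> has_sum (fun x => c * f x) (c * s).
Proof.
wlog c0 : f c s / 0 <= c => [wlg|].
  have [c0|c0] := leP 0 c; first exact: wlg.
  move=> /has_sumN /(wlg _ (- c) (- s)).
  rewrite oppr_ge0 => /(_ (ltW c0)).
  by apply: eq_has_sum => [x|]; rewrite mulrNN.
move=> [u [v [su [sv [[u0 v0] us vs fE ->]]]]].
exists (fun x => c * u x), (fun x => c * v x), (c * su), (c * sv).
split; [by split=> x; rewrite mulr_ge0| exact: esumZl| exact: esumZl| |].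
- by move=> x; rewrite fE mulrBr.
- by rewrite mulrBr.
Qed.

Lemma has_sum0 (T : choiceType) : has_sum (fun _ : T => 0) 0.
Proof. by apply: has_sum_nneg => //; rewrite esum1. Qed.

Lemma has_sum_seq (T : choiceType) (I : Type) (r : seq I)
    (f : I -> T -> R) (s : I -> R) :
  (forall i, has_sum (f i) (s i)) ->
  has_sum (fun x => \sum_(i <- r) f i x) (\sum_(i <- r) s i).
Proof.
move=> fs; elim: r => [|i r ih].
  by apply: (eq_has_sum _ _ (has_sum0 T)) => [x|]; rewrite big_nil.
by apply: (eq_has_sum _ _ (has_sumD (fs i) ih)) => [x|]; rewrite big_cons.
Qed.

Lemma esum_prod (T T' : choiceType) (f : T -> R) (g : T' -> R) s t :
  (forall x, 0 <= f x) -> (forall x, 0 <= g x) ->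
  (\esum_(x in [set: T]) (f x)%:E = s%:E)%E ->
  (\esum_(x in [set: T']) (g x)%:E = t%:E)%E ->
  (\esum_(p in [set: T * T']) (f p.1 * g p.2)%:E = (s * t)%:E)%E.
Proof.
move=> f0 g0 fs gt.
have -> : [set: T * T'] = [set: T] `*`` (fun=> [set: T']).
  by apply/seteqP; split.
rewrite -(@esum_esum _ _ _ setT (fun=> setT) (fun x y => (f x * g y)%:E)).
  under eq_esum do rewrite (esumZl (f0 _) g0 gt) mulrC.
  rewrite (esumZl _ f0 fs) 1?mulrC// -lee_fin -gt.
  by apply: esum_ge0 => x _; rewrite lee_fin.
by move=> i j _ _; rewrite lee_fin mulr_ge0.
Qed.

Lemma has_sum_prod (T T' : choiceType) (f : T -> R) (g : T' -> R) s t :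
  has_sum f s -> has_sum g t ->
  has_sum (fun p : T * T' => f p.1 * g p.2) (s * t).
Proof.
move=> [u [v [su [sv [[u0 v0] us vs fE ->]]]]].
move=> [u' [v' [su' [sv' [[u'0 v'0] us' vs' gE ->]]]]].
have pos (a : T -> R) (b : T' -> R) x y : (forall x, 0 <= a x) ->
    (forall x, 0 <= b x) ->
    (\esum_(x in [set: T]) (a x)%:E = x%:E)%E ->
    (\esum_(x in [set: T']) (b x)%:E = y%:E)%E ->
    has_sum (fun p : T * T' => a p.1 * b p.2) (x * y).
  by move=> a0 b0 ax bx; apply: has_sum_nneg => [p|];
    [rewrite mulr_ge0|exact: esum_prod].
have h1 := pos _ _ _ _ u0 u'0 us us'.
have h2 := pos _ _ _ _ v0 v'0 vs vs'.
have h3 := pos _ _ _ _ u0 v'0 us vs'.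
have h4 := pos _ _ _ _ v0 u'0 vs us'.
apply: (eq_has_sum _ _ (has_sumB (has_sumD h1 h2) (has_sumD h3 h4))).
  by move=> p; rewrite fE gE; ring.
by ring.
Qed.

Lemma has_sum_bij (T T' : choiceType) (f : T -> R) s (e : T' -> T) :
  bijective e -> has_sum f s -> has_sum (f \o e) s.
Proof.
move=> [e' ee' e'e] [u [v [su [sv [[u0 v0] us vs fE ->]]]]].
have be : set_bij [set: T'] [set: T] e.
  by split => // [x y _ _ /(can_inj ee')//|y _]; exists (e' y).
exists (u \o e), (v \o e), su, sv; split => //.
- by split => x /=.
- by rewrite -us (reindex_esum _ _ _ _ be).
- by rewrite -vs (reindex_esum _ _ _ _ be).
- by move=> x; rewrite /= fE.
Qed.

Lemma esum_inj_supp (T T' : choiceType) (f : T -> \bar R) (e : T' -> T) :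
  injective e -> (forall x, ~ range e x -> f x = 0%E) ->
  (\esum_(x in [set: T]) f x = \esum_(x in [set: T']) f (e x))%E.
Proof.
move=> inje f0; rewrite -(esum_image setT e f); last by move=> x y _ _ /inje.
rewrite [RHS]esum_mkcond; apply: eq_esum => x _.
by case: ifPn => // /negP; rewrite inE => /f0.
Qed.

Lemma has_sum_inj_supp (T T' : choiceType) (f : T -> R) (e : T' -> T) s :
  injective e -> (forall x, ~ range e x -> f x = 0) ->
  has_sum (f \o e) s -> has_sum f s.
Proof.
move=> inje f0 [u [v [su [sv [[u0 v0] us vs fE ->]]]]].
pose ext (g : T' -> R) x : R :=
  if pselect (exists y, e y = x) is left h then g (projT1 (cid h)) else 0.
have exte g y : ext g (e y) = g y.
  rewrite /ext; case: pselect => [h|]; last by case; exists y.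
  by case: cid => z /= /inje ->.
have extn g x : ~ range e x -> ext g x = 0.
  move=> nx; rewrite /ext; case: pselect => // -[y yx]; exfalso; apply: nx.
  by exists y.
have ext0 g x : (forall x, 0 <= g x) -> 0 <= ext g x.
  by move=> g0; rewrite /ext; case: pselect => //.
exists (ext u), (ext v), su, sv; split => //.
- by split=> x; exact: ext0.
- rewrite (esum_inj_supp inje); first by under eq_esum do rewrite exte.
  by move=> x /extn ->.
- rewrite (esum_inj_supp inje); first by under eq_esum do rewrite exte.
  by move=> x /extn ->.
- move=> x; have [[y _ <-]|nx] := pselect (range e x).
    by rewrite !exte -fE.
  by rewrite !extn// subr0 f0.
Qed.

Lemma has_sum_int (f : int -> R) s s' : f 0 = 0 ->
  has_sum (fun n : nat => f n.+1%:Z) s ->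
  has_sum (fun n : nat => f (- n.+1%:Z)) s' -> has_sum f (s + s').
Proof.
move=> f0 fs fs'.
have h1 : has_sum (fun n : int => if 0 < n then f n else 0) s.
  apply: (@has_sum_inj_supp _ _ _ (fun n : nat => n.+1%:Z)).
  - by move=> x y [].
  - move=> [[|n]|n]// nr; exfalso; apply: nr; by exists n.
  - exact: fs.
have h2 : has_sum (fun n : int => if n < 0 then f n else 0) s'.
  apply: (@has_sum_inj_supp _ _ _ (fun n : nat => - n.+1%:Z)).
  - by move=> x y /oppr_inj [].
  - move=> [n|n]// nr; exfalso; apply: nr; by exists n.
  - exact: fs'.
by apply: (eq_has_sum _ _ (has_sumD h1 h2)) => // -[[|n]|n] /=;
  rewrite ?f0 ?addr0 ?add0r.
Qed.

End SignedSums.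

(** * Zeta values as sums over the integers *)

Section Zeta.
Variable R : realType.

Lemma series_inv_pow_le2 (s n : nat) : (2 <= s)%N ->
  series (fun n : nat => n.+1%:R ^- s : R) n <= 2.
Proof.
(* The bound is strengthened so that the induction telescopes: 1/(k+1)^2 <= 1/k - 1/(k+1). *)
move=> s2; suff : series (fun n : nat => n.+1%:R ^- s : R) n.+1 <= 2 - n.+1%:R^-1.
  move=> h; apply: le_trans (le_trans h _); last first.
    by rewrite gerBl invr_ge0.
  by rewrite seriesSr lerDl invr_ge0 exprn_ge0.
elim: n => [|n ih].
  rewrite /series/= big_nat1 expr1n invr1; lra.
rewrite seriesSr; apply: (le_trans (lerD ih (lexx _))) => /=.
have e (k : nat) : (k.+1%:R : R) = k%:R + 1 by rewrite -natr1.
have m1 : (1 : R) <= n.+1%:R by rewrite ler1n.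
have h : n.+2%:R ^- s <= (n.+1%:R^-1 - n.+2%:R^-1 : R).
  apply: (@le_trans _ _ (n.+2%:R ^- 2)).
    rewrite lef_pV2 ?posrE ?exprn_gt0// ler_eXn2l// ltr1n//.
  have -> : n.+1%:R^-1 - n.+2%:R^-1 = (n.+1%:R * n.+2%:R)^-1 :> R.
    have n1 : (n.+1%:R : R) != 0 by rewrite pnatr_eq0.
    have n2 : (n.+1%:R + 1 : R) != 0 by rewrite -(e n.+1) pnatr_eq0.
    rewrite (e n.+1); move: (n.+1%:R : R) n1 n2 => x n1 n2.
    by field; rewrite n1 n2.
  rewrite lef_pV2 ?posrE ?exprn_gt0 ?mulr_gt0// expr2 ler_wpM2r//.
  by rewrite ler_nat.
by apply: (le_trans (lerD (lexx _) h)); rewrite addrA subrK.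
Qed.

Lemma esum_inv_pow (s : nat) : (2 <= s)%N ->
  (\esum_(n in [set: nat]) (n.+1%:R ^- s : R)%:E = (zeta R s)%:E)%E.
Proof.
move=> s2; rewrite -nneseries_esumT; last first.
  by move=> n; rewrite lee_fin invr_ge0 exprn_ge0.
have nd : nondecreasing_seq (series (fun n : nat => n.+1%:R ^- s : R)).
  by apply/nondecreasing_seqP => n; rewrite seriesSr lerDl invr_ge0 exprn_ge0.
have cv : cvgn (series (fun n : nat => n.+1%:R ^- s : R)).
  apply: nondecreasing_is_cvgn => //; exists 2 => _ [n _ <-].
  exact: series_inv_pow_le2.
rewrite /zeta -EFin_lim//; congr (limn _); apply/funext => n.
by rewrite /eseries/= sumEFin.
Qed.

Lemma has_sum_zeta (s : nat) : (2 <= s)%N ->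
  has_sum (fun n : nat => n.+1%:R ^- s : R) (zeta R s).
Proof.
by move=> s2; apply: has_sum_nneg; [move=> n; rewrite invr_ge0 exprn_ge0|
  exact: esum_inv_pow].
Qed.

(** The term n = 0 is 0 because the inverse of 0 is 0, so the sum is one over nonzero integers. *)
Lemma has_sum_zeta_norm (s : nat) : (2 <= s)%N ->
  has_sum (fun n : int => `|n%:~R : R| ^- s) (2 * zeta R s).
Proof.
move=> s2; rewrite mulr_natl mulr2n; apply: has_sum_int.
- by rewrite normr0 expr0n; case: s s2 => //= s _; rewrite invr0.
- apply: (eq_has_sum _ erefl (has_sum_zeta s2)) => n.
  by rewrite ger0_norm//.
- apply: (eq_has_sum _ erefl (has_sum_zeta s2)) => n.
  by rewrite mulrNz normrN ger0_norm//.
Qed.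

(** For odd s the summand is even in n; for even s it is odd in n and the two half-lines cancel.
    This is where even zeta values drop out of the result. *)
Lemma has_sum_zeta_sg (s : nat) : (2 <= s)%N ->
  has_sum (fun n : int => Num.sg (n%:~R : R) * n%:~R ^- s)
    (if odd s then 2 * zeta R s else 0).
Proof.
move=> s2; case: ifPn => os.
  apply: (eq_has_sum _ erefl (has_sum_zeta_norm s2)) => n.
  case: (sgrP (n%:~R : R)) => [_|_|_].
  - by rewrite mul0r expr0n gtn_eqF ?invr0// ltnW.
  - by rewrite mul1r.
  - by rewrite mulN1r exprNn -signr_odd os expr1 mulN1r invrN.
rewrite -[X in has_sum _ X](subrr (zeta R s)); apply: has_sum_int.
- by rewrite sgr0 mul0r.
- apply: (eq_has_sum _ erefl (has_sum_zeta s2)) => n.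
  by rewrite gtr0_sg ?mul1r// ltr0z.
- apply: (eq_has_sum _ erefl (has_sumN (has_sum_zeta s2))) => n.
  rewrite mulrNz sgrN gtr0_sg ?ltr0z// mulN1r exprNn -signr_odd (negbTE os).
  by rewrite expr0 mul1r.
Qed.

End Zeta.

(** * Integrals with parameters *)

Lemma is_deriveW (R : realType) (f : R -> R) (x d : R) :
  is_derive x 1 f d -> derivable f x 1 /\ 'D_1 f x = d.
Proof. by move=> df; split; [exact: ex_derive|exact: derive_val]. Qed.

Section Moments.
Context d (T : measurableType d) (R : realType).
Variable mu : {measure set T -> \bar R}.

Lemma measurable_inv_ge0 (D : set T) (f : T -> R) :
  measurable D -> (forall x, 0 <= f x) -> measurable_fun D f ->
  measurable_fun D (fun x => (f x)^-1).
Proof.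
move=> mD f0 mf.
have -> : (fun x => (f x)^-1) = (@powR R ^~ (-1)) \o f.
  by apply/funext => x /=; rewrite powR_inv1.
by apply: measurableT_comp => //; exact: measurable_powR.
Qed.

(* Bernoulli's inequality: the tangent of the convex function x^-a *)
Lemma tangent_inv_pow (x y : R) (a : nat) : 0 < x -> 0 < y ->
  x ^- a <= y ^- a + a%:R * (y - x) * x ^- a.+1.
Proof.
move=> x0 y0; have xn0 : x != 0 by rewrite gt_eqF.
have yn0 : y != 0 by rewrite gt_eqF.
have bern (v : R) : 0 <= v -> 1 + a%:R * (v - 1) <= v ^+ a.
  move=> v0; elim: a => [|a ih]; first by rewrite mul0r addr0 expr0.
  rewrite exprS -natr1; apply: le_trans (ler_wpM2l v0 ih).
  rewrite -subr_ge0 (_ : _ - _ = a%:R * (v - 1) ^+ 2); last by ring.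
  by rewrite mulr_ge0 ?sqr_ge0.
have v0 : 0 < x / y by rewrite divr_gt0.
rewrite -subr_ge0; have -> : y ^- a + a%:R * (y - x) * x ^- a.+1 - x ^- a =
    ((x / y) ^+ a - 1 + a%:R * (y / x - 1)) * x ^- a.
  rewrite expr_div_n exprS; have := expf_neq0 a xn0; have := expf_neq0 a yn0.
  move: (x ^+ a) (y ^+ a) => p q q0 p0; field.
  by rewrite xn0 q0 p0.
rewrite mulr_ge0 ?invr_ge0 ?exprn_ge0 ?(ltW x0)//.
have := bern _ (ltW v0).
suff : 0 <= a%:R * (x / y - 1 + (y / x - 1)) by lra.
rewrite mulr_ge0// (_ : _ + _ = (x - y) ^+ 2 / (x * y)).
  by rewrite divr_ge0 ?sqr_ge0// mulr_ge0 ?ltW.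
by field; rewrite xn0 yn0.
Qed.

Variables (wgt X : T -> R).
Hypothesis wgt0 : forall x, 0 <= wgt x.
Hypothesis X0 : forall x, 0 <= X x.
Hypothesis mwgt : measurable_fun [set: T] wgt.
Hypothesis mX : measurable_fun [set: T] X.

Definition moment (a : nat) (N : R) : \bar R :=
  (\int[mu]_x (wgt x * (X x + N ^+ 2) ^- a)%:E)%E.

Lemma measurable_moment a N :
  measurable_fun [set: T] (fun x => wgt x * (X x + N ^+ 2) ^- a).
Proof.
apply: measurable_funM => //; apply: measurable_inv_ge0 => //.
  by move=> x; rewrite exprn_ge0// addr_ge0// sqr_ge0.
by apply: measurable_funX; exact: measurable_funD.
Qed.

Lemma integral_le_affine (f g h : T -> R) (c : R) : 0 <= c ->
  (forall x, 0 <= f x) -> (forall x, 0 <= g x) -> (forall x, 0 <= h x) ->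
  measurable_fun [set: T] f -> measurable_fun [set: T] g ->
  measurable_fun [set: T] h ->
  (forall x, f x <= g x + c * h x) ->
  (\int[mu]_x (f x)%:E <= \int[mu]_x (g x)%:E + c%:E * \int[mu]_x (h x)%:E)%E.
Proof.
move=> c0 f0 g0 h0 mf mg mh fgh.
rewrite -ge0_integralZl_EFin//; last 2 first.
- by move=> x _; rewrite lee_fin.
- exact/measurable_EFinP.
rewrite -ge0_integralD//; last 4 first.
- by move=> x _; rewrite lee_fin.
- exact/measurable_EFinP.
- by move=> x _; rewrite -EFinM lee_fin mulr_ge0.
- by apply/measurable_EFinP; exact: measurable_funM.
apply: ge0_le_integral => //.
- by move=> x _; rewrite lee_fin.
- exact/measurable_EFinP.
- by apply/measurable_EFinP; apply: measurable_funD => //; exact: measurable_funM.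
- by move=> x _; rewrite -EFinM -EFinD lee_fin.
Qed.

(* By convexity of s |-> (X + s)^-a, the moment stays above its tangent, whose
   slope is a multiple of the next moment; no differentiation under the
   integral sign is needed. *)
Lemma momentS (a : nat) (N e : R) (f f' : R -> R) :
  (0 < a)%N -> N != 0 -> 0 < e ->
  (forall x, `|x - N| < e -> moment a x = (f x)%:E) ->
  (forall x, `|x - N| < e -> derivable f x 1 /\ 'D_1 f x = f' x) ->
  moment a.+1 N = (- (f' N) / (2 * N * a%:R))%:E.
Proof.
move=> a0 N0 e0 mf dff'.
have df x : `|x - N| < e -> is_derive x 1 f (f' x).
  by move=> /dff'[? <-]; exact: derivableP.
have int0 b x y : 0 <= wgt y * (X y + x ^+ 2) ^- b.
  by rewrite mulr_ge0// invr_ge0 exprn_ge0// addr_ge0// sqr_ge0.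
have NN : `|N - N| < e by rewrite subrr normr0.
have pN x : 0 < X x + N ^+ 2.
  by rewrite ltr_wpDl// lt_def sqr_ge0 expf_neq0.
have mom0 b x : (0 <= moment b x)%E.
  by apply: integral_ge0 => y _; rewrite lee_fin.
have [g gE] : exists g, moment a.+1 N = g%:E.
  (* Finiteness of the next moment, from (X + N^2)^-1 <= N^-2; the additional summand only brings
     the bound to the shape of [integral_le_affine]. *)
  have : (moment a.+1 N <= moment a N + (N ^- 2)%:E * moment a N)%E.
    apply: integral_le_affine; try exact: measurable_moment;
      try exact: int0.
      by rewrite invr_ge0 sqr_ge0.
    move=> x; rewrite exprS invfM -subr_ge0.
    have -> : wgt x * (X x + N ^+ 2) ^- a +
       N ^- 2 * (wgt x * (X x + N ^+ 2) ^- a) -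
       wgt x * ((X x + N ^+ 2)^-1 / (X x + N ^+ 2) ^+ a) =
       wgt x * (X x + N ^+ 2) ^- a * (1 + (N ^- 2 - (X x + N ^+ 2)^-1)) by ring.
    rewrite mulr_ge0// addr_ge0// subr_ge0 lef_pV2 ?posrE//.
      by rewrite lerDr.
    by rewrite lt_def sqr_ge0 expf_neq0.
  rewrite mf// -EFinM -EFinD; have := mom0 a.+1 N.
  by case: (moment a.+1 N) => [g| |]// _ _; exists g.
have tan y x : 0 < X x + y ^+ 2 -> wgt x * (X x + N ^+ 2) ^- a <=
    wgt x * (X x + y ^+ 2) ^- a +
    a%:R * (y ^+ 2 - N ^+ 2) * (wgt x * (X x + N ^+ 2) ^- a.+1).
  move=> py; have := ler_wpM2l (wgt0 x) (tangent_inv_pow a (pN x) py).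
  by congr (_ <= _); ring.
pose d0 := Num.min e `|N|.
have d00 : 0 < d0 by rewrite lt_min e0 normr_gt0.
have ind y : `|y - N| < d0 -> y != 0 /\ `|y - N| < e.
  rewrite lt_min => /andP[h1 h2]; split => //.
  by apply: contraTneq h2 => ->; rewrite sub0r normrN ltxx.
have key y : `|y - N| < d0 ->
    f N <= f y + a%:R * (y ^+ 2 - N ^+ 2) * g.
  move=> /ind[y0 ye].
  have py x : 0 < X x + y ^+ 2.
    by rewrite ltr_wpDl// lt_def sqr_ge0 expf_neq0.
  (* If the coefficient is negative, its term is moved to the other side of the inequality to keep
     all integrands nonnegative. *)
  have [c0|c0] := leP 0 (a%:R * (y ^+ 2 - N ^+ 2)).
    have := integral_le_affine c0 (int0 a N) (int0 a y) (int0 a.+1 N)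
      (measurable_moment a N) (measurable_moment a y) (measurable_moment _ N)
      (fun x => tan y x (py x)).
    rewrite -![(\int[mu]_x _)%E]/(moment _ _) gE !mf//.
  have c1 : 0 <= - (a%:R * (y ^+ 2 - N ^+ 2)) by rewrite oppr_ge0 ltW.
  have le x : 0 <= wgt x * (X x + N ^+ 2) ^- a +
       - (a%:R * (y ^+ 2 - N ^+ 2)) * (wgt x * (X x + N ^+ 2) ^- a.+1).
    by rewrite addr_ge0// mulr_ge0.
  have : (\int[mu]_x (wgt x * (X x + N ^+ 2) ^- a +
       - (a%:R * (y ^+ 2 - N ^+ 2)) * (wgt x * (X x + N ^+ 2) ^- a.+1))%:E <=
       \int[mu]_x (wgt x * (X x + y ^+ 2) ^- a)%:E)%E.
    apply: ge0_le_integral => //.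
    - by move=> x _; rewrite lee_fin.
    - apply/measurable_EFinP; apply: measurable_funD; first exact: measurable_moment.
      by apply: measurable_funM => //; exact: measurable_moment.
    - by apply/measurable_EFinP; exact: measurable_moment.
    - by move=> x _; rewrite lee_fin; have := tan y x (py x); lra.
  under eq_integral do rewrite EFinD.
  rewrite ge0_integralD//=; last 4 first.
  - by move=> x _; rewrite lee_fin.
  - by apply/measurable_EFinP; exact: measurable_moment.
  - by move=> x _; rewrite lee_fin mulr_ge0.
  - apply/measurable_EFinP; apply: measurable_funM => //.
    exact: measurable_moment.
  under [X in (_ + X <= _)%E]eq_integral do rewrite EFinM.
  rewrite ge0_integralZl_EFin//; last 2 first.
  - by move=> x _; rewrite lee_fin.
  - by apply/measurable_EFinP; exact: measurable_moment.
  rewrite -![(\int[mu]_x _)%E]/(moment _ _) gE !mf//.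
  rewrite lee_fin; lra.
(* By [key], F has a minimum at N, so its derivative vanishes there; that equation determines
   [g]. *)
pose F y := f y + a%:R * (y ^+ 2 - N ^+ 2) * g.
have dF y : `|y - N| < d0 -> is_derive y 1 F (f' y + a%:R * g * (2 * y)).
  move=> /ind[_ ye]; have := df _ ye => dfy.
  have dq : is_derive y 1 (fun y : R => a%:R * (y ^+ 2 - N ^+ 2) * g)
      (a%:R * g * (2 * y)).
    apply: is_derive_eq; rewrite /GRing.scale/= ?(subr0, addr0, mul0r, mulr0, add0r, mulr1, expr1).
    ring.
  exact: is_deriveD.
have inN y : y \in `](N - d0), (N + d0)[ -> `|y - N| < d0.
  by rewrite in_itv/= => /andP[h1 h2]; rewrite ltr_norml; apply/andP; split; lra.
have dF0 : is_derive N 1 F 0.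
  apply: (@derive1_at_min R F (N - d0) (N + d0) N).
  - lra.
  - by move=> t /inN /dF h; apply: ex_derive.
  - by rewrite in_itv/=; apply/andP; split; lra.
  - by move=> t /inN /key; rewrite /F subrr mulr0 mul0r addr0.
have dFN : is_derive N 1 F (f' N + a%:R * g * (2 * N)).
  by apply: dF; rewrite subrr normr0.
have : f' N + a%:R * g * (2 * N) = 0.
  by rewrite -(@derive_val _ _ _ _ _ _ _ dFN) (@derive_val _ _ _ _ _ _ _ dF0).
rewrite gE => h; congr EFin.
have an0 : a%:R != 0 :> R by rewrite pnatr_eq0 -lt0n.
have -> : f' N = - (a%:R * g * (2 * N)) by lra.
field; by rewrite an0 N0.
Qed.

End Moments.

(** [momentS] restated for derivatives that are given through the raising operator -(1 / (2 a N))
    d/dN, the form in which the closed forms provide them. *)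
Lemma moment_recursion d (T : measurableType d) (R : realType)
    (mu : {measure set T -> \bar R}) (wgt X : T -> R) (G : nat -> R -> \bar R)
    (a : nat) (N e : R) (f f' : R -> R) :
  (forall b x, G b x = moment mu wgt X b x) ->
  (forall x, 0 <= wgt x) -> (forall x, 0 <= X x) ->
  measurable_fun [set: T] wgt -> measurable_fun [set: T] X ->
  (0 < a)%N -> N != 0 -> 0 < e ->
  (forall x, `|x - N| < e -> G a x = (f x)%:E /\
     is_derive x 1 f (- (2 * x * a%:R) * f' x)) ->
  G a.+1 N = (f' N)%:E.
Proof.
move=> GE w0 X0 mw mX a0 N0 e0 h; rewrite GE.
have h1 x : `|x - N| < e -> moment mu wgt X a x = (f x)%:E.
  by move=> /h[<- _]; rewrite GE.
have h2 x : `|x - N| < e ->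
    derivable f x 1 /\ 'D_1 f x = - (2 * x * a%:R) * f' x.
  by move=> /h[_]; exact: is_deriveW.
rewrite (momentS w0 X0 mw mX a0 N0 e0 h1 h2); congr EFin.
by field; rewrite pnatr_eq0 -lt0n a0 N0.
Qed.

(** * Cauchy kernels on the line and their convolution *)

Section LineIntegrals.
Variable R : realType.
Notation mu := (@lebesgue_measure R).

Lemma integral_line (f F : R -> R) (lm lp : R) :
  (forall x, 0 <= f x) -> continuous f ->
  (forall x : R, derivable F x 1 /\ 'D_1 F x = f x) ->
  F x @[x --> +oo%R] --> lp -> F x @[x --> -oo%R] --> lm ->
  (\int[mu]_x (f x)%:E = (lp - lm)%:E)%E.
Proof.
move=> f0 cf dFf Flp Flm.
have dF (x : R) : is_derive x 1 F (f x) by have [? <-] := dFf x; exact: derivableP.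
have cF : continuous F.
  by move=> x; apply/differentiable_continuous/derivable1_diffP; exact: ex_derive.
have mf : measurable_fun [set: R] f by exact: continuous_measurable_fun.
have cfN : continuous (f \o -%R).
  by move=> x; apply: continuous_comp; [exact: opp_continuous|exact: cf].
rewrite -(setUv `]-oo, (- 0)%R]%classic) ge0_integral_setU//=; last 4 first.
- exact: measurableC.
- by apply/measurable_EFinP; rewrite setUv.
- by move=> x _; rewrite lee_fin.
- exact/disj_setPCl.
rewrite setCitvl integral_itv_obnd_cbnd; last exact/measurable_EFinP/measurable_funTS.
rewrite ge0_integration_by_substitutionNy//; last exact: continuous_subspaceT.
rewrite oppr0.
rewrite (@ge0_continuous_FTC2y _ f F 0 lp)//; last 3 first.
- exact: continuous_subspaceT.
- exact/cvg_at_right_filter/cF.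
- by move=> x _; rewrite derive1E; exact: derive_val.
rewrite (@ge0_continuous_FTC2y _ (f \o -%R) (fun x => - F (- x)) 0 (- lm))//=; last 4 first.
- exact: continuous_subspaceT.
- have Fn : F (- x) @[x --> +oo] --> lm by apply/(cvgNy_compNP F).
  exact: cvgN.
- apply: cvg_at_right_filter; apply: cvgN.
  by apply: continuous_comp; [exact: opp_continuous|exact: cF].
- by move=> x _; rewrite derive1E derive_val /GRing.scale/= ?mulN1r ?mulrN1 ?opprK.
by rewrite oppr0 -!EFinB -EFinD; congr EFin; ring.
Qed.

Lemma cvgNy_atan : (@atan R) x @[x --> -oo] --> - (pi / 2).
Proof.
apply/cvgNy_compNP.
rewrite (_ : atan \o -%R = fun x => - atan x); last first.
  by apply/funext => x /=; rewrite atanN.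
by apply: cvgN; exact: cvgy_atan.
Qed.

Lemma is_derive_atan_scale (A c x : R) : A != 0 ->
  is_derive x 1 (fun x => atan ((x + c) / A) : R) (A / ((x + c) ^+ 2 + A ^+ 2)).
Proof.
move=> A0.
have d : is_derive x 1 (fun x : R => (x + c) / A) A^-1.
  by apply: is_derive_eq; rewrite /GRing.scale/= !(mulr0, add0r, addr0, mulr1).
suff -> : A / ((x + c) ^+ 2 + A ^+ 2) = (1 + ((x + c) / A) ^+ 2)^-1 * A^-1.
  exact: (@is_derive1_comp _ (@atan R) (fun x => (x + c) / A)).
have p : 0 < (x + c) ^+ 2 + A ^+ 2.
  by rewrite ltr_wpDl ?sqr_ge0// lt_def sqr_ge0 expf_neq0.
have p' : 0 < A ^+ 2 + (x + c) ^+ 2 by rewrite addrC.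
have q : 1 + ((x + c) / A) ^+ 2 != 0.
  by rewrite gt_eqF// ltr_wpDr ?sqr_ge0.
have -> : 1 + ((x + c) / A) ^+ 2 = ((x + c) ^+ 2 + A ^+ 2) / A ^+ 2.
  by field.
by field; rewrite A0 !gt_eqF.
Qed.

Lemma cvgy_atan_scale (A c : R) : 0 < A ->
  atan ((x + c) / A) @[x --> +oo%R] --> pi / 2.
Proof.
move=> A0; apply: (@cvg_comp _ _ _ (fun x : R => (x + c) / A) (@atan R) _ (+oo%R)).
  by apply: gt0_cvgMly; [rewrite invr_gt0|exact: cvg_addrr].
exact: cvgy_atan.
Qed.

Lemma cvgNy_atan_scale (A c : R) : 0 < A ->
  atan ((x + c) / A) @[x --> -oo%R] --> - (pi / 2).
Proof.
move=> A0; apply: (@cvg_comp _ _ _ (fun x : R => (x + c) / A) (@atan R) _ (-oo%R)).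
  by apply: gt0_cvgMlNy; [rewrite invr_gt0|exact: cvg_addrr_Ny].
exact: cvgNy_atan.
Qed.

Lemma is_derive_continuous (f : R -> R) (x d : R) :
  is_derive x 1 f d -> {for x, continuous f}.
Proof.
move=> df; apply: differentiable_continuous; apply/derivable1_diffP.
exact: ex_derive.
Qed.

Lemma sqrD_gt0 (x A : R) : A != 0 -> 0 < x ^+ 2 + A ^+ 2.
Proof. by move=> A0; rewrite ltr_wpDl ?sqr_ge0// lt_def sqr_ge0 expf_neq0. Qed.

Lemma continuous_inv_sqrD (A c : R) : A != 0 ->
  continuous (fun x : R => ((x + c) ^+ 2 + A ^+ 2)^-1).
Proof.
move=> A0 x; apply: cvgV; first by rewrite gt_eqF// sqrD_gt0.
have d : is_derive x 1 (fun x : R => (x + c) ^+ 2 + A ^+ 2) (2 * (x + c)).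
  by apply: is_derive_eq; rewrite /GRing.scale/= ?expr1; ring.
exact: (is_derive_continuous d).
Qed.

Lemma cauchy_integral (A : R) : 0 < A ->
  (\int[mu]_x ((x ^+ 2 + A ^+ 2)^-1)%:E = (pi / A)%:E)%E.
Proof.
move=> A0; have An : A != 0 by rewrite gt_eqF.
rewrite (@integral_line _ (fun x => A^-1 * atan ((x + 0) / A))
   (A^-1 * - (pi / 2)) (A^-1 * (pi / 2))).
- by congr EFin; field.
- by move=> x; rewrite invr_ge0 ltW// sqrD_gt0.
- have := continuous_inv_sqrD (c := 0) An.
  by under eq_fun do rewrite addr0.
- move=> x; have := is_derive_atan_scale 0 x An => d.
  suff df : is_derive x 1 (fun x => A^-1 * atan ((x + 0) / A)) ((x ^+ 2 + A ^+ 2)^-1).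
    by split; [exact: ex_derive|exact: derive_val].
  apply: is_derive_eq; rewrite /GRing.scale/= !addr0.
  by have := sqrD_gt0 x An => p; field; rewrite An gt_eqF.
- by apply: cvgMr; exact: cvgy_atan_scale.
- by apply: cvgMr; exact: cvgNy_atan_scale.
Qed.

(** In the variable y = 1/x the ratio is continuous at 0 with value 1; the filter is left general to
    treat both ends of the line at once. *)
Lemma cvg_ln_ratio (A B k : R) (F : set_system R) {FF : Filter F} :
  A != 0 -> B != 0 -> x^-1 @[x --> F] --> (0:R) -> (\forall x \near F, x != 0) ->
  ln (((x + k) ^+ 2 + B ^+ 2) / (x ^+ 2 + A ^+ 2)) @[x --> F] --> (0:R).
Proof.
move=> A0 B0 x0 xn0.
pose g (y : R) := ln (((1 + k * y) ^+ 2 + B ^+ 2 * y ^+ 2) / (1 + A ^+ 2 * y ^+ 2)).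
have h : g (x^-1) @[x --> F] --> (0:R).
  apply: (@cvg_comp _ _ _ (fun x : R => x^-1) g _ (nbhs (0:R))) => //.
  suff gl : g y @[y --> (0:R)] --> g 0.
    move: gl; rewrite [X in _ --> X](_ : g 0 = 0)//.
    by rewrite /g !expr0n/= !(mulr0, mulr0n, addr0) expr1n divr1 ln1.
  have e1 : ((1 + k * 0) ^+ 2 + B ^+ 2 * 0 ^+ 2) / (1 + A ^+ 2 * 0 ^+ 2) = 1 :> R.
    by rewrite !expr0n/= !(mulr0, mulr0n, addr0) expr1n divr1.
  apply: (@continuous_comp _ _ _
    (fun y => ((1 + k * y) ^+ 2 + B ^+ 2 * y ^+ 2) / (1 + A ^+ 2 * y ^+ 2))
    (@ln R)); last by rewrite /= e1; exact: continuous_ln.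
  have e : 1 + A ^+ 2 * 0 ^+ 2 != 0 :> R by rewrite expr0n mulr0 addr0 oner_neq0.
  have d : is_derive (0 : R) 1 (fun y : R => (1 + k * y) ^+ 2 + B ^+ 2 * y ^+ 2) (2 * k).
    by apply: is_derive_eq; rewrite /GRing.scale/= ?expr1; ring.
  have d' : is_derive (0 : R) 1 (fun y : R => 1 + A ^+ 2 * y ^+ 2) 0.
    by apply: is_derive_eq; rewrite /GRing.scale/= ?expr1; ring.
  apply: cvgM; first exact: (is_derive_continuous d).
  by apply: cvgV => //; exact: (is_derive_continuous d').
apply: cvg_trans h; apply: near_eq_cvg; near=> x; rewrite /g; congr ln.
have xn : x != 0 by near: x.
have p : 1 + A ^+ 2 * x^-1 ^+ 2 != 0.
  by rewrite gt_eqF// ltr_wpDr// mulr_ge0 ?sqr_ge0.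
have q := sqrD_gt0 x A0.
have -> : 1 + A ^+ 2 * x^-1 ^+ 2 = (x ^+ 2 + A ^+ 2) / x ^+ 2 by field.
by field; rewrite xn gt_eqF.
Unshelve. all: by end_near. Qed.

(** Cauchy kernels form a convolution semigroup: the scales A and B combine to A + B. *)
Definition convolution_value (A B k : R) : R :=
  pi * (A + B) / (A * B * ((A + B) ^+ 2 + k ^+ 2)).

Lemma line_integral_convolution_neq (A B k : R) : 0 < A -> 0 < B ->
  (k != 0) || (A != B) ->
  (\int[mu]_x ((x ^+ 2 + A ^+ 2)^-1 * ((x + k) ^+ 2 + B ^+ 2)^-1)%:E =
   (convolution_value A B k)%:E)%E.
Proof.
move=> A0 B0 kAB; have An : A != 0 by rewrite gt_eqF.
have Bn : B != 0 by rewrite gt_eqF.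
(* Common denominator of the partial fractions. It vanishes only for k = 0 and A = B, where the
   poles of the two factors coincide; that case is treated separately. *)
pose D := (k ^+ 2 + (A - B) ^+ 2) * (k ^+ 2 + (A + B) ^+ 2).
have D1 : 0 < k ^+ 2 + (A - B) ^+ 2.
  by rewrite lt_def addr_ge0 ?sqr_ge0// paddr_eq0 ?sqr_ge0// !expf_eq0/= subr_eq0 negb_and kAB.
have AB0 : A + B != 0 by rewrite gt_eqF// addr_gt0.
have D2 : 0 < k ^+ 2 + (A + B) ^+ 2 by exact: sqrD_gt0.
have D2' : 0 < (A + B) ^+ 2 + k ^+ 2 by rewrite addrC.
have Dp : 0 < D by exact: mulr_gt0.
pose b := (k ^+ 2 + B ^+ 2 - A ^+ 2) / D.
pose c := (k ^+ 2 + A ^+ 2 - B ^+ 2) / D.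
pose F (x : R) := k / D * ln (((x + k) ^+ 2 + B ^+ 2) / (x ^+ 2 + A ^+ 2)) +
  (b / A * atan ((x + 0) / A) + c / B * atan ((x + k) / B)).
have pA x := sqrD_gt0 x An.
have pB x := sqrD_gt0 (x + k) Bn.
rewrite (@integral_line _ F
   (k / D * 0 + (b / A * - (pi / 2) + c / B * - (pi / 2)))
   (k / D * 0 + (b / A * (pi / 2) + c / B * (pi / 2)))).
- congr EFin; rewrite /convolution_value /b /c /D.
  by field; rewrite An Bn !gt_eqF.
- by move=> x; rewrite mulr_ge0// invr_ge0 ltW.
- move=> x; apply: cvgM.
    have := continuous_inv_sqrD (c := 0) An.
    by under eq_fun do rewrite addr0; apply.
  exact: continuous_inv_sqrD.
- move=> x; have d1 := is_derive_atan_scale 0 x An.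
  have d2 := is_derive_atan_scale k x Bn.
  have dr : is_derive x 1 (fun x : R => ((x + k) ^+ 2 + B ^+ 2) / (x ^+ 2 + A ^+ 2))
     ((2 * (x + k) * (x ^+ 2 + A ^+ 2) - ((x + k) ^+ 2 + B ^+ 2) * (2 * x)) /
      (x ^+ 2 + A ^+ 2) ^+ 2).
    have e1 : is_derive x 1 (fun x : R => (x + k) ^+ 2 + B ^+ 2) (2 * (x + k)).
      by apply: is_derive_eq; rewrite /GRing.scale/= ?expr1; ring.
    have e2 : is_derive x 1 (fun x : R => x ^+ 2 + A ^+ 2) (2 * x).
      by apply: is_derive_eq; rewrite /GRing.scale/= ?expr1; ring.
    have e3 : is_derive x 1 (fun x : R => (x ^+ 2 + A ^+ 2)^-1) (- (x ^+ 2 + A ^+ 2) ^- 2 * (2 * x)).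
      by apply: is_deriveV; rewrite gt_eqF.
    apply: is_derive_eq; rewrite /GRing.scale/=; field.
    by rewrite gt_eqF.
  have dl : is_derive x 1 (fun x : R => ln (((x + k) ^+ 2 + B ^+ 2) / (x ^+ 2 + A ^+ 2)))
     (2 * (x + k) / ((x + k) ^+ 2 + B ^+ 2) - 2 * x / (x ^+ 2 + A ^+ 2)).
    have dln := @is_derive1_ln R (((x + k) ^+ 2 + B ^+ 2) / (x ^+ 2 + A ^+ 2))
       (divr_gt0 (pB x) (pA x)).
    have := @is_derive1_comp _ (@ln R)
        (fun x : R => ((x + k) ^+ 2 + B ^+ 2) / (x ^+ 2 + A ^+ 2)) _ _ _ dln dr.
    congr is_derive.
    by field; rewrite !gt_eqF.
  suff df : is_derive x 1 F ((x ^+ 2 + A ^+ 2)^-1 * ((x + k) ^+ 2 + B ^+ 2)^-1).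
    by split; [exact: ex_derive|exact: derive_val].
  apply: is_derive_eq; rewrite /GRing.scale/= addr0 /b /c /D.
  by field; rewrite An Bn !gt_eqF.
- apply: cvgD; last by apply: cvgD; apply: cvgMr; exact: cvgy_atan_scale.
  apply: cvgMr; apply: cvg_ln_ratio => //.
    by apply/gtr0_cvgV0 => //; exact: nbhs_pinfty_gt.
  by near=> x; rewrite gt_eqF//; near: x; exact: nbhs_pinfty_gt.
- apply: cvgD; last by apply: cvgD; apply: cvgMr; exact: cvgNy_atan_scale.
  apply: cvgMr; apply: cvg_ln_ratio => //.
    by apply/ltr0_cvgV0 => //; exact: nbhs_ninfty_lt.
  by near=> x; rewrite lt_eqF//; near: x; exact: nbhs_ninfty_lt.
Unshelve. all: by end_near. Qed.

End LineIntegrals.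

(** * Differentiation rules in logarithmic form *)

Section LogDerivatives.
Variable R : realType.
Implicit Types f g : R -> R.

Lemma eq_is_derive f g (x d d' : R) : is_derive x 1 f d -> f =1 g -> d = d' ->
  is_derive x 1 g d'.
Proof. by move=> df /funext <- <-. Qed.

(** With derivatives written as f * u, factors of a monomial contribute additively to u, and the
    derivative of a monomial is visibly the monomial times a sum. *)
Lemma is_derive_expn_log f (x u : R) (n : nat) :
  is_derive x 1 f (f x * u) -> is_derive x 1 (fun x => f x ^+ n) (f x ^+ n * (n%:R * u)).
Proof.
case: n => [|n] df.
  under eq_fun do rewrite expr0.
  by rewrite mul0r mulr0; exact: is_derive_cst.
apply: (eq_is_derive (is_deriveX n.+1 df)) => [y|].
  by rewrite !fctE.
by rewrite exprS /GRing.scale/=; ring.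
Qed.

Lemma is_derive_mul_log f g (x u v : R) :
  is_derive x 1 f (f x * u) -> is_derive x 1 g (g x * v) ->
  is_derive x 1 (fun x => f x * g x) (f x * g x * (u + v)).
Proof.
move=> df dg; apply: (eq_is_derive (is_deriveM df dg)) => //.
by rewrite /GRing.scale/=; ring.
Qed.

Lemma is_derive_inv_log f (x u : R) : f x != 0 ->
  is_derive x 1 f (f x * u) -> is_derive x 1 (fun x => (f x)^-1) ((f x)^-1 * - u).
Proof.
move=> fx0 df; apply: (eq_is_derive (is_deriveV fx0 df)) => //.
by rewrite /GRing.scale/=; field.
Qed.

Lemma is_derive_id_log (x : R) : x != 0 -> is_derive x 1 (fun x : R => x) (x * x^-1).
Proof. by move=> x0; rewrite mulfV//; exact: is_derive_id. Qed.

Lemma is_derive_cst_log (c x : R) : is_derive x 1 (fun _ : R => c) (c * 0).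
Proof. by rewrite mulr0; exact: is_derive_cst. Qed.

Lemma is_derive_bigsum (I : Type) (l : seq I) (f : I -> R -> R) (f' : I -> R) (x : R) :
  (forall i, is_derive x 1 (f i) (f' i)) ->
  is_derive x 1 (fun x => \sum_(i <- l) f i x) (\sum_(i <- l) f' i).
Proof.
move=> df; elim: l => [|i l ih].
  rewrite big_nil; under eq_fun do rewrite big_nil; exact: is_derive_cst.
rewrite big_cons; under eq_fun do rewrite big_cons.
by have := is_deriveD (df i) ih.
Qed.

End LogDerivatives.

(** * Closed forms *)

(** [op a] raises an exponent from [a] to [a.+1], so the iteration applies [op 1] first and [op n]
    last and reaches the exponent [n.+1]. *)
Definition iter_op (T : Type) (op : nat -> T -> T) :=
  fix F (n : nat) (l : T) : T := if n is n'.+1 then op n (F n' l) else l.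

(* Formal linear combinations of the monomials x^-p y^-q V^r where
   V = x y / (z^2 - (x - y)^2). *)
Section PairMonomials.
Variable R : realType.

Definition pair_comb := seq (rat * (nat * nat * nat)).

(** V has degree 0 and equals 1/4 on the plane x + y + z = 0, so powers of V affect neither the
    homogeneity nor, on the plane, the dependence on x and y. *)
Definition pair_V (x y z : R) : R := x * y / (z ^+ 2 - (x - y) ^+ 2).

Definition pair_mon (m : nat * nat * nat) (x y z : R) : R :=
  x ^- m.1.1 * y ^- m.1.2 * pair_V x y z ^+ m.2.

Definition pair_eval (l : pair_comb) (x y z : R) : R :=
  \sum_(m <- l) ratr m.1 * pair_mon m.2 x y z.

(* -(1 / (2 a x)) d/dx *)
Definition pair_dx (a : nat) (l : pair_comb) : pair_comb :=
  flatten [seq (let: (c, (p, q, r)) := m in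
    [:: (c * (p%:R - r%:R) / (2 * a%:R), (p.+2, q, r));
        (- (c * r%:R / a%:R), (p.+1, q.+1, r.+1));
        (c * r%:R / a%:R, (p.+2, q, r.+1))]) | m <- l].

Definition pair_swap (l : pair_comb) : pair_comb :=
  [seq (m.1, (m.2.1.2, m.2.1.1, m.2.2)) | m <- l].

Definition pair_dy (a : nat) (l : pair_comb) : pair_comb :=
  pair_swap (pair_dx a (pair_swap l)).

(** The operator -(1 / (2 a z)) d/dz; one monomial suffices because dV/dz = -2 z V^2 / (x y). *)
Definition pair_dz (a : nat) (l : pair_comb) : pair_comb :=
  [seq (let: (c, (p, q, r)) := m in (c * r%:R / a%:R, (p.+1, q.+1, r.+1))) | m <- l].

(** x^-2 y^-2 V = 1 / (x y (z^2 - (x - y)^2)), one summand of the closed form for a_1 = a_2 = a_3 =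
    1, without its sign and pi^2. *)
Definition pair_start : pair_comb := [:: (1, (2, 2, 1)%N)].

Lemma pair_eval_swap l x y z : pair_eval (pair_swap l) x y z = pair_eval l y x z.
Proof.
rewrite /pair_eval big_map; apply: eq_bigr => -[c [[p q] r]] _ /=.
rewrite /pair_mon/= /pair_V -(sqrrN (x - y)) opprB (mulrC x y).
by rewrite (mulrC (x ^- q)).
Qed.

Lemma is_derive_pair_x (l : pair_comb) (a : nat) (x y z : R) :
  (0 < a)%N -> x != 0 -> y != 0 -> z ^+ 2 - (x - y) ^+ 2 != 0 ->
  is_derive x 1 (fun x => pair_eval l x y z)
    (- (2 * x * a%:R) * pair_eval (pair_dx a l) x y z).
Proof.
move=> a0 x0 y0 Q0; have an0 : a%:R != 0 :> R by rewrite pnatr_eq0 -lt0n.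
set V := pair_V x y z.
have dQ : is_derive x 1 (fun x => z ^+ 2 - (x - y) ^+ 2)
    ((z ^+ 2 - (x - y) ^+ 2) * (- (2 * (x - y)) / (z ^+ 2 - (x - y) ^+ 2))).
  by apply: is_derive_eq; rewrite /GRing.scale/= ?expr1; field.
(* The logarithmic derivative is a polynomial in 1/x, 1/y and V, since 1 / (z^2 - (x - y)^2) = V /
   (x y). Hence the monomials are closed under the operators. *)
have dV : is_derive x 1 (fun x => pair_V x y z) (V * (x^-1 + 2 * V * (y^-1 - x^-1))).
  have := is_derive_mul_log (is_derive_mul_log (is_derive_id_log x0)
    (is_derive_cst_log y x))
    (@is_derive_inv_log _ (fun x => z ^+ 2 - (x - y) ^+ 2) _ _ Q0 dQ).
  by move=> /eq_is_derive; apply => //; rewrite /V /pair_V; field; rewrite x0 y0 Q0.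
have dmon m : is_derive x 1 (fun x => ratr m.1 * pair_mon m.2 x y z)
   (ratr m.1 * pair_mon m.2 x y z *
     (- (m.2.1.1%:R / x) + m.2.2%:R * (x^-1 + 2 * V * (y^-1 - x^-1)))).
  have := is_derive_mul_log (is_derive_cst_log (ratr m.1) x)
     (is_derive_mul_log (is_derive_mul_log
     (@is_derive_inv_log _ (fun x => x ^+ m.2.1.1) _ _ (expf_neq0 m.2.1.1 x0)
       (is_derive_expn_log m.2.1.1 (is_derive_id_log x0)))
     (is_derive_cst_log (y ^- m.2.1.2) x)) (@is_derive_expn_log _ (fun t => pair_V t y z) _ _ m.2.2 dV)).
  by move=> /eq_is_derive; apply => [t|]; rewrite /pair_mon /=; ring.
have := is_derive_bigsum l dmon.
move=> /eq_is_derive; apply => //.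
rewrite /pair_eval /pair_dx big_flatten/= big_map mulr_sumr.
apply: eq_bigr => -[c [[p q] r]] _ /=.
rewrite 2!big_cons big_seq1/= /pair_mon/= -/V.
rewrite !(rmorphN, rmorphM, rmorphB, fmorphV) !rmorph_nat/=.
rewrite !exprS !invfM; move: (x ^- p) (y ^- q) (V ^+ r) (ratr c) => xp yq Vr c'.
by field; rewrite an0 x0 y0.
Qed.

Lemma is_derive_pair_y (l : pair_comb) (a : nat) (x y z : R) :
  (0 < a)%N -> x != 0 -> y != 0 -> z ^+ 2 - (x - y) ^+ 2 != 0 ->
  is_derive y 1 (fun y => pair_eval l x y z)
    (- (2 * y * a%:R) * pair_eval (pair_dy a l) x y z).
Proof.
move=> a0 x0 y0; rewrite -(sqrrN (x - y)) opprB => Q0.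
rewrite pair_eval_swap; under eq_fun do rewrite -pair_eval_swap.
exact: is_derive_pair_x.
Qed.

Lemma is_derive_pair_z (l : pair_comb) (a : nat) (x y z : R) :
  (0 < a)%N -> x != 0 -> y != 0 -> z ^+ 2 - (x - y) ^+ 2 != 0 ->
  is_derive z 1 (fun z => pair_eval l x y z)
    (- (2 * z * a%:R) * pair_eval (pair_dz a l) x y z).
Proof.
move=> a0 x0 y0 Q0; have an0 : a%:R != 0 :> R by rewrite pnatr_eq0 -lt0n.
set V := pair_V x y z.
have dQ : is_derive z 1 (fun z => z ^+ 2 - (x - y) ^+ 2)
    ((z ^+ 2 - (x - y) ^+ 2) * (2 * z / (z ^+ 2 - (x - y) ^+ 2))).
  by apply: is_derive_eq; rewrite /GRing.scale/= ?expr1; field.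
have dV : is_derive z 1 (fun z => pair_V x y z) (V * - (2 * z * V / (x * y))).
  have := is_derive_mul_log (is_derive_cst_log (x * y) z)
    (@is_derive_inv_log _ (fun z => z ^+ 2 - (x - y) ^+ 2) _ _ Q0 dQ).
  by move=> /eq_is_derive; apply => //; rewrite /V /pair_V; field; rewrite x0 y0 Q0.
have dmon m : is_derive z 1 (fun z => ratr m.1 * pair_mon m.2 x y z)
   (ratr m.1 * pair_mon m.2 x y z * (m.2.2%:R * - (2 * z * V / (x * y)))).
  have := is_derive_mul_log (is_derive_cst_log (ratr m.1) z)
     (is_derive_mul_log (is_derive_cst_log (x ^- m.2.1.1 * y ^- m.2.1.2) z)
     (@is_derive_expn_log _ (fun t => pair_V x y t) _ _ m.2.2 dV)).
  by move=> /eq_is_derive; apply => [t|]; rewrite /pair_mon /=; ring.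
have := is_derive_bigsum l dmon.
move=> /eq_is_derive; apply => //.
rewrite /pair_eval /pair_dz big_map mulr_sumr.
apply: eq_bigr => -[c [[p q] r]] _ /=.
rewrite /pair_mon/= -/V.
rewrite !(rmorphM, fmorphV) !rmorph_nat/=.
rewrite !exprS !invfM; move: (x ^- p) (y ^- q) (V ^+ r) (ratr c) => xp yq Vr c'.
by field; rewrite an0 x0 y0.
Qed.

(** Exponents at least 2 make the lattice sums converge; p + q is minus the degree of
    homogeneity. *)
Definition pair_ok (n : nat) (l : pair_comb) : bool :=
  all (fun m => [&& 2 <= m.2.1.1, 2 <= m.2.1.2 & m.2.1.1 + m.2.1.2 == n])%N l.

Lemma pair_ok_dx n a l : pair_ok n l -> pair_ok n.+2 (pair_dx a l).
Proof.
move=> /allP okl; apply/allP => m /flattenP[s /mapP[[c [[p q] r]] /okl /= /and3P[h1 h2 /eqP h3] ->]].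
by rewrite !inE => /or3P[] /eqP -> /=; lia.
Qed.

Lemma pair_ok_swap n l : pair_ok n (pair_swap l) = pair_ok n l.
Proof.
rewrite /pair_ok /pair_swap all_map; apply: eq_all => -[c [[p q] r]] /=; lia.
Qed.

Lemma pair_ok_dy n a l : pair_ok n l -> pair_ok n.+2 (pair_dy a l).
Proof. by move=> okl; rewrite pair_ok_swap pair_ok_dx// pair_ok_swap. Qed.

Lemma pair_ok_dz n a l : pair_ok n l -> pair_ok n.+2 (pair_dz a l).
Proof.
rewrite /pair_ok all_map; apply: sub_all => -[c [[p q] r]] /=; lia.
Qed.

Lemma pair_ok_iter (op : nat -> pair_comb -> pair_comb) n b l :
  (forall n a l, pair_ok n l -> pair_ok n.+2 (op a l)) ->
  pair_ok n l -> pair_ok (n + b.*2) (iter_op op b l).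
Proof.
move=> opok okl; elim: b => [|b ih]; first by rewrite addn0.
by rewrite doubleS !addnS; exact: opok.
Qed.

End PairMonomials.

(* Formal linear combinations of the monomials x^-p y^-q M^-(l+1) W^r where
   M = x + y and W = M^2 / (k^2 + M^2). *)
Section LineMonomials.
Variable R : realType.

Definition line_comb := seq (rat * (nat * nat * nat * nat)).

(** W has degree 0, and [convolution_value x y k] is pi W / (x y M). *)
Definition line_W (x y k : R) : R := (x + y) ^+ 2 / (k ^+ 2 + (x + y) ^+ 2).

Definition line_mon (m : nat * nat * nat * nat) (x y k : R) : R :=
  x ^- m.1.1.1 * y ^- m.1.1.2 * (x + y) ^- m.1.2.+1 * line_W x y k ^+ m.2.

Definition line_eval (l : line_comb) (x y k : R) : R :=
  \sum_(m <- l) ratr m.1 * line_mon m.2 x y k.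

(* -(1 / (2 a x)) d/dx *)
Definition line_dx (a : nat) (l : line_comb) : line_comb :=
  flatten [seq (let: (c, (p, q, l, r)) := m in
    [:: (c * p%:R / (2 * a%:R), (p.+2, q, l, r));
        (c * (l.+1%:R / 2 - r%:R) / a%:R, (p.+1, q, l.+1, r));
        (c * r%:R / a%:R, (p.+1, q, l.+1, r.+1))]) | m <- l].

Definition line_swap (l : line_comb) : line_comb :=
  [seq (m.1, (m.2.1.1.2, m.2.1.1.1, m.2.1.2, m.2.2)) | m <- l].

Definition line_dy (a : nat) (l : line_comb) : line_comb :=
  line_swap (line_dx a (line_swap l)).

Definition line_start (l r : nat) : line_comb := [:: (1, (1, 1, l, r)%N)].

Lemma line_eval_swap l x y k : line_eval (line_swap l) x y k = line_eval l y x k.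
Proof.
rewrite /line_eval big_map; apply: eq_bigr => -[c [[[p q] l'] r]] _ /=.
by rewrite /line_mon/= /line_W (addrC x y) (mulrC (x ^- q)).
Qed.

Lemma is_derive_line_x (l : line_comb) (a : nat) (x y k : R) :
  (0 < a)%N -> x != 0 -> x + y != 0 ->
  is_derive x 1 (fun x => line_eval l x y k)
    (- (2 * x * a%:R) * line_eval (line_dx a l) x y k).
Proof.
move=> a0 x0 M0; have an0 : a%:R != 0 :> R by rewrite pnatr_eq0 -lt0n.
have D0 : k ^+ 2 + (x + y) ^+ 2 != 0 by rewrite gt_eqF// sqrD_gt0.
set W := line_W x y k.
have dD : is_derive x 1 (fun x => k ^+ 2 + (x + y) ^+ 2)
    ((k ^+ 2 + (x + y) ^+ 2) * (2 * (x + y) / (k ^+ 2 + (x + y) ^+ 2))).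
  rewrite mulrC divfK//.
  apply: is_derive_eq; rewrite /GRing.scale/= ?expr1; ring.
have dM : is_derive x 1 (fun x => x + y) ((x + y) * (x + y)^-1).
  by rewrite mulfV//; apply: is_derive_eq; rewrite addr0.
have dW : is_derive x 1 (fun x => line_W x y k) (W * (2 / (x + y) * (1 - W))).
  have := is_derive_mul_log (@is_derive_expn_log _ (fun x => x + y) _ _ 2 dM)
    (@is_derive_inv_log _ (fun x => k ^+ 2 + (x + y) ^+ 2) _ _ D0 dD).
  by move=> /eq_is_derive; apply => //; rewrite /W /line_W; field; rewrite M0 D0.
have dmon m : is_derive x 1 (fun x => ratr m.1 * line_mon m.2 x y k)
   (ratr m.1 * line_mon m.2 x y k *
     (- (m.2.1.1.1%:R / x) - m.2.1.2.+1%:R / (x + y) +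
      m.2.2%:R * (2 / (x + y) * (1 - W)))).
  have := is_derive_mul_log (is_derive_cst_log (ratr m.1) x)
     (is_derive_mul_log (is_derive_mul_log (is_derive_mul_log
     (@is_derive_inv_log _ (fun x => x ^+ m.2.1.1.1) _ _ (expf_neq0 m.2.1.1.1 x0)
       (is_derive_expn_log m.2.1.1.1 (is_derive_id_log x0)))
     (is_derive_cst_log (y ^- m.2.1.1.2) x))
     (@is_derive_inv_log _ (fun x => (x + y) ^+ m.2.1.2.+1) _ _ (expf_neq0 m.2.1.2.+1 M0)
       (@is_derive_expn_log _ (fun x => x + y) _ _ m.2.1.2.+1 dM)))
     (@is_derive_expn_log _ (fun t => line_W t y k) _ _ m.2.2 dW)).
  by move=> /eq_is_derive; apply => [t|]; rewrite /line_mon /=; ring.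
have := is_derive_bigsum l dmon.
move=> /eq_is_derive; apply => //.
rewrite /line_eval /line_dx big_flatten/= big_map mulr_sumr.
apply: eq_bigr => -[c [[[p q] i] r]] _ /=.
rewrite 2!big_cons big_seq1/= /line_mon/= -/W.
rewrite !(rmorphN, rmorphM, rmorphB, fmorphV) !rmorph_nat/=.
rewrite !exprS !invfM; move: (x ^- p) (y ^- q) (W ^+ r) (ratr c) ((x + y) ^- i).
move=> xp yq Wr c' Mi.
by field; rewrite an0 x0 M0.
Qed.

Lemma is_derive_line_y (l : line_comb) (a : nat) (x y k : R) :
  (0 < a)%N -> y != 0 -> x + y != 0 ->
  is_derive y 1 (fun y => line_eval l x y k)
    (- (2 * y * a%:R) * line_eval (line_dy a l) x y k).
Proof.
move=> a0 y0; rewrite addrC => M0.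
rewrite line_eval_swap; under eq_fun do rewrite -line_eval_swap.
exact: is_derive_line_x.
Qed.

(* kap r is the integral of (1 + u^2)^-r over the line for r > 0. *)
Fixpoint kap (r : nat) : R :=
  if r is r'.+1 then
    if r' is 0%N then pi else kap r' * ((2 * r'%:R - 1) / (2 * r'%:R))
  else 0.

(** The convention [kap 0 = 0] makes the case r = 0 hold. *)
Lemma kapS r : r%:R * kap r.+1 = (r%:R - 2^-1) * kap r.
Proof.
case: r => [|r]; first by rewrite mul0r mulr0.
have r0 : r.+1%:R != 0 :> R by rewrite pnatr_eq0.
have -> : kap r.+2 = kap r.+1 * ((2 * r.+1%:R - 1) / (2 * r.+1%:R)) by [].
move: (r.+1%:R : R) (kap r.+1) r0 => n K r0.
by field.
Qed.

(** The integral of [line_eval] over k: W^r contributes [kap r] times M, which lowers M^-(l+1) to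
    M^-l. For r = 0 that integral diverges and the value 0 stands in for it. *)
Definition line_int (l : line_comb) (x y : R) : R :=
  \sum_(m <- l) ratr m.1 * kap m.2.2 *
    (x ^- m.2.1.1.1 * y ^- m.2.1.1.2 * (x + y) ^- m.2.1.2).

Lemma line_int_swap l x y : line_int (line_swap l) x y = line_int l y x.
Proof.
rewrite /line_int big_map; apply: eq_bigr => -[c [[[p q] l'] r]] _ /=.
by rewrite (addrC x y) (mulrC (x ^- q)).
Qed.

Lemma is_derive_line_int_x (l : line_comb) (a : nat) (x y : R) :
  (0 < a)%N -> x != 0 -> x + y != 0 ->
  is_derive x 1 (fun x => line_int l x y)
    (- (2 * x * a%:R) * line_int (line_dx a l) x y).
Proof.
move=> a0 x0 M0; have an0 : a%:R != 0 :> R by rewrite pnatr_eq0 -lt0n.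
have dM : is_derive x 1 (fun x => x + y) ((x + y) * (x + y)^-1).
  by rewrite mulfV//; apply: is_derive_eq; rewrite addr0.
have dmon (m : rat * (nat * nat * nat * nat)) :
    is_derive x 1 (fun x => ratr m.1 * kap m.2.2 *
      (x ^- m.2.1.1.1 * y ^- m.2.1.1.2 * (x + y) ^- m.2.1.2))
   (ratr m.1 * kap m.2.2 *
      (x ^- m.2.1.1.1 * y ^- m.2.1.1.2 * (x + y) ^- m.2.1.2) *
     (- (m.2.1.1.1%:R / x) - m.2.1.2%:R / (x + y))).
  have := is_derive_mul_log (is_derive_cst_log (ratr m.1 * kap m.2.2) x)
     (is_derive_mul_log (is_derive_mul_log
     (@is_derive_inv_log _ (fun x => x ^+ m.2.1.1.1) _ _ (expf_neq0 m.2.1.1.1 x0)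
       (is_derive_expn_log m.2.1.1.1 (is_derive_id_log x0)))
     (is_derive_cst_log (y ^- m.2.1.1.2) x))
     (@is_derive_inv_log _ (fun x => (x + y) ^+ m.2.1.2) _ _ (expf_neq0 m.2.1.2 M0)
       (@is_derive_expn_log _ (fun x => x + y) _ _ m.2.1.2 dM))).
  by move=> /eq_is_derive; apply => [t|]; rewrite /=; ring.
have := is_derive_bigsum l dmon.
move=> /eq_is_derive; apply => //.
rewrite /line_int /line_dx big_flatten/= big_map mulr_sumr.
apply: eq_bigr => -[c [[[p q] i] r]] _ /=.
rewrite 2!big_cons big_seq1.
rewrite [_.1]/= [_.2.2]/= [_.2.1.1.1]/= [_.2.1.1.2]/= [_.2.1.2]/=.
(* The last two monomials of [line_dx] now combine with the factor (l + 1)/2 - r + (r - 1/2) = l/2,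
   which is what differentiating M^-l requires. *)
have -> : ratr (c * r%:R / a%:R) * kap r.+1 =
    ratr c / a%:R * (r%:R - 2^-1) * kap r.
  rewrite !(rmorphM, fmorphV) !rmorph_nat.
  by rewrite mulrAC -(mulrA _ r%:R) kapS; ring.
rewrite !(rmorphN, rmorphM, rmorphB, fmorphV) !rmorph_nat.
move: (kap r) => Wr; rewrite /=.
rewrite !exprS !invfM; move: (x ^- p) (y ^- q) (ratr c) ((x + y) ^- i).
move=> xp yq c' Mi.
by field; rewrite an0 x0 M0.
Qed.

Lemma is_derive_line_int_y (l : line_comb) (a : nat) (x y : R) :
  (0 < a)%N -> y != 0 -> x + y != 0 ->
  is_derive y 1 (fun y => line_int l x y)
    (- (2 * y * a%:R) * line_int (line_dy a l) x y).
Proof.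
move=> a0 y0; rewrite addrC => M0.
rewrite line_int_swap; under eq_fun do rewrite -line_int_swap.
exact: is_derive_line_int_x.
Qed.

Definition line_ok (n : nat) (l : line_comb) : bool :=
  all (fun m => m.2.1.1.1 + m.2.1.1.2 + m.2.1.2 == n)%N l.

Lemma line_ok_dx n a l : line_ok n l -> line_ok n.+2 (line_dx a l).
Proof.
move=> /allP okl; apply/allP => m /flattenP[s /mapP[[c [[[p q] i] r]] /okl /= /eqP h3 ->]].
by rewrite !inE => /or3P[] /eqP -> /=; lia.
Qed.

Lemma line_ok_swap n l : line_ok n (line_swap l) = line_ok n l.
Proof.
rewrite /line_ok /line_swap all_map; apply: eq_all => -[c [[[p q] i] r]] /=; lia.
Qed.

Lemma line_ok_dy n a l : line_ok n l -> line_ok n.+2 (line_dy a l).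
Proof. by move=> okl; rewrite line_ok_swap line_ok_dx// line_ok_swap. Qed.

Lemma line_ok_iter (op : nat -> line_comb -> line_comb) n b l :
  (forall n a l, line_ok n l -> line_ok n.+2 (op a l)) ->
  line_ok n l -> line_ok (n + b.*2) (iter_op op b l).
Proof.
move=> opok okl; elim: b => [|b ih]; first by rewrite addn0.
by rewrite doubleS !addnS; exact: opok.
Qed.

End LineMonomials.

(** * Line integrals belonging to a vanishing n_r *)

Section ClosedForms1.
Variable R : realType.
Notation mu := (@lebesgue_measure R).

Lemma measurable_sqr_shift (k : R) :
  measurable_fun [set: R] (fun x : R => (x + k) ^+ 2).
Proof. by apply: measurable_funX; exact: measurable_funD. Qed.

Lemma measurable_inv_sqrD (k B : R) (b : nat) :
  measurable_fun [set: R] (fun x : R => ((x + k) ^+ 2 + B ^+ 2) ^- b).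
Proof.
apply: measurable_inv_ge0 => //.
  by move=> x; rewrite exprn_ge0// addr_ge0// sqr_ge0.
by apply: measurable_funX; apply: measurable_funD => //; exact: measurable_sqr_shift.
Qed.

Lemma inv_sqrD_ge0 (x B : R) (b : nat) : 0 <= (x ^+ 2 + B ^+ 2) ^- b.
Proof. by rewrite invr_ge0 exprn_ge0// addr_ge0// sqr_ge0. Qed.

Lemma gt0_near (N e x : R) : 0 < N -> `|x - N| < e -> e <= N -> 0 < x.
Proof. by move=> N0; rewrite ltr_norml => /andP[h _] eN; lra. Qed.

(** In the excluded case k = 0, A = B the integrand is (x^2 + A^2)^-2, the moment that follows
    [cauchy_integral]. *)
Lemma line_integral_convolution (A B k : R) : 0 < A -> 0 < B ->
  (\int[mu]_x ((x ^+ 2 + A ^+ 2)^-1 * ((x + k) ^+ 2 + B ^+ 2)^-1)%:E =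
   (convolution_value A B k)%:E)%E.
Proof.
move=> A0 B0; have [[k0 AB]|] := pselect (k = 0 /\ A = B); last first.
  move=> kAB; apply: line_integral_convolution_neq => //.
  by apply/negPn/negP; rewrite negb_or !negbK => /andP[/eqP ? /eqP ?]; exact: kAB.
subst B k; have An : A != 0 by rewrite gt_eqF.
have mom b x : moment mu (fun=> 1) (fun x : R => x ^+ 2) b x =
    (\int[mu]_u ((u ^+ 2 + x ^+ 2) ^- b)%:E)%E.
  by apply: eq_integral => u _; rewrite mul1r.
transitivity (moment mu (fun=> 1) (fun x : R => x ^+ 2) 2 A).
  rewrite mom; apply: eq_integral => u _; rewrite addr0.
  by rewrite expr2 invfM.
rewrite (@momentS _ _ _ mu (fun=> 1) (fun x : R => x ^+ 2) _ _ _ _ 1 A A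
   (fun x => pi * x^-1) (fun x => - (pi * x ^- 2)))//.
- congr EFin; rewrite /convolution_value expr0n/= addr0.
  have -> : A + A = 2 * A by ring.
  by field.
- by move=> x; exact: sqr_ge0.
- move=> x xA; have x0 := gt0_near A0 xA (lexx _).
  by rewrite mom; under eq_integral do rewrite expr1; exact: cauchy_integral.
- move=> x xA; have x0 := gt0_near A0 xA (lexx _).
  have xn : x != 0 by rewrite gt_eqF.
  have := is_derive_mul_log (is_derive_cst_log pi x)
    (@is_derive_inv_log _ (fun x => x) _ _ xn (is_derive_id_log xn)).
  by move=> /eq_is_derive h; apply/is_deriveW/h => //; field.
Qed.

Lemma integral_kap (M : R) (r : nat) : 0 < M ->
  (\int[mu]_k ((k ^+ 2 + M ^+ 2) ^- r.+1)%:E = (kap R r.+1 * M ^- (2 * r).+1)%:E)%E.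
Proof.
elim: r M => [|r ih] M M0.
  rewrite muln0 expr1; under eq_integral do rewrite expr1.
  exact: cauchy_integral.
have mom b x : moment mu (fun=> 1) (fun x : R => x ^+ 2) b x =
    (\int[mu]_u ((u ^+ 2 + x ^+ 2) ^- b)%:E)%E.
  by apply: eq_integral => u _; rewrite mul1r.
have Mn : M != 0 by rewrite gt_eqF.
rewrite -mom (@momentS _ _ _ mu (fun=> 1) (fun x : R => x ^+ 2) _ _ _ _ r.+1 M M
   (fun x => kap R r.+1 * x ^- (2 * r).+1)
   (fun x => - (kap R r.+1 * (2 * r).+1%:R * x ^- (2 * r).+2)))//.
- congr EFin; have := kapS R r.+1.
  have r0 : r.+1%:R != 0 :> R by rewrite pnatr_eq0.
  move=> h; have -> : kap R r.+2 = (r.+1%:R - 2^-1) * kap R r.+1 / r.+1%:R.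
    by rewrite -h; field.
  have -> : (2 * r).+1%:R = 2 * r.+1%:R - 1 :> R.
    by rewrite -[(2 * r).+1]addn1 natrD natrM -[r.+1]addn1 natrD; ring.
  rewrite mulnS !addSn add0n !exprS !invfM opprK.
  move: (M ^- (2 * r)) (kap R r.+1) (r.+1%:R : R) r0 => m K r' r0.
  by field; rewrite r0 Mn.
- by move=> x; exact: sqr_ge0.
- by move=> x xM; rewrite mom; apply: ih; exact: gt0_near M0 xM (lexx _).
- move=> x xM; have x0 := gt0_near M0 xM (lexx _).
  have xn : x != 0 by rewrite gt_eqF.
  have := is_derive_mul_log (is_derive_cst_log (kap R r.+1) x)
    (@is_derive_inv_log _ (fun x => x ^+ (2 * r).+1) _ _ (expf_neq0 _ xn)
      (is_derive_expn_log (2 * r).+1 (is_derive_id_log xn))).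
  move=> /eq_is_derive h; apply/is_deriveW/h => //.
  by rewrite [in RHS]exprS [in RHS]invfM; ring.
Qed.

(** The contribution of one k = m_r when n_r = 0, after unfolding. It is evaluated at N1 = N2 in the
    end, but each of them has to vary alone for its exponent to be raised. *)
Definition tail_integral (c a b : nat) (k N1 N2 : R) : \bar R :=
  (\int[mu]_x (k ^- (2 * c) * ((x ^+ 2 + N1 ^+ 2) ^- a *
     ((x + k) ^+ 2 + N2 ^+ 2) ^- b))%:E)%E.

Definition tail_comb (a b l r : nat) : line_comb :=
  iter_op line_dx a (iter_op line_dy b (line_start l r)).

(* Expands k^(-2c) / (M^2 + k^2) in partial fractions with respect to k^2. *)
Definition tail_value (L : nat -> nat -> line_comb) (c : nat) (k N1 N2 : R) : R :=
  pi * (\sum_(i < c) (-1) ^+ i * k ^- (2 * (c - i)) * line_eval (L (2 * i)%N 0%N) N1 N2 k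
        + (-1) ^+ c * line_eval (L (2 * c)%N 1%N) N1 N2 k).

(** Induction on c by 1 / (k^2 (k^2 + M^2)) = M^-2 (k^-2 - 1 / (k^2 + M^2)): each step splits off
    one power of k, changes the sign and adds two to the exponent of 1/M. *)
Lemma tail_value_base (c : nat) (k N1 N2 : R) : k != 0 -> 0 < N1 -> 0 < N2 ->
  k ^- (2 * c) * convolution_value N1 N2 k = tail_value line_start c k N1 N2.
Proof.
move=> k0 N10 N20; have N1n : N1 != 0 by rewrite gt_eqF.
have N2n : N2 != 0 by rewrite gt_eqF.
have Mn : N1 + N2 != 0 by rewrite gt_eqF// addr_gt0.
have Dn : k ^+ 2 + (N1 + N2) ^+ 2 != 0 by rewrite gt_eqF// sqrD_gt0.
have Dn' : (N1 + N2) ^+ 2 + k ^+ 2 != 0 by rewrite addrC.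
have lE l r : line_eval (line_start l r) N1 N2 k =
    N1^-1 * N2^-1 * (N1 + N2) ^- l.+1 * line_W N1 N2 k ^+ r.
  by rewrite /line_eval big_seq1/= rmorph1 mul1r /line_mon/= !expr1.
rewrite /tail_value; under eq_bigr do rewrite lE.
rewrite lE; elim: c => [|c ih].
  rewrite big_ord0 add0r muln0 !expr0 !mul1r !expr1 invr1 mul1r.
  by rewrite /convolution_value /line_W; field; rewrite N1n N2n Mn Dn.
have kS n : k ^- (2 * n.+1) = k ^- 2 * k ^- (2 * n).
  by rewrite mulnS exprD invfM.
rewrite kS -[LHS]mulrA ih big_ord_recr/= subSnn.
rewrite mulrCA; congr (_ * _); rewrite mulrDr mulr_sumr.
under [X in _ = X + _ + _]eq_bigr => i _.
  rewrite subSn ?(ltnW (ltn_ord i))// kS.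
  over.
rewrite -[RHS]addrA; congr (_ + _).
  by apply: eq_bigr => i _; ring.
rewrite !mulnS muln0 addn0 !addSn !add0n !exprS !invfM !expr0 /line_W.
move: (_ ^+ (2 * c))^-1 => m; move: (_ ^+ c) => s.
by field; rewrite N1n N2n Mn Dn k0.
Qed.

Lemma is_derive_tail_value_x (L : nat -> nat -> line_comb) (a c : nat)
    (k x y : R) :
  (0 < a)%N -> x != 0 -> x + y != 0 ->
  is_derive x 1 (fun x => tail_value L c k x y)
    (- (2 * x * a%:R) * tail_value (fun l r => line_dx a (L l r)) c k x y).
Proof.
move=> a0 x0 M0.
have dl l := is_derive_line_x l k a0 x0 M0.
have ds := @is_derive_bigsum R 'I_c (index_enum 'I_c)
  (fun i x => (-1) ^+ i * k ^- (2 * (c - i)) * line_eval (L (2 * i)%N 0%N) x y k)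
  (fun i => (-1) ^+ i * k ^- (2 * (c - i)) *
     (- (2 * x * a%:R) * line_eval (line_dx a (L (2 * i)%N 0%N)) x y k)) x.
have {}ds := ds (fun i => is_deriveZ _ (dl _)).
have := is_deriveZ pi (is_deriveD ds (is_deriveZ ((-1) ^+ c) (dl (L (2 * c)%N 1%N)))).
move=> /eq_is_derive; apply => //.
rewrite /tail_value /GRing.scale/= [RHS]mulrCA; congr (_ * _).
rewrite mulrDr; congr (_ + _); last by rewrite mulrCA.
rewrite [RHS]mulr_sumr.
by apply: eq_bigr => i _; rewrite mulrCA.
Qed.

Lemma is_derive_tail_value_y (L : nat -> nat -> line_comb) (a c : nat)
    (k x y : R) :
  (0 < a)%N -> y != 0 -> x + y != 0 ->
  is_derive y 1 (fun y => tail_value L c k x y)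
    (- (2 * y * a%:R) * tail_value (fun l r => line_dy a (L l r)) c k x y).
Proof.
move=> a0 x0 M0.
have dl l := is_derive_line_y l k a0 x0 M0.
have ds := @is_derive_bigsum R 'I_c (index_enum 'I_c)
  (fun i y => (-1) ^+ i * k ^- (2 * (c - i)) * line_eval (L (2 * i)%N 0%N) x y k)
  (fun i => (-1) ^+ i * k ^- (2 * (c - i)) *
     (- (2 * y * a%:R) * line_eval (line_dy a (L (2 * i)%N 0%N)) x y k)) y.
have {}ds := ds (fun i => is_deriveZ _ (dl _)).
have := is_deriveZ pi (is_deriveD ds (is_deriveZ ((-1) ^+ c) (dl (L (2 * c)%N 1%N)))).
move=> /eq_is_derive; apply => //.
rewrite /tail_value /GRing.scale/= [RHS]mulrCA; congr (_ * _).
rewrite mulrDr; congr (_ + _); last by rewrite mulrCA.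
rewrite [RHS]mulr_sumr.
by apply: eq_bigr => i _; rewrite mulrCA.
Qed.

Lemma tail_integralE (c a b : nat) (k N1 N2 : R) : k != 0 -> 0 < N1 -> 0 < N2 ->
  tail_integral c a.+1 b.+1 k N1 N2 = (tail_value (tail_comb a b) c k N1 N2)%:E.
Proof.
move=> k0; have kc0 : 0 <= k ^- (2 * c).
  by rewrite invr_ge0 mulnC exprM sqr_ge0.
have cancel (N a' v : R) : N != 0 -> a' != 0 ->
    - (- (2 * N * a') * v) / (2 * N * a') = v.
  by move=> N0 a0; field; rewrite N0 a0.
elim: a N1 N2 => [|a iha] N1 N2 N10 N20.
  elim: b N2 N20 => [|b ihb] N2 N20.
    transitivity ((k ^- (2 * c))%:E * \int[mu]_x ((x ^+ 2 + N1 ^+ 2)^-1 *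
        ((x + k) ^+ 2 + N2 ^+ 2)^-1)%:E)%E; last first.
      by rewrite line_integral_convolution// -EFinM tail_value_base.
    rewrite -ge0_integralZl_EFin//.
    - by move=> x _; rewrite lee_fin mulr_ge0// invr_ge0 addr_ge0 ?sqr_ge0.
    - apply/measurable_EFinP/measurable_funM.
        have := measurable_inv_sqrD 0 N1 1.
        by under eq_fun do rewrite addr0 expr1.
      have := measurable_inv_sqrD k N2 1.
      by under eq_fun do rewrite expr1.
  have mom b' y : tail_integral c 1 b' k N1 y = moment mu
    (fun x => k ^- (2 * c) * (x ^+ 2 + N1 ^+ 2) ^- 1) (fun x => (x + k) ^+ 2) b' y.
    by apply: eq_integral => x _; rewrite mulrA.
  rewrite mom (@momentS _ _ _ mu _ _ _ _ _ _ b.+1 N2 N2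
    (fun y => tail_value (tail_comb 0 b) c k N1 y)
    (fun y => - (2 * y * b.+1%:R) * tail_value (tail_comb 0 b.+1) c k N1 y))//.
  - by rewrite cancel// ?pnatr_eq0// gt_eqF.
  - by move=> x; rewrite mulr_ge0// inv_sqrD_ge0.
  - by move=> x; exact: sqr_ge0.
  - apply: measurable_funM => //.
    have := measurable_inv_sqrD 0 N1 1.
    by under eq_fun do rewrite addr0.
  - exact: measurable_sqr_shift.
  - by rewrite gt_eqF.
  - by move=> x xN; rewrite -mom ihb//; exact: gt0_near N20 xN (lexx _).
  - move=> x xN; have x0 := gt0_near N20 xN (lexx _).
    by apply/is_deriveW/is_derive_tail_value_y => //; rewrite gt_eqF ?addr_gt0.
have mom a' x : tail_integral c a' b.+1 k x N2 = moment mu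
  (fun x => k ^- (2 * c) * ((x + k) ^+ 2 + N2 ^+ 2) ^- b.+1) (fun x => x ^+ 2) a' x.
  by apply: eq_integral => u _; congr EFin; ring.
rewrite mom (@momentS _ _ _ mu _ _ _ _ _ _ a.+1 N1 N1
  (fun x => tail_value (tail_comb a b) c k x N2)
  (fun x => - (2 * x * a.+1%:R) * tail_value (tail_comb a.+1 b) c k x N2))//.
- by rewrite cancel// ?pnatr_eq0// gt_eqF.
- by move=> x; rewrite mulr_ge0// inv_sqrD_ge0.
- by move=> x; exact: sqr_ge0.
- by apply: measurable_funM => //; exact: measurable_inv_sqrD.
- by rewrite gt_eqF.
- by move=> x xN; rewrite -mom iha//; exact: gt0_near N10 xN (lexx _).
- move=> x xN; have x0 := gt0_near N10 xN (lexx _).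
  by apply/is_deriveW/is_derive_tail_value_x => //; rewrite gt_eqF ?addr_gt0.
Qed.

End ClosedForms1.

(** * The double integral near the plane *)

Section ClosedForms2.
Variable R : realType.
Notation mu := (@lebesgue_measure R).
Notation T := (measurableTypeR R).
Notation mu2 := (mu \x mu)%E.

Definition box_fun (a b c : nat) (N1 N2 N3 : R) (x y : R) : R :=
  (x ^+ 2 + N1 ^+ 2) ^- a * (y ^+ 2 + N2 ^+ 2) ^- b *
  ((x + y) ^+ 2 + N3 ^+ 2) ^- c.

Definition box_integral (a b c : nat) (N1 N2 N3 : R) : \bar R :=
  (\int[mu2]_p (box_fun a b c N1 N2 N3 p.1 p.2)%:E)%E.

Lemma box_fun_ge0 a b c N1 N2 N3 x y : 0 <= box_fun a b c N1 N2 N3 x y.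
Proof. by rewrite !mulr_ge0// inv_sqrD_ge0. Qed.

Lemma measurable_sqr_fst : measurable_fun [set: T * T] (fun p => p.1 ^+ 2 : R).
Proof. by apply: measurable_funX; exact: measurable_fst. Qed.

Lemma measurable_sqr_snd : measurable_fun [set: T * T] (fun p => p.2 ^+ 2 : R).
Proof. by apply: measurable_funX; exact: measurable_snd. Qed.

Lemma measurable_sqr_add : measurable_fun [set: T * T] (fun p => (p.1 + p.2) ^+ 2 : R).
Proof.
apply: measurable_funX; apply: measurable_funD; [exact: measurable_fst|exact: measurable_snd].
Qed.

Lemma measurable_inv_pow2 (X : T * T -> R) (N : R) (a : nat) : (forall p, 0 <= X p) ->
  measurable_fun [set: T * T] X ->
  measurable_fun [set: T * T] (fun p => (X p + N ^+ 2) ^- a).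
Proof.
move=> X0 mX; apply: measurable_inv_ge0 => //.
  by move=> x; rewrite exprn_ge0// addr_ge0// sqr_ge0.
by apply: measurable_funX; exact: measurable_funD.
Qed.

Lemma measurable_box a b c N1 N2 N3 :
  measurable_fun [set: T * T] (fun p => box_fun a b c N1 N2 N3 p.1 p.2).
Proof.
apply: measurable_funM; first apply: measurable_funM;
  apply: measurable_inv_pow2 => //; try by move=> p; exact: sqr_ge0.
- exact: measurable_sqr_fst.
- exact: measurable_sqr_snd.
- exact: measurable_sqr_add.
Qed.

(** Two convolutions of Cauchy kernels: over y with scales |N2| and |N3|, then over x with scales
    |N1| and |N2| + |N3| and shift 0. *)
Lemma box_integral111 (N1 N2 N3 : R) : N1 != 0 -> N2 != 0 -> N3 != 0 ->
  box_integral 1 1 1 N1 N2 N3 =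
  (pi ^+ 2 / (`|N1| * `|N2| * `|N3| * (`|N1| + `|N2| + `|N3|)))%:E.
Proof.
move=> N10 N20 N30.
have p1 : 0 < `|N1| by rewrite normr_gt0.
have p2 : 0 < `|N2| by rewrite normr_gt0.
have p3 : 0 < `|N3| by rewrite normr_gt0.
rewrite /box_integral (@fubini_tonelli1 _ _ _ _ _ mu mu
  (fun p => (box_fun 1 1 1 N1 N2 N3 p.1 p.2)%:E)); last 2 first.
- by apply/measurable_EFinP; exact: measurable_box.
- by move=> p; rewrite lee_fin box_fun_ge0.
have inner x : fubini_F mu (fun p : T * T => (box_fun 1 1 1 N1 N2 N3 p.1 p.2)%:E) x =
   ((x ^+ 2 + N1 ^+ 2)^-1 * convolution_value `|N2| `|N3| x)%:E.
  rewrite EFinM -line_integral_convolution// -ge0_integralZl_EFin//.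
  - apply: eq_integral => y _; rewrite -EFinM; congr EFin.
    by rewrite /box_fun/= !expr1 !real_normK ?num_real// (addrC x) mulrA.
  - by move=> y _; rewrite lee_fin mulr_ge0// invr_ge0 addr_ge0// sqr_ge0.
  - apply/measurable_EFinP/measurable_funM.
      have := measurable_inv_sqrD 0 `|N2| 1.
      by under eq_fun do rewrite addr0 expr1.
    have := measurable_inv_sqrD x `|N3| 1.
    by under eq_fun do rewrite expr1.
  - by rewrite invr_ge0 addr_ge0// sqr_ge0.
under eq_integral do rewrite inner.
have s0 : 0 < `|N2| + `|N3| by rewrite addr_gt0.
transitivity ((pi * (`|N2| + `|N3|) / (`|N2| * `|N3|))%:E *
  \int[mu]_x ((x ^+ 2 + `|N1| ^+ 2)^-1 * ((x + 0) ^+ 2 + (`|N2| + `|N3|) ^+ 2)^-1)%:E)%E.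
  rewrite -ge0_integralZl_EFin//.
  - apply: eq_integral => x _; rewrite -EFinM; congr EFin.
    rewrite real_normK ?num_real// addr0 /convolution_value.
    have q1 := sqrD_gt0 x N10.
    have q2 : 0 < x ^+ 2 + (`|N2| + `|N3|) ^+ 2 by apply: sqrD_gt0; rewrite gt_eqF.
    rewrite (addrC ((_ + _) ^+ 2)).
    move: q1 q2; move: (x ^+ 2 + N1 ^+ 2) (x ^+ 2 + (`|N2| + `|N3|) ^+ 2) => X Y q1 q2.
    by field; rewrite !gt_eqF.
  - by move=> x _; rewrite lee_fin mulr_ge0// invr_ge0 addr_ge0// sqr_ge0.
  - apply/measurable_EFinP/measurable_funM.
      have := measurable_inv_sqrD 0 `|N1| 1.
      by under eq_fun do rewrite addr0 expr1.
    have := measurable_inv_sqrD 0 (`|N2| + `|N3|) 1.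
    by under eq_fun do rewrite expr1.
  - by rewrite divr_ge0 ?mulr_ge0 ?pi_ge0// ltW// mulr_gt0.
rewrite line_integral_convolution// -EFinM; congr EFin.
rewrite /convolution_value expr0n/= addr0.
have s1 : 0 < `|N1| + (`|N2| + `|N3|) by rewrite addr_gt0.
rewrite -addrA; by field; rewrite !gt_eqF.
Qed.

(* A neighbourhood of the punctured plane N1 + N2 + N3 = 0 on which the
   denominators N_i^2 - (N_j - N_k)^2 do not vanish. *)
Definition near_plane (N1 N2 N3 : R) : Prop :=
  [/\ `|N1 + N2 + N3| < 2 * `|N1|, `|N1 + N2 + N3| < 2 * `|N2| &
      `|N1 + N2 + N3| < 2 * `|N3|].

Lemma near_plane_neq0 N1 N2 N3 : near_plane N1 N2 N3 ->
  [/\ N1 != 0, N2 != 0 & N3 != 0].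
Proof.
have n0 (x s : R) : `|s| < 2 * `|x| -> x != 0.
  by apply: contraTneq => ->; rewrite normr0 mulr0 -leNgt.
by case=> /n0 ? /n0 ? /n0 ?; split.
Qed.

Lemma near_planeA N1 N2 N3 : near_plane N1 N2 N3 -> near_plane N2 N3 N1.
Proof. by case=> h1 h2 h3; split; rewrite addrC addrA. Qed.

Lemma near_plane_open1 N1 N2 N3 : near_plane N1 N2 N3 ->
  exists e : R, 0 < e /\ forall x, `|x - N1| < e ->
    near_plane x N2 N3 /\ Num.sg x = Num.sg N1.
Proof.
move=> U; have [n1 n2 n3] := near_plane_neq0 U; case: U => h1 h2 h3.
set s := `|N1 + N2 + N3|.
pose m := Num.min (2 * `|N1| - s) (Num.min (2 * `|N2| - s) (2 * `|N3| - s)).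
have m0 : 0 < m by rewrite !lt_min !subr_gt0 h1 h2 h3.
have m1 : m <= 2 * `|N1| - s by rewrite /m ge_min lexx.
have m2 : m <= 2 * `|N2| - s by rewrite /m !ge_min lexx orbT.
have m3 : m <= 2 * `|N3| - s by rewrite /m !ge_min lexx !orbT.
(* Moving N1 by d changes |N1 + N2 + N3| by at most d and 2 |N1| by at most 2 d, so d < m/3
   preserves the three inequalities; d < |N1| preserves the sign. *)
exists (Num.min (m / 3) `|N1|); split.
  by rewrite lt_min normr_gt0 n1 andbT divr_gt0.
move=> x; rewrite lt_min => /andP[x1 x2].
have hs : `|x + N2 + N3| <= s + `|x - N1|.
  rewrite (_ : x + N2 + N3 = (N1 + N2 + N3) + (x - N1)); last by ring.
  exact: ler_normD.
have hx : `|N1| <= `|x| + `|x - N1|.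
  have := ler_normB x (x - N1).
  by rewrite (_ : x - (x - N1) = N1)//; ring.
split; first by split; lra.
have [N1p|N1n|N1e] := ltrgtP N1 0; last by rewrite N1e eqxx in n1.
  rewrite (ltr0_sg N1p) ltr0_sg//.
  move: x2; rewrite (ltr0_norm N1p) ltr_norml => /andP[]; lra.
rewrite (gtr0_sg N1n) gtr0_sg//.
move: x2; rewrite (gtr0_norm N1n) ltr_norml => /andP[]; lra.
Qed.

(** If the factor N3 - N1 + N2 or N3 + N1 - N2 vanished, N1 + N2 + N3 would be 2 N1 or 2 N2. *)
Lemma near_plane_quad N1 N2 N3 : near_plane N1 N2 N3 ->
  N3 ^+ 2 - (N1 - N2) ^+ 2 != 0.
Proof.
move=> [h1 h2 h3].
have n2 (x : R) : `|2 * x| = 2 * `|x| by rewrite normrM normr_nat.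
rewrite subr_sqr mulf_neq0//.
- apply: contraTneq h1 => e; rewrite -leNgt -n2.
  by rewrite (_ : N1 + N2 + N3 = 2 * N1)//; lra.
- apply: contraTneq h2 => e; rewrite -leNgt -n2.
  by rewrite (_ : N1 + N2 + N3 = 2 * N2)//; lra.
Qed.

End ClosedForms2.

(* comb_i describes the summand of the box integral in which N_i plays the role
   of z; the exponents a.+1, b.+1, c.+1 belong to N1, N2, N3. *)
Definition comb3 (a b c : nat) : pair_comb :=
  iter_op pair_dx a (iter_op pair_dy b (iter_op pair_dz c pair_start)).
Definition comb2 (a b c : nat) : pair_comb :=
  iter_op pair_dx a (iter_op pair_dz b (iter_op pair_dy c pair_start)).
Definition comb1 (a b c : nat) : pair_comb :=
  iter_op pair_dz a (iter_op pair_dx b (iter_op pair_dy c pair_start)).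

Section BoxClosedForm.
Variable R : realType.
Notation mu := (@lebesgue_measure R).
Notation T := (measurableTypeR R).
Notation mu2 := (mu \x mu)%E.

Lemma triangle_identity (N1 N2 N3 : R) : near_plane N1 N2 N3 ->
  (`|N1| * `|N2| * `|N3| * (`|N1| + `|N2| + `|N3|))^-1 =
  Num.sg N1 * Num.sg N2 / (N1 * N2 * (N3 ^+ 2 - (N1 - N2) ^+ 2)) +
  Num.sg N1 * Num.sg N3 / (N1 * N3 * (N2 ^+ 2 - (N1 - N3) ^+ 2)) +
  Num.sg N2 * Num.sg N3 / (N2 * N3 * (N1 ^+ 2 - (N2 - N3) ^+ 2)).
Proof.
move=> U; have [n1 n2 n3] := near_plane_neq0 U.
have q3 := near_plane_quad U.
have q1 := near_plane_quad (near_planeA U).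
have q2 : N2 ^+ 2 - (N1 - N3) ^+ 2 != 0.
  rewrite -(sqrrN (N1 - N3)) opprB.
  exact: near_plane_quad (near_planeA (near_planeA U)).
have s0 : `|N1| + `|N2| + `|N3| != 0.
  by rewrite gt_eqF// ltr_wpDr// ltr_wpDr// normr_gt0.
case: U => h1 h2 h3; move: s0 h1 h2 h3.
have [p1|p1|e1] := ltrgtP N1 0; last by rewrite e1 eqxx in n1.
all: have [p2|p2|e2] := ltrgtP N2 0; last by rewrite e2 eqxx in n2.
all: have [p3|p3|e3] := ltrgtP N3 0; last by rewrite e3 eqxx in n3.
all: rewrite ?(ltr0_sg p1) ?(gtr0_sg p1) ?(ltr0_sg p2) ?(gtr0_sg p2)
  ?(ltr0_sg p3) ?(gtr0_sg p3) ?(ltr0_norm p1) ?(gtr0_norm p1)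
  ?(ltr0_norm p2) ?(gtr0_norm p2) ?(ltr0_norm p3) ?(gtr0_norm p3).
(* Three equal signs contradict [near_plane]: the inequalities add up to 3 s < 2 s with s = |N1| +
   |N2| + |N3|. In the six other sign patterns the claim is an identity of rational functions. *)
1: by rewrite !ltr_norml => s0 /andP[? ?] /andP[? ?] /andP[? ?]; lra.
7: by rewrite !ltr_norml => s0 /andP[? ?] /andP[? ?] /andP[? ?]; lra.
all: move=> s0 _ _ _; field; by rewrite ?n1 ?n2 ?n3 ?q1 ?q2 ?q3 ?s0.
Qed.

(** The products of signs are separate arguments so that they are constants under
    differentiation. *)
Definition box_value (L3 L2 L1 : pair_comb) (s3 s2 s1 N1 N2 N3 : R) : R :=
  pi ^+ 2 * (s3 * pair_eval L3 N1 N2 N3 + s2 * pair_eval L2 N1 N3 N2 +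
             s1 * pair_eval L1 N2 N3 N1).

Lemma is_derive_box_value (f3 f2 f1 : R -> R) (d3 d2 d1 s3 s2 s1 x k : R) :
  is_derive x 1 f3 (k * d3) -> is_derive x 1 f2 (k * d2) ->
  is_derive x 1 f1 (k * d1) ->
  is_derive x 1 (fun x => pi ^+ 2 * (s3 * f3 x + s2 * f2 x + s1 * f1 x))
    (k * (pi ^+ 2 * (s3 * d3 + s2 * d2 + s1 * d1))).
Proof.
move=> h3 h2 h1.
have := is_deriveZ (pi ^+ 2)
  (is_deriveD (is_deriveD (is_deriveZ s3 h3) (is_deriveZ s2 h2)) (is_deriveZ s1 h1)).
by move=> /eq_is_derive; apply => //; rewrite /GRing.scale/=; ring.
Qed.

(** Each induction step needs the formula for all nearby values of one N_r, which [near_plane_open1]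
    provides together with the constancy of the sign. The exponents are raised in the order N3, N2,
    N1, as in the definition of the three lists. *)
Lemma box_integralE (a b c : nat) (N1 N2 N3 : R) : near_plane N1 N2 N3 ->
  box_integral a.+1 b.+1 c.+1 N1 N2 N3 =
  (box_value (comb3 a b c) (comb2 a b c) (comb1 a b c)
    (Num.sg N1 * Num.sg N2) (Num.sg N1 * Num.sg N3) (Num.sg N2 * Num.sg N3)
    N1 N2 N3)%:E.
Proof.
have quad2 x y z : near_plane x y z -> y ^+ 2 - (x - z) ^+ 2 != 0 :> R.
  move=> U; rewrite -(sqrrN (x - z)) opprB.
  exact: near_plane_quad (near_planeA (near_planeA U)).
have sq1 (p : T * T) : 0 <= (p.1 : R) ^+ 2 by exact: sqr_ge0.
have sq2 (p : T * T) : 0 <= (p.2 : R) ^+ 2 by exact: sqr_ge0.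
have sq3 (p : T * T) : 0 <= (p.1 + p.2 : R) ^+ 2 by exact: sqr_ge0.
elim: a N1 N2 N3 => [|a iha] N1 N2 N3 U.
  elim: b N1 N2 N3 U => [|b ihb] N1 N2 N3 U.
    elim: c N1 N2 N3 U => [|c ihc] N1 N2 N3 U.
      have [n1 n2 n3] := near_plane_neq0 U.
      rewrite box_integral111// triangle_identity//; congr EFin.
      rewrite /box_value /comb1 /comb2 /comb3 /= /pair_eval !big_seq1 /=.
      rewrite rmorph1 !mul1r /pair_mon /pair_V /= !expr1.
      have q3 := near_plane_quad U.
      have q2 := quad2 _ _ _ U.
      have q1 := near_plane_quad (near_planeA U).
      move: q1 q2 q3 (Num.sg N1) (Num.sg N2) (Num.sg N3).
      move: (N3 ^+ 2 - _) (N2 ^+ 2 - _) (N1 ^+ 2 - _) => Q1 Q2 Q3 q1 q2 q3 s1 s2 s3.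
      by field; rewrite n1 n2 n3 q1 q2 q3.
    have U' := near_planeA (near_planeA U).
    have [e [e0 eU]] := near_plane_open1 U'.
    have mom c' z : box_integral 1 1 c' N1 N2 z = moment mu2
      (fun p : T * T => (p.1 ^+ 2 + N1 ^+ 2) ^- 1 * (p.2 ^+ 2 + N2 ^+ 2) ^- 1)
      (fun p : T * T => (p.1 + p.2) ^+ 2) c' z by [].
    have [n1 n2 n3] := near_plane_neq0 U.
    refine (@moment_recursion _ _ _ mu2 _ _ (fun c' z => box_integral 1 1 c' N1 N2 z)
      c.+1 N3 e
      (fun z => box_value (comb3 0 0 c) (comb2 0 0 c) (comb1 0 0 c)
        (Num.sg N1 * Num.sg N2) (Num.sg N1 * Num.sg N3) (Num.sg N2 * Num.sg N3) N1 N2 z) 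
      (fun z => box_value (comb3 0 0 c.+1) (comb2 0 0 c.+1) (comb1 0 0 c.+1)
        (Num.sg N1 * Num.sg N2) (Num.sg N1 * Num.sg N3) (Num.sg N2 * Num.sg N3) N1 N2 z)
      mom _ sq3 _ (@measurable_sqr_add R) isT n3 e0 _).
    - by move=> p; rewrite mulr_ge0// inv_sqrD_ge0.
    - apply: measurable_funM; apply: measurable_inv_pow2 => //.
        exact: measurable_sqr_fst.
      exact: measurable_sqr_snd.
    - move=> z /eU[Uz sz]; have {}Uz := near_planeA Uz.
      have [_ _ z0] := near_plane_neq0 Uz.
      split; first by rewrite -sz; exact: ihc.
      refine (is_derive_box_value _ _ _
        (is_derive_pair_z (comb3 0 0 c) (isT : (0 < c.+1)%N) _ _ _)
        (is_derive_pair_y (comb2 0 0 c) (isT : (0 < c.+1)%N) _ _ _)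
        (is_derive_pair_y (comb1 0 0 c) (isT : (0 < c.+1)%N) _ _ _)) => //.
      + exact: near_plane_quad.
      + exact: quad2.
      + exact: near_plane_quad (near_planeA Uz).
  have U' := near_planeA U.
  have [e [e0 eU]] := near_plane_open1 U'.
  have mom b' y : box_integral 1 b' c.+1 N1 y N3 = moment mu2
    (fun p : T * T => (p.1 ^+ 2 + N1 ^+ 2) ^- 1 * ((p.1 + p.2) ^+ 2 + N3 ^+ 2) ^- c.+1)
    (fun p : T * T => p.2 ^+ 2) b' y.
    by apply: eq_integral => p _; congr EFin; rewrite /box_fun; ring.
  have [n1 n2 n3] := near_plane_neq0 U.
  refine (@moment_recursion _ _ _ mu2 _ _ (fun b' y => box_integral 1 b' c.+1 N1 y N3)
    b.+1 N2 e
    (fun y => box_value (comb3 0 b c) (comb2 0 b c) (comb1 0 b c)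
      (Num.sg N1 * Num.sg N2) (Num.sg N1 * Num.sg N3) (Num.sg N2 * Num.sg N3) N1 y N3) 
    (fun y => box_value (comb3 0 b.+1 c) (comb2 0 b.+1 c) (comb1 0 b.+1 c)
      (Num.sg N1 * Num.sg N2) (Num.sg N1 * Num.sg N3) (Num.sg N2 * Num.sg N3) N1 y N3)
    mom _ sq2 _ (@measurable_sqr_snd R) isT n2 e0 _).
  - by move=> p; rewrite mulr_ge0// inv_sqrD_ge0.
  - apply: measurable_funM; apply: measurable_inv_pow2 => //.
      exact: measurable_sqr_fst.
    exact: measurable_sqr_add.
  - move=> y /eU[Uy sy]; have {}Uy := near_planeA (near_planeA Uy).
    have [_ y0 _] := near_plane_neq0 Uy.
    split; first by rewrite -sy; exact: ihb.
    refine (is_derive_box_value _ _ _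
      (is_derive_pair_y (comb3 0 b c) (isT : (0 < b.+1)%N) _ _ _)
      (is_derive_pair_z (comb2 0 b c) (isT : (0 < b.+1)%N) _ _ _)
      (is_derive_pair_x (comb1 0 b c) (isT : (0 < b.+1)%N) _ _ _)) => //.
    + exact: near_plane_quad.
    + exact: quad2.
    + exact: near_plane_quad (near_planeA Uy).
have [e [e0 eU]] := near_plane_open1 U.
have mom a' x : box_integral a' b.+1 c.+1 x N2 N3 = moment mu2
  (fun p : T * T => (p.2 ^+ 2 + N2 ^+ 2) ^- b.+1 * ((p.1 + p.2) ^+ 2 + N3 ^+ 2) ^- c.+1)
  (fun p : T * T => p.1 ^+ 2) a' x.
  by apply: eq_integral => p _; congr EFin; rewrite /box_fun; ring.
have [n1 n2 n3] := near_plane_neq0 U.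
refine (@moment_recursion _ _ _ mu2 _ _ (fun a' x => box_integral a' b.+1 c.+1 x N2 N3)
  a.+1 N1 e
  (fun x => box_value (comb3 a b c) (comb2 a b c) (comb1 a b c)
    (Num.sg N1 * Num.sg N2) (Num.sg N1 * Num.sg N3) (Num.sg N2 * Num.sg N3) x N2 N3) 
  (fun x => box_value (comb3 a.+1 b c) (comb2 a.+1 b c) (comb1 a.+1 b c)
    (Num.sg N1 * Num.sg N2) (Num.sg N1 * Num.sg N3) (Num.sg N2 * Num.sg N3) x N2 N3)
  mom _ sq1 _ (@measurable_sqr_fst R) isT n1 e0 _).
- by move=> p; rewrite mulr_ge0// inv_sqrD_ge0.
- apply: measurable_funM; apply: measurable_inv_pow2 => //.
    exact: measurable_sqr_snd.
  exact: measurable_sqr_add.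
- move=> x /eU[Ux sx]; have [x0 _ _] := near_plane_neq0 Ux.
  split; first by rewrite -sx; exact: iha.
  refine (is_derive_box_value _ _ _
    (is_derive_pair_x (comb3 a b c) (isT : (0 < a.+1)%N) _ _ _)
    (is_derive_pair_x (comb2 a b c) (isT : (0 < a.+1)%N) _ _ _)
    (is_derive_pair_z (comb1 a b c) (isT : (0 < a.+1)%N) _ _ _)) => //.
  + exact: near_plane_quad.
  + exact: quad2.
  + exact: near_plane_quad (near_planeA Ux).
Qed.

End BoxClosedForm.

(** * Sums over the lattice *)

Section SumsAndIntegrals.
Variable R : realType.
Notation mu := (@lebesgue_measure R).
Local Open Scope ereal_scope.

(** Encoding the countable index set in [nat] makes monotone convergence for series applicable to
    unordered sums. *)
Lemma esum_pickle (T : countType) (a : T -> \bar R) : (forall t, 0 <= a t) ->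
  \esum_(t in [set: T]) a t = \sum_(k <oo) oapp a 0 (pickle_inv k).
Proof.
move=> a0; rewrite nneseries_esumT; last by move=> k; case: pickle_inv => /=.
rewrite (@esum_inj_supp _ _ _ (fun k => oapp a 0 (pickle_inv k)) (@pickle T)).
- by apply: eq_esum => t _; rewrite pickleK_inv.
- exact: pcan_inj pickleK_inv.
- move=> k nk; have := @pickle_invK T k; case: pickle_inv => //= t tk.
  by exfalso; apply: nk; exists t.
Qed.

Lemma integral_esum (d : measure_display) (X : measurableType d)
    (m : {measure set X -> \bar R}) (D : set X) (T : countType)
    (f : T -> X -> \bar R) : measurable D ->
  (forall t, measurable_fun D (f t)) -> (forall t x, 0 <= f t x) ->
  \int[m]_(x in D) (\esum_(t in [set: T]) f t x) =
  \esum_(t in [set: T]) \int[m]_(x in D) f t x.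
Proof.
move=> mD mf f0; rewrite esum_pickle; last by move=> t; exact: integral_ge0.
under eq_integral do rewrite esum_pickle//.
rewrite integral_nneseries//.
- apply: eq_eseriesr => k _; case: pickle_inv => //=.
  by rewrite integral0.
- by move=> k; case: pickle_inv => //= ; exact: measurable_cst.
- by move=> k x _; case: pickle_inv => //=.
Qed.

Lemma measurable_esum (d : measure_display) (X : measurableType d)
    (D : set X) (T : countType) (f : T -> X -> \bar R) :
  (forall t, measurable_fun D (f t)) -> (forall t x, 0 <= f t x) ->
  measurable_fun D (fun x => \esum_(t in [set: T]) f t x).
Proof.
move=> mf f0; under eq_fun do rewrite esum_pickle//.
have := @ge0_emeasurable_sum _ X R D
  (fun k x => oapp (fun t => f t x) 0 (pickle_inv k)) xpredT.
apply.
- by move=> k x _ _; case: pickle_inv => //=.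
- by move=> k _; case: pickle_inv => //=; exact: measurable_cst.
Qed.

Definition unit_itv (m : int) : set R := `[m%:~R, (m + 1)%:~R[%classic.

Lemma measurable_unit_itv m : measurable (unit_itv m).
Proof. exact: measurable_itv. Qed.

Lemma lebesgue_unit_itv m : mu (unit_itv m) = 1.
Proof.
rewrite lebesgue_measure_itv/= lte_fin ltr_int ltzD1 lexx.
by rewrite -EFinB -intrB addrAC subrr add0r.
Qed.

Lemma integral_unit_itv (f : R -> \bar R) : measurable_fun [set: R] f ->
  (forall x, 0 <= f x) ->
  \int[mu]_x f x = \esum_(m in [set: int]) \int[mu]_(x in unit_itv m) f x.
Proof.
move=> mf f0.
pose F k := oapp unit_itv set0 (pickle_inv k : option int).
have FT : \bigcup_k F k = [set: R].
  apply/seteqP; split; first by [].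
  move=> x _; exists (pickle (Num.floor x)); first exact: I.
  rewrite /F pickleK_inv [X in X x]/=.
  by rewrite /unit_itv/= in_itv/= floor_le_tmp floorD1_gt.
have tF : trivIset setT F.
  move=> i j _ _; rewrite /F; have := @pickle_invK int i; have := @pickle_invK int j.
  case: (pickle_inv i : option int) => [m|]; last by move=> _ _ [x []].
  case: (pickle_inv j : option int) => [n|]; last by move=> _ _ [x []].
  move=> /= <- <- [x []]; rewrite /unit_itv/= !in_itv/= => /andP[a b] /andP[c e].
  have := le_lt_trans a e; have := le_lt_trans c b.
  by rewrite !ltr_int !ltzD1 => h1 h2; congr pickle; apply/eqP; rewrite eq_le h1 h2.
rewrite -[in LHS]FT ge0_integral_bigcup//; last 2 first.
- move=> k; rewrite /F; case: (pickle_inv k : option int) => [m|] /=.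
    exact: measurable_unit_itv.
  exact: measurable0.
- by rewrite FT.
rewrite esum_pickle; last by move=> m; exact: integral_ge0.
apply: eq_eseriesr => k _; rewrite /F; case: (pickle_inv k : option int) => //=.
by rewrite integral_set0.
Qed.

Lemma esum_le_integral (G : R -> \bar R) (H : int -> \bar R) :
  measurable_fun [set: R] G -> (forall x, 0 <= G x) -> (forall m, 0 <= H m) ->
  (forall m x, unit_itv m x -> H m <= G x) ->
  \esum_(m in [set: int]) H m <= \int[mu]_x G x.
Proof.
move=> mG G0 H0 HG; rewrite integral_unit_itv//; apply: le_esum => m _.
rewrite -[leLHS]mule1 -(lebesgue_unit_itv m) -integral_cst; last exact: measurable_itv.
apply: ge0_le_integral => //.
- exact: measurable_unit_itv.
- by move=> x _; exact: H0.
- exact: measurable_funTS.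
- by move=> x; exact: HG.
Qed.

Lemma integral_le_esum (G : R -> \bar R) (H : int -> \bar R) :
  measurable_fun [set: R] G -> (forall x, 0 <= G x) -> (forall m, 0 <= H m) ->
  (forall m x, unit_itv m x -> G x <= H m) ->
  \int[mu]_x G x <= \esum_(m in [set: int]) H m.
Proof.
move=> mG G0 H0 GH; rewrite integral_unit_itv//; apply: le_esum => m _.
rewrite -[leRHS]mule1 -(lebesgue_unit_itv m) -integral_cst; last exact: measurable_itv.
apply: ge0_le_integral => //.
- exact: measurable_unit_itv.
- exact: measurable_funTS.
- by move=> x; exact: GH.
Qed.

Notation T := (measurableTypeR R).
Notation mu2 := (mu \x mu).

Lemma esum_le_integral2 (f : R -> R -> R) (h : int -> int -> R) :
  measurable_fun [set: T * T] (fun p => f p.1 p.2) ->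
  (forall x y, (0 <= f x y)%R) -> (forall m n, (0 <= h m n)%R) ->
  (forall m n x y, unit_itv m x -> unit_itv n y -> (h m n <= f x y)%R) ->
  \esum_(p in [set: int * int]) (h p.1 p.2)%:E <= \int[mu2]_p (f p.1 p.2)%:E.
Proof.
move=> mf f0 h0 hf.
have mfE : measurable_fun [set: T * T] (fun p => (f p.1 p.2)%:E) by exact/measurable_EFinP.
have f0E (p : T * T) : 0 <= (f p.1 p.2)%:E by rewrite lee_fin.
rewrite (@fubini_tonelli1 _ _ _ _ _ mu mu (fun p => (f p.1 p.2)%:E))//.
have -> : [set: int * int] = [set: int] `*`` (fun=> [set: int]).
  by apply/seteqP; split.
rewrite -(@esum_esum _ _ _ setT (fun=> setT) (fun m n => (h m n)%:E)); last first.
  by move=> i j _ _; rewrite lee_fin.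
apply: esum_le_integral.
- exact: (@measurable_fun_fubini_tonelli_F _ _ _ _ _ mu (fun p => (f p.1 p.2)%:E)).
- by move=> x; apply: integral_ge0 => y _; rewrite lee_fin.
- by move=> m; apply: esum_ge0 => n _; rewrite lee_fin.
- move=> m x mx; apply: esum_le_integral.
  + exact: (measurableT_comp mfE (measurable_pair1 x)).
  + by move=> y; rewrite lee_fin.
  + by move=> n; rewrite lee_fin.
  + by move=> n y ny; rewrite lee_fin hf.
Qed.

Lemma integral2_le_esum (f : R -> R -> R) (h : int -> int -> R) :
  measurable_fun [set: T * T] (fun p => f p.1 p.2) ->
  (forall x y, (0 <= f x y)%R) -> (forall m n, (0 <= h m n)%R) ->
  (forall m n x y, unit_itv m x -> unit_itv n y -> (f x y <= h m n)%R) ->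
  \int[mu2]_p (f p.1 p.2)%:E <= \esum_(p in [set: int * int]) (h p.1 p.2)%:E.
Proof.
move=> mf f0 h0 hf.
have mfE : measurable_fun [set: T * T] (fun p => (f p.1 p.2)%:E) by exact/measurable_EFinP.
have f0E (p : T * T) : 0 <= (f p.1 p.2)%:E by rewrite lee_fin.
rewrite (@fubini_tonelli1 _ _ _ _ _ mu mu (fun p => (f p.1 p.2)%:E))//.
have -> : [set: int * int] = [set: int] `*`` (fun=> [set: int]).
  by apply/seteqP; split.
rewrite -(@esum_esum _ _ _ setT (fun=> setT) (fun m n => (h m n)%:E)); last first.
  by move=> i j _ _; rewrite lee_fin.
apply: integral_le_esum.
- exact: (@measurable_fun_fubini_tonelli_F _ _ _ _ _ mu (fun p => (f p.1 p.2)%:E)).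
- by move=> x; apply: integral_ge0 => y _; rewrite lee_fin.
- by move=> m; apply: esum_ge0 => n _; rewrite lee_fin.
- move=> m x mx; apply: integral_le_esum.
  + exact: (measurableT_comp mfE (measurable_pair1 x)).
  + by move=> y; rewrite lee_fin.
  + by move=> n; rewrite lee_fin.
  + by move=> n y ny; rewrite lee_fin hf.
Qed.

End SumsAndIntegrals.

(** * Comparison of lattice sums with integrals *)

Section Harnack.
Variable R : realType.
Notation mu := (@lebesgue_measure R).

(** The triangle inequality in the plane: |x + iB| <= |y + iB| + |x - y| <= (1 + e) |y + iB|. *)
Lemma sqrD_shift_le (x y B e : R) : 0 <= e -> `|x - y| <= e * `|B| ->
  x ^+ 2 + B ^+ 2 <= (1 + e) ^+ 2 * (y ^+ 2 + B ^+ 2).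
Proof.
move=> e0 xy; have hx : `|x| <= `|y| + e * `|B|.
  have := ler_normD y (x - y); rewrite addrC subrK => /le_trans; apply.
  by rewrite lerD2l.
rewrite -(real_normK (num_real x)) -(real_normK (num_real y)) -(real_normK (num_real B)).
apply: (@le_trans _ _ ((`|y| + e * `|B|) ^+ 2 + `|B| ^+ 2)).
  by rewrite lerD2r lerXn2r// nnegrE// addr_ge0// mulr_ge0.
rewrite -subr_ge0.
have -> : (1 + e) ^+ 2 * (`|y| ^+ 2 + `|B| ^+ 2) -
    ((`|y| + e * `|B|) ^+ 2 + `|B| ^+ 2) =
    e ^+ 2 * `|y| ^+ 2 + e * ((`|y| - `|B|) ^+ 2 + `|y| ^+ 2 + `|B| ^+ 2) by ring.
by rewrite addr_ge0// mulr_ge0// ?addr_ge0// ?sqr_ge0.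
Qed.

Lemma inv_sqrD_shift_le (x y B e : R) (a : nat) : B != 0 -> 0 <= e ->
  `|x - y| <= e * `|B| ->
  (y ^+ 2 + B ^+ 2) ^- a <= (1 + e) ^+ (2 * a) * (x ^+ 2 + B ^+ 2) ^- a.
Proof.
move=> B0 e0 xy; have px := sqrD_gt0 x B0; have py := sqrD_gt0 y B0.
have p : 0 < (x ^+ 2 + B ^+ 2) ^+ a by rewrite exprn_gt0.
have q : 0 < (y ^+ 2 + B ^+ 2) ^+ a by rewrite exprn_gt0.
rewrite ler_pdivlMr// mulrC ler_pdivrMr//.
rewrite exprM -exprMn; apply: lerXn2r; last exact: sqrD_shift_le.
  by rewrite nnegrE ltW.
by rewrite nnegrE mulr_ge0 ?sqr_ge0// ltW.
Qed.

Lemma box_fun_shift_le (a b c : nat) (N1 N2 N3 x y x' y' e : R) :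
  N1 != 0 -> N2 != 0 -> N3 != 0 -> 0 <= e ->
  `|x - x'| <= e * `|N1| -> `|y - y'| <= e * `|N2| ->
  `|x + y - (x' + y')| <= e * `|N3| ->
  box_fun a b c N1 N2 N3 x' y' <=
  (1 + e) ^+ (2 * (a + b + c)) * box_fun a b c N1 N2 N3 x y.
Proof.
move=> n1 n2 n3 e0 h1 h2 h3; rewrite /box_fun.
have -> : (1 + e) ^+ (2 * (a + b + c)) =
    (1 + e) ^+ (2 * a) * (1 + e) ^+ (2 * b) * (1 + e) ^+ (2 * c).
  by rewrite -!exprD -!mulnDr.
have -> : (1 + e) ^+ (2 * a) * (1 + e) ^+ (2 * b) * (1 + e) ^+ (2 * c) *
   ((x ^+ 2 + N1 ^+ 2) ^- a * (y ^+ 2 + N2 ^+ 2) ^- b * ((x + y) ^+ 2 + N3 ^+ 2) ^- c) =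
   (1 + e) ^+ (2 * a) * (x ^+ 2 + N1 ^+ 2) ^- a *
   ((1 + e) ^+ (2 * b) * (y ^+ 2 + N2 ^+ 2) ^- b) *
   ((1 + e) ^+ (2 * c) * ((x + y) ^+ 2 + N3 ^+ 2) ^- c) by ring.
by rewrite !ler_pM ?mulr_ge0 ?inv_sqrD_ge0//; exact: inv_sqrD_shift_le.
Qed.

Lemma esum_ge0_fin (T : choiceType) (f : T -> R) (B : R) : (forall x, 0 <= f x) ->
  (\esum_(x in [set: T]) (f x)%:E <= B%:E)%E ->
  exists s, (\esum_(x in [set: T]) (f x)%:E = s%:E)%E.
Proof.
move=> f0; have : (0 <= \esum_(x in [set: T]) (f x)%:E)%E.
  by apply: esum_ge0 => x _; rewrite lee_fin.
by case: (\esum_(x in _) _)%E => [s| |]// _ _; exists s.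
Qed.

Lemma unit_itv_norm (m : int) (x : R) : unit_itv m x -> `|x - m%:~R| <= 1.
Proof.
rewrite /unit_itv/= in_itv/= intrD => /andP[h1 h2].
by rewrite ler_norml; apply/andP; split; lra.
Qed.

(* The summand varies by a factor 1 + O(1/t) over a unit square, even after a
   shift of the square by tau (n1, n2), uniformly in n1 and n2. *)
Lemma lattice_sum_box (a b c : nat) (n1 n2 n3 : int) (tau t B : R) :
  n1 != 0 -> n2 != 0 -> n3 != 0 -> n1 + n2 + n3 = 0 -> 0 <= tau <= 1 -> 0 < t ->
  box_integral a b c (n1%:~R * t) (n2%:~R * t) (n3%:~R * t) = B%:E ->
  exists s, [/\ (\esum_(p in [set: int * int])
     (box_fun a b c (n1%:~R * t) (n2%:~R * t) (n3%:~R * t)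
       (p.1%:~R + n1%:~R * tau) (p.2%:~R + n2%:~R * tau))%:E = s%:E)%E,
    s <= (1 + 3 / t) ^+ (2 * (a + b + c)) * B &
    B <= (1 + 3 / t) ^+ (2 * (a + b + c)) * s].
Proof.
move=> n10 n20 n30 n123 /andP[tau0 tau1] t0 BE.
set N1 := n1%:~R * t; set N2 := n2%:~R * t; set N3 := n3%:~R * t.
(* The constant 3: each coordinate is within 1 of its lattice point, and the shift adds at most
   |n_r|. For x + y the total is at most 2 + |n_3| <= 3 |n_3|, that is (3/t) |N3|. *)
set K := _ ^+ _; have e0 : 0 <= 3 / t by rewrite divr_ge0// ltW.
have K0 : 0 <= K by rewrite exprn_ge0// addr_ge0.
have Nn (n : int) : n != 0 -> n%:~R * t != 0 :> R.
  by move=> n0; rewrite mulf_neq0 ?intr_eq0// gt_eqF.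
have eN (n : int) : 3 / t * `|n%:~R * t| = 3 * `|n%:~R|.
  by rewrite normrM (gtr0_norm t0); field; rewrite gt_eqF.
have n1le (n : int) : n != 0 -> 1 <= `|n%:~R : R|.
  by move=> n0; rewrite -intr_norm ler1z -gtz0_ge1 normr_gt0.
have ntau (n : int) : `|n%:~R * tau| <= `|n%:~R : R|.
  by rewrite normrM (ger0_norm tau0) ler_piMr.
have shift (m n : int) x : n != 0 -> unit_itv m x ->
    `|m%:~R + n%:~R * tau - x| <= 3 / t * `|n%:~R * t|.
  move=> n0 /unit_itv_norm; rewrite distrC eN => h.
  have := ler_normD (m%:~R - x) (n%:~R * tau).
  rewrite (_ : m%:~R - x + _ = m%:~R + n%:~R * tau - x); last by ring.
  have := ntau n; have := n1le n n0; lra.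
have shift2 (m m' : int) x y : unit_itv m x -> unit_itv m' y ->
    `|m%:~R + n1%:~R * tau + (m'%:~R + n2%:~R * tau) - (x + y)| <= 3 / t * `|N3|.
  move=> /unit_itv_norm h /unit_itv_norm h'; rewrite eN.
  have e3 : n1%:~R + n2%:~R = - n3%:~R :> R.
    by apply/eqP; rewrite -subr_eq0 opprK -!intrD n123.
  have -> : m%:~R + n1%:~R * tau + (m'%:~R + n2%:~R * tau) - (x + y) =
      - (x - m%:~R) - (y - m'%:~R) - n3%:~R * tau.
    by rewrite -[n3%:~R]opprK -e3; ring.
  apply: (le_trans (ler_normB _ _)); apply: (le_trans (lerD (ler_normB _ _) (lexx _))).
  have := ntau n3; have := n1le n3 n30; rewrite normrN; lra.
pose f := box_fun a b c N1 N2 N3.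
pose h (m m' : int) := f (m%:~R + n1%:~R * tau) (m'%:~R + n2%:~R * tau).
have f0 x y : 0 <= f x y by exact: box_fun_ge0.
have KB : (\int[(mu \x mu)%E]_p (K * f p.1 p.2)%:E = (K * B)%:E)%E.
  rewrite EFinM -BE -ge0_integralZl_EFin//.
  by move=> p _; rewrite lee_fin.
  by apply/measurable_EFinP; exact: measurable_box.
have le1 : (\esum_(p in [set: int * int]) (h p.1 p.2)%:E <= (K * B)%:E)%E.
  rewrite -KB.
  apply: (@esum_le_integral2 _ (fun x y => K * f x y) h) => //.
  - by apply: measurable_funM => //; exact: measurable_box.
  - by move=> x y; rewrite mulr_ge0.
  - by move=> m n; exact: f0.
  - move=> m m' x y mx my; apply: box_fun_shift_le; rewrite ?Nn//.
    + by rewrite distrC; exact: shift.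
    + by rewrite distrC; exact: shift.
    + by rewrite distrC; exact: shift2.
have [s sE] := esum_ge0_fin (fun p => f0 _ _) le1.
exists s; split => //.
  by move: le1; rewrite sE lee_fin.
have Ks : (\esum_(p in [set: int * int]) (K * h p.1 p.2)%:E = (K * s)%:E)%E.
  by apply: esumZl => // p; exact: f0.
rewrite -lee_fin -Ks -BE.
apply: (@integral2_le_esum _ f (fun m n => K * h m n)) => //.
- exact: measurable_box.
- by move=> m n; rewrite mulr_ge0//; exact: f0.
- move=> m m' x y mx my; apply: box_fun_shift_le; rewrite ?Nn//.
  + exact: shift.
  + exact: shift.
  + exact: shift2.
Qed.

(** The chord over [0, 1] of a convex function. *)
Lemma expn1D_le (v : R) (n : nat) : 0 <= v <= 1 ->
  (1 + v) ^+ n <= 1 + (2 ^+ n - 1) * v.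
Proof.
move=> /andP[v0 v1]; elim: n => [|n ih].
  by rewrite !expr0 subrr mul0r addr0.
rewrite !exprS; apply: (le_trans (ler_wpM2l _ ih)); first by rewrite addr_ge0.
have h : 1 <= (2 : R) ^+ n by rewrite exprn_ege1// ler1n.
rewrite -subr_ge0.
have -> : 1 + (2 * 2 ^+ n - 1) * v - (1 + v) * (1 + (2 ^+ n - 1) * v) =
    v * ((2 ^+ n - 1) * (1 - v)) by ring.
by rewrite !mulr_ge0// subr_ge0.
Qed.

(** The integral over k is M times [kap r.+1], and a unit step is 1/M relative to the scale M. The
    resulting factor 1 + C/M costs C times [kap r.+1], uniformly in M, and the omitted k = 0 costs
    1. *)
Lemma tail_sum (r : nat) : exists2 C : R, 0 <= C & forall M : R, 1 <= M ->
  exists s, has_sum (fun k : int => if k != 0 then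
      (M ^+ 2 / (k%:~R ^+ 2 + M ^+ 2)) ^+ r.+1 else 0) s /\
    `|s - M * kap R r.+1| <= C.
Proof.
pose C : R := 2 ^+ (2 * r.+1) - 1; pose kp := kap R r.+1.
have C0 : 0 <= C by rewrite subr_ge0 exprn_ege1// ler1n.
have kp0 : 0 <= kp.
  have : (0%E <= (kp * 1 ^- (2 * r).+1)%:E)%E.
    by rewrite -integral_kap//; apply: integral_ge0 => x _; rewrite lee_fin inv_sqrD_ge0.
  by rewrite expr1n invr1 mulr1 lee_fin.
exists (C * kp + 1) => [|M M1]; first by rewrite addr_ge0// mulr_ge0.
have M0 : 0 < M by lra.
have Mn : M != 0 by rewrite gt_eqF.
pose g (x : R) := (M ^+ 2) ^+ r.+1 * (x ^+ 2 + M ^+ 2) ^- r.+1.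
have g0 x : 0 <= g x by rewrite mulr_ge0 ?inv_sqrD_ge0// exprn_ge0// sqr_ge0.
have mg : measurable_fun [set: R] g.
  apply: measurable_funM => //.
  have := measurable_inv_sqrD 0 M r.+1.
  by under eq_fun do rewrite addr0.
have gint : (\int[mu]_x (g x)%:E = (M * kp)%:E)%E.
  under eq_integral do rewrite EFinM.
  rewrite ge0_integralZl_EFin//.
  - rewrite integral_kap// -EFinM; congr EFin.
    rewrite -exprM mulnS exprD (exprS _ (2 * r)) -/kp; have := expf_neq0 (2 * r) Mn.
    by move: (M ^+ (2 * r)) => m m0; field; rewrite m0 Mn.
  - by move=> x _; rewrite lee_fin inv_sqrD_ge0.
  - apply/measurable_EFinP; have := measurable_inv_sqrD 0 M r.+1.
    by under eq_fun do rewrite addr0.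
  - by rewrite exprn_ge0// sqr_ge0.
pose K : R := (1 + M^-1) ^+ (2 * r.+1).
have Mi : 0 <= M^-1 <= 1 by rewrite invr_ge0 ltW//= invf_le1.
have K0 : 0 <= K by rewrite exprn_ge0// addr_ge0//; case/andP: Mi.
have KC : K <= 1 + C / M by exact: expn1D_le.
have shift x y : `|x - y| <= 1 -> g y <= K * g x.
  move=> xy; rewrite /g mulrCA ler_wpM2l ?exprn_ge0 ?(ltW M0)//.
  apply: inv_sqrD_shift_le => //; first by case/andP: Mi.
  by rewrite (gtr0_norm M0) mulVf.
have KgE : (\int[mu]_x (K * g x)%:E = (K * (M * kp))%:E)%E.
  under eq_integral do rewrite EFinM.
  rewrite ge0_integralZl_EFin// ?gint//.
  - by move=> x _; rewrite lee_fin.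
  - exact/measurable_EFinP.
have le1 : (\esum_(m in [set: int]) (g m%:~R)%:E <= (K * (M * kp))%:E)%E.
  rewrite -KgE; apply: esum_le_integral.
  - by apply/measurable_EFinP; exact: measurable_funM.
  - by move=> x; rewrite lee_fin mulr_ge0.
  - by move=> m; rewrite lee_fin.
  - by move=> m x /unit_itv_norm mx; rewrite lee_fin shift.
have [s sE] := esum_ge0_fin (fun m => g0 _) le1.
have le2 : M * kp <= K * s.
  rewrite -lee_fin -gint -(esumZl K0 (fun m => g0 _) sE).
  apply: integral_le_esum.
  - exact/measurable_EFinP.
  - by move=> x; rewrite lee_fin.
  - by move=> m; rewrite lee_fin mulr_ge0.
  - by move=> m x /unit_itv_norm mx; rewrite lee_fin shift// distrC.
move: le1; rewrite sE lee_fin => le1.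
exists (s - 1); split.
  have h0 : has_sum (fun k : int => if k == 0 then 1 else 0 : R) 1.
    apply: (@has_sum_inj_supp _ _ _ _ (fun _ : unit => 0)).
    - by move=> [] [].
    - by move=> x nx; case: eqP => // x0; exfalso; apply: nx; exists tt.
    - apply: has_sum_nneg => //=; rewrite (_ : [set: unit] = [set tt]).
        by rewrite esum_set1// lee_fin.
      by apply/seteqP; split => // -[].
  have := has_sumB (has_sum_nneg (fun m => g0 _) sE) h0.
  apply: eq_has_sum => // k; rewrite /g; case: eqP => [->|k0] /=.
    by rewrite expr0n/= add0r mulfV ?subrr// expf_neq0// expf_neq0.
  by rewrite subr0 expr_div_n.
have Mk : 0 <= M * kp by rewrite mulr_ge0// ltW.
have s0 : 0 <= s by rewrite -lee_fin -sE; apply: esum_ge0 => m _; rewrite lee_fin.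
have b1 : s <= M * kp + C * kp.
  apply: (le_trans le1); apply: (le_trans (ler_wpM2r Mk KC)).
  by rewrite mulrDl mul1r lerD2l mulrA divfK.
have b2 : M * kp <= s + C * kp.
  have KM := ler_wpM2r s0 KC; have h := le_trans le2 KM.
  have [sM|/ltW Ms] := leP s (M * kp); last first.
    by apply: (le_trans Ms); rewrite lerDl mulr_ge0.
  apply: (le_trans h); rewrite mulrDl mul1r lerD2l.
  have CM : 0 <= C / M by rewrite divr_ge0// ltW.
  by apply: (le_trans (ler_wpM2l CM sM)); rewrite mulrA divfK.
rewrite -/kp; move: b1 b2 (mulr_ge0 C0 kp0); move: (M * kp) (C * kp) => X Y b1 b2 Y0.
by rewrite ler_norml; apply/andP; split; lra.
Qed.

End Harnack.

(** * Unfolding the integral over tau_1 *)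

Section Unfolding.
Variable R : realType.
Notation mu := (@lebesgue_measure R).
Local Open Scope ereal_scope.

Lemma integral_unit_itvs (f : R -> \bar R) (m : int) (N : nat) :
  measurable_fun [set: R] f -> (forall x, 0 <= f x) ->
  \int[mu]_(x in `[m%:~R, (m + N%:Z)%R%:~R[%classic) f x =
  \sum_(j < N) \int[mu]_(x in unit_itv (m + j%:Z)%R) f x.
Proof.
move=> mf f0; elim: N => [|N ih].
  by rewrite addr0 set_itvco0 integral_set0 big_ord0.
rewrite big_ord_recr/= -ih.
rewrite (@itv_bndbnd_setU _ _ _ (BLeft ((m + N%:Z)%R%:~R : R))); last 2 first.
- by rewrite bnd_simp ler_int lerDl.
- by rewrite bnd_simp ler_int lerD2l lez_nat leqnSn.
have -> : (m + N.+1%:Z)%R = (m + N%:Z + 1)%R by rewrite -addrA -PoszD addn1.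
rewrite ge0_integral_setU//.
- exact: measurable_funTS.
- rewrite disj_set2E; apply/eqP; rewrite -subset0 => x [] /=.
  by rewrite !in_itv/= => /andP[_ h1] /andP[h2 _]; have := lt_le_trans h1 h2; rewrite ltxx.
Qed.

Lemma integral_affine (f : R -> R) (m : R) (N : nat) : (0 < N)%N ->
  continuous f -> (forall x, (0 <= f x)%R) ->
  \int[mu]_(x in `[m, (m + N%:R)%R[%classic) (f x)%:E =
  N%:R%:E * \int[mu]_(x in `[0%R, 1%R]%classic) (f (m + N%:R * x)%R)%:E.
Proof.
move=> N0 cf f0.
have mf : measurable_fun [set: R] f by exact: continuous_measurable_fun.
have dF (x : R) : is_derive x 1%R (fun x : R => m + N%:R * x)%R N%:R%R.
  by apply: is_derive_eq; rewrite /GRing.scale/= !(add0r, mul1r, mulr1).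
have DF : derive1 (fun x : R => m + N%:R * x)%R = cst N%:R%R.
  by apply/funext => x; rewrite derive1E; exact: derive_val.
have cF : continuous (fun x : R => m + N%:R * x)%R.
  by move=> x; exact: is_derive_continuous (dF x).
have := @integration_by_substitution_increasing R (fun x => m + N%:R * x)%R f 0%R 1%R ler01.
rewrite mulr0 addr0 mulr1 => h.
rewrite integral_itv_bndo_bndc; last exact/measurable_EFinP/measurable_funTS.
rewrite h; first last.
- exact: continuous_subspaceT.
- split.
  + by move=> x _; exact: ex_derive.
  + exact/cvg_at_right_filter/cF.
  + exact/cvg_at_left_filter/cF.
- by rewrite DF; exact: is_cvg_cst.
- by rewrite DF; exact: is_cvg_cst.
- by rewrite DF => x _; exact: cvg_cst.
- by move=> x y _ _ xy; rewrite ltrD2l ltr_pM2l// ltr0n.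
rewrite -ge0_integralZl_EFin//.
- by apply: eq_integral => x _; rewrite DF /= -EFinM mulrC.
- by move=> x _; rewrite lee_fin.
- apply/measurable_EFinP/measurable_funTS.
  by apply: measurableT_comp => //; exact: continuous_measurable_fun.
Qed.

(** For n > 0, n times the integral of f(m + n x) over [0, 1] is the integral of f over [m, m + n],
    and summing over m covers every unit interval n times. The reflection x -> 1 - x reduces n < 0
    to this case. *)
Lemma unfold_line (f : R -> R) (n : int) : (n != 0)%R ->
  continuous f -> (forall x, (0 <= f x)%R) ->
  \esum_(m in [set: int])
    \int[mu]_(x in `[0%R, 1%R]%classic) (f (m%:~R + n%:~R * x)%R)%:E =
  \int[mu]_x (f x)%:E.
Proof.
wlog n0 : n / (0 < n)%R => [wlg n0 cf f0|_ cf f0].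
  have [np|np] := ltP 0%R n; first exact: wlg.
  have nn : (0 < - n)%R by rewrite oppr_gt0 lt_neqAle n0.
  rewrite -(wlg (- n)%R nn _ cf f0) ?oppr_eq0//.
  have be : set_bij [set: int] [set: int] (fun m : int => m + n)%R.
    split => //; first by move=> x y _ _ /addIr.
    by move=> y _; exists (y - n)%R => //; rewrite subrK.
  rewrite [RHS](reindex_esum _ _ _ _ be); apply: eq_esum => m _.
  have cg : continuous (fun x : R => f (m%:~R + n%:~R * x)%R).
    move=> x; apply: continuous_comp; last exact: cf.
    have dF : is_derive x 1%R (fun x : R => m%:~R + n%:~R * x)%R n%:~R%R.
      by apply: is_derive_eq; rewrite /GRing.scale/= !(add0r, mul1r, mulr1).
    exact: is_derive_continuous dF.
  rewrite (@integration_by_substitution_onem R (fun x => f (m%:~R + n%:~R * x)%R) 1%R).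
  - rewrite /unstable.onem subrr; apply: eq_integral => x _; congr (f _)%:E.
    by rewrite intrD mulrNz; ring.
  - by rewrite ler01 lexx.
  - exact: continuous_subspaceT.
case: n n0 => // N N0; set I := \int[mu]_x (f x)%:E; set S := esum _ _.
have mf : measurable_fun [set: R] (fun x => (f x)%:E).
  by apply/measurable_EFinP; exact: continuous_measurable_fun.
have f0E x : 0 <= (f x)%:E by rewrite lee_fin.
have NR : (N%:R : R) != 0%R by rewrite pnatr_eq0 -lt0n.
have shift (j : int) : \esum_(m in [set: int]) \int[mu]_(x in unit_itv (m + j)%R) (f x)%:E = I.
  rewrite /I (integral_unit_itv mf f0E).
  have be : set_bij [set: int] [set: int] (fun m : int => m + j)%R.
    split => //; first by move=> x y _ _ /addIr.
    by move=> y _; exists (y - j)%R => //; rewrite subrK.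
  by rewrite [RHS](reindex_esum _ _ _ _ be).
have sumE (A : \bar R) : 0 <= A -> \sum_(j < N) A = N%:R%:E * A.
  move=> A0; elim: (N) => [|k ih]; first by rewrite big_ord0 mul0e.
  by rewrite big_ord_recr/= ih -natr1 EFinD ge0_muleDl ?mul1e// lee_fin.
have int0 (D : set R) : 0 <= \int[mu]_(x in D) (f x)%:E by exact: integral_ge0.
have I0 : 0 <= I by exact: integral_ge0.
have S0 : 0 <= S.
  by apply: esum_ge0 => m _; apply: integral_ge0 => x _; rewrite lee_fin.
have key : N%:R%:E * S = N%:R%:E * I.
  rewrite -(sumE S S0) -(sumE I I0).
  rewrite -esum_sum; last by move=> m j _ _; apply: integral_ge0 => x _; rewrite lee_fin.
  under [RHS]eq_bigr => j _ do rewrite -(shift j%:Z).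
  rewrite -esum_sum; last by move=> m j _ _; exact: int0.
  apply: eq_esum => m _; rewrite -(integral_unit_itvs m N mf f0E) intrD.
  rewrite (integral_affine _ N0 cf f0) sumE; first by [].
  by apply: integral_ge0 => x _; rewrite lee_fin.
have : (N%:R^-1)%:E * (N%:R%:E * S) = (N%:R^-1)%:E * (N%:R%:E * I) by rewrite key.
by rewrite !muleA -EFinM mulVf// !mul1e.
Qed.

End Unfolding.

(** * Asymptotics *)

Section Asymptotics.
Variable R : realType.

(* f t = p(t) + O(1/t) for a polynomial p with constant term c. *)
Definition asym (f : R -> R) (c : R) : Prop :=
  exists p : {poly R}, p.[0] = c /\ exists K t0 : R,
    0 < t0 /\ forall t, t0 <= t -> `|f t - p.[t]| <= K / t.

(** In Horner form, p(t) t + c = O(1/t) forces p(t) = O(1/t), so p = 0 by induction; then c t is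
    bounded and c = 0. *)
Lemma bounded_poly_eq0 (p : {poly R}) (K t0 : R) : 0 < t0 ->
  (forall t, t0 <= t -> `|p.[t]| <= K / t) -> p = 0.
Proof.
elim/poly_ind: p K => [//|p c ih] K t00 pK.
have p0 : p = 0.
  apply: (ih (K / t0 + `|c|)) => // t tt0.
  have tp : 0 < t by exact: lt_le_trans tt0.
  have := pK t tt0; rewrite hornerMXaddC => h.
  rewrite ler_pdivlMr// -[X in _ * X](gtr0_norm tp) -normrM.
  have := ler_normB (p.[t] * t + c) c; rewrite addrK => /le_trans; apply.
  rewrite lerD2r; apply: (le_trans h).
  have K0 : 0 <= K.
    by have := le_trans (normr_ge0 _) h; rewrite pmulr_lge0// invr_gt0.
  by rewrite ler_wpM2l// lef_pV2// posrE.
rewrite p0 mul0r add0r; apply/eqP; rewrite polyC_eq0; apply/eqP.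
have cK t : t0 <= t -> `|c| * t <= K.
  move=> tt0; have tp : 0 < t by exact: lt_le_trans tt0.
  by have := pK t tt0; rewrite p0 mul0r add0r hornerC ler_pdivlMr.
apply/eqP/negPn/negP => c0; have cp : 0 < `|c| by rewrite normr_gt0.
have K0 : 0 <= K by apply: le_trans (cK t0 (lexx _)); rewrite mulr_ge0// ltW.
have tt : t0 <= t0 + (K + 1) / `|c| by rewrite lerDl divr_ge0 ?addr_ge0// ltW.
have := cK _ tt; rewrite mulrDr (mulrCA `|c|) mulfV ?gt_eqF// mulr1.
have : 0 < `|c| * t0 by rewrite mulr_gt0.
lra.
Qed.

Lemma asym_uniq f c c' : asym f c -> asym f c' -> c = c'.
Proof.
move=> [p [<- [K [t0 [t00 pK]]]]] [q [<- [K' [t1 [t10 qK]]]]].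
suff : p - q = 0 by move/eqP; rewrite subr_eq0 => /eqP ->.
apply: (@bounded_poly_eq0 _ (K + K') (t0 + t1)); first by rewrite addr_gt0.
move=> t tt; rewrite !hornerE.
rewrite (_ : _ - _ = (f t - q.[t]) - (f t - p.[t])); last by ring.
apply: (le_trans (ler_normB _ _)); rewrite mulrDl addrC lerD//.
  by apply: pK; apply: le_trans tt; rewrite lerDl ltW.
by apply: qK; apply: le_trans tt; rewrite lerDr ltW.
Qed.

Lemma asymD f g c d : asym f c -> asym g d -> asym (fun t => f t + g t) (c + d).
Proof.
move=> [p [<- [K [t0 [t00 pK]]]]] [q [<- [K' [t1 [t10 qK]]]]].
exists (p + q); split; first by rewrite hornerD.
exists (K + K'), (t0 + t1); split; first by rewrite addr_gt0.
move=> t tt; rewrite hornerD.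
rewrite (_ : _ - _ = (f t - p.[t]) + (g t - q.[t])); last by ring.
apply: (le_trans (ler_normD _ _)); rewrite mulrDl lerD//.
  by apply: pK; apply: le_trans tt; rewrite lerDl ltW.
by apply: qK; apply: le_trans tt; rewrite lerDr ltW.
Qed.

Lemma asymZ f c a : asym f c -> asym (fun t => a * f t) (a * c).
Proof.
move=> [p [<- [K [t0 [t00 pK]]]]].
exists (a *: p); split; first by rewrite hornerZ.
exists (`|a| * K), t0; split => // t tt; rewrite hornerZ -mulrBr normrM -mulrA.
by rewrite ler_wpM2l// pK.
Qed.

Lemma asym_near f g c (t0 : R) : 0 < t0 -> (forall t, t0 <= t -> f t = g t) ->
  asym f c -> asym g c.
Proof.
move=> t00 fg [p [<- [K [t1 [t10 pK]]]]].
exists p; split => //; exists K, (t0 + t1); split; first by rewrite addr_gt0.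
move=> t tt; rewrite -fg ?pK//.
  by apply: le_trans tt; rewrite lerDr ltW.
by apply: le_trans tt; rewrite lerDl ltW.
Qed.

Lemma asym_le f c (K t0 : R) : 0 < t0 ->
  (forall t, t0 <= t -> `|f t - c| <= K / t) -> asym f c.
Proof.
move=> t00 fK; exists c%:P; split; first by rewrite hornerC.
by exists K, t0; split => // t tt; rewrite hornerC fK.
Qed.

Lemma asym0 : asym (fun=> 0) 0.
Proof.
by apply: (@asym_le _ _ 0 1) => // t _; rewrite subrr normr0 mul0r.
Qed.

Lemma asym_expn (n : nat) : (0 < n)%N -> asym (fun t => t ^+ n) 0.
Proof.
move=> n0; exists 'X^n; split; first by rewrite hornerXn expr0n gtn_eqF.
exists 0, 1; split => // t _; by rewrite hornerXn subrr normr0 mul0r.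
Qed.

Lemma asym_sum (I : Type) (r : seq I) (f : I -> R -> R) (c : I -> R) :
  (forall i, asym (f i) (c i)) ->
  asym (fun t => \sum_(i <- r) f i t) (\sum_(i <- r) c i).
Proof.
move=> fc; elim: r => [|i r ih].
  by rewrite big_nil; apply: asym_near asym0 => // t _; rewrite big_nil.
rewrite big_cons; apply: asym_near (asymD (fc i) ih) => // t _.
by rewrite big_cons.
Qed.

Lemma asym_sum_nat (m n : nat) (f : nat -> R -> R) (c : nat -> R) :
  (forall i, (m <= i < n)%N -> asym (f i) (c i)) ->
  asym (fun t => \sum_(m <= i < n) f i t) (\sum_(m <= i < n) c i).
Proof.
move=> fc; rewrite big_nat.
apply: (@asym_near (fun t => \sum_(m <= i < n | (m <= i < n)%N) f i t) _ _ 1) => //.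
  by move=> t _; rewrite [RHS]big_nat.
rewrite big_mkcond.
apply: (@asym_near (fun t => \sum_(m <= i < n) if (m <= i < n)%N then f i t else 0) _ _ 1) => //.
  by move=> t _; rewrite [RHS]big_mkcond.
by apply: asym_sum => i; case: ifPn => [/fc//|_]; exact: asym0.
Qed.

(** For n > 0, from exp(x) = exp(x/n)^n >= (x/n)^n at x = e t. *)
Lemma expn_mul_expN_le (e t : R) (n : nat) : 0 < e -> 0 < t ->
  t ^+ n * expR (- (e * t)) <= (n%:R / e) ^+ n.
Proof.
move=> e0 t0; case: n => [|n].
  rewrite !expr0 mul1r -expR0 ler_expR oppr_le0 mulr_ge0// ltW//.
have n0 : (0 : R) < n.+1%:R by rewrite ltr0n.
have x0 : 0 <= e * t / n.+1%:R by rewrite divr_ge0// ltW// mulr_gt0.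
have h : (e * t / n.+1%:R) ^+ n.+1 <= expR (e * t).
  have -> : expR (e * t) = expR (e * t / n.+1%:R) ^+ n.+1.
    rewrite -expRM_natl; congr expR; by field; rewrite gt_eqF.
  apply: lerXn2r; rewrite ?nnegrE ?expR_ge0//.
  by apply: le_trans (expR_ge1Dx _); rewrite lerDr.
rewrite expRN ler_pdivrMr ?expR_gt0//.
apply: le_trans (ler_wpM2l _ h); last first.
  by rewrite exprn_ge0// divr_ge0// ltW.
rewrite -exprMn (_ : n.+1%:R / e * _ = t)//.
by field; rewrite !gt_eqF.
Qed.

(** After multiplication by t^(w-2) the zeta terms have the odd exponents 2w - 2k - 3, so none of
    them meets the constant term: they are positive for k < w - 1, and k = w - 1 gives 1/t. *)
Lemma asym_laurent (w : nat) (c : int -> rat) (d : R) : (2 < w)%N ->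
  asym (fun t => t ^+ (w - 2) * laurent_poly w c d t) (d / (4 * pi) ^+ (w - 2)).
Proof.
move=> w2; have p0 : 0 < 4 * pi :> R by rewrite mulr_gt0// pi_gt0.
have pn : 4 * pi != 0 :> R by rewrite gt_eqF.
pose f (k : nat) (t : R) : R := t ^+ (w - 2) * (ratr (c (w%:Z - (2 * k)%:Z - 1)) *
      (zeta R (2 * k + 1) / (4 * pi * t) ^ ((2 * k + 1)%:Z - w%:Z))).
have fE k (t : R) : 0 < t -> f k t = ratr (c (w%:Z - (2 * k)%:Z - 1)) *
   zeta R (2 * k + 1) / (4 * pi) ^ ((2 * k + 1)%:Z - w%:Z) *
   t ^ ((2 * w)%:Z - (2 * k)%:Z - 3).
  move=> t0; have tn : t != 0 by rewrite gt_eqF.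
  rewrite /f exprzMl ?unitfE// invfM (exprnP t (w - 2)).
  have -> : (2 * w)%:Z - (2 * k)%:Z - 3 = (w - 2)%:Z - ((2 * k + 1)%:Z - w%:Z) by lia.
  rewrite [in RHS](expfzDr _ _ tn) -invr_expz.
  by move: (t ^ _) (t ^ _)^-1 ((4 * pi) ^ _)^-1 => A B C; ring.
have := asymD (asymD (asymZ (ratr (c w%:Z) * (- (4 * pi)) ^+ w)
  (asym_expn (n := 2 * w - 2) ltac:(lia)))
  (@asym_sum_nat 1 w f (fun=> 0) _))
  (@asym_le (fun=> d / (4 * pi) ^+ (w - 2)) (d / (4 * pi) ^+ (w - 2)) 0 1 ltr01 _).
rewrite mulr0 big1// !add0r => h; apply: (asym_near ltr01 _ (h _ _)).
- move=> t t1; have t0 : 0 < t by exact: lt_le_trans t1.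
  have tn : t != 0 by rewrite gt_eqF.
  rewrite /laurent_poly 2!(mulrDr (t ^+ (w - 2))) mulr_sumr; congr (_ + _ + _).
    rewrite (_ : (2 * w - 2 = w - 2 + w)%N); last by lia.
    rewrite (_ : - (4 * pi * t) = - (4 * pi) * t); last by rewrite mulNr.
    by rewrite exprD (exprMn w _ t); ring.
  have -> : w%:Z - 2 = (w - 2)%:Z by lia.
  rewrite -exprnP (exprMn (w - 2) _ t).
  have := expf_neq0 (w - 2) tn; have := expf_neq0 (w - 2) pn.
  move: (t ^+ (w - 2)) ((4 * pi) ^+ (w - 2)) => A B B0 A0.
  by field; rewrite A0 B0.
- move=> k /andP[k1 kw].
  have [kw'|kw'] := ltnP k (w - 1).
    have e : (2 * w)%:Z - (2 * k)%:Z - 3 = (2 * w - 2 * k - 3)%N%:Z by lia.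
    have := asymZ (ratr (c (w%:Z - (2 * k)%:Z - 1)) *
       zeta R (2 * k + 1) / (4 * pi) ^ ((2 * k + 1)%:Z - w%:Z))
      (asym_expn (n := 2 * w - 2 * k - 3) ltac:(lia)).
    rewrite mulr0; apply: (asym_near ltr01) => t t1.
    by rewrite fE ?e// (lt_le_trans _ t1).
  apply: (@asym_le _ _ `|ratr (c (w%:Z - (2 * k)%:Z - 1)) *
       zeta R (2 * k + 1) / (4 * pi) ^ ((2 * k + 1)%:Z - w%:Z)| 1) => // t t1.
  have t0 : 0 < t by exact: lt_le_trans t1.
  have e : (2 * w)%:Z - (2 * k)%:Z - 3 = - 1%:Z by lia.
  by rewrite subr0 fE// e normrM exprN1 (gtr0_norm (x := t^-1))// invr_gt0.
- by move=> t _; rewrite subrr normr0 mul0r.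
Qed.

(** One power of t more than t^(w-2) is still absorbed by the exponential decay, which makes the
    remainder O(1/t). *)
Lemma asym_is_c (a1 a2 a3 : nat) (d : R) : (2 < a1 + a2 + a3)%N ->
  is_c_2_minus_w a1 a2 a3 d ->
  asym (fun t => t ^+ (a1 + a2 + a3 - 2) * constant_mode a1 a2 a3 t)
    (d / (4 * pi) ^+ (a1 + a2 + a3 - 2)).
Proof.
set w := (a1 + a2 + a3)%N => w2 [c [e [K [e0 [t0 [_ h]]]]]].
pose t1 := Num.max 1 (t0 + 1).
have t11 : 1 <= t1 by rewrite le_max lexx.
rewrite -[X in asym _ X]addr0.
have ex := @asym_le (fun t => t ^+ (w - 2) *
  (constant_mode a1 a2 a3 t - laurent_poly w c d t)) 0
  (`|K| * (((w - 1)%N%:R / e) ^+ (w - 1))) t1.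
apply: asym_near (asymD (asym_laurent c d w2) (ex _ _)); first exact: (lt_le_trans ltr01 t11).
- by move=> t _; ring.
- exact: (lt_le_trans ltr01 t11).
- move=> t tt; have t0' : t0 < t.
    by apply: lt_le_trans tt; rewrite lt_max ltrDl ltr01 orbT.
  have tp : 0 < t by apply: lt_le_trans tt; exact: (lt_le_trans ltr01 t11).
  rewrite subr0 normrM (ger0_norm (exprn_ge0 _ (ltW tp))).
  have h1 : `|constant_mode a1 a2 a3 t - laurent_poly w c d t| <=
      `|K| * expR (- (e * t)).
    apply: (le_trans (h _ t0')); rewrite ler_wpM2r ?expR_ge0//.
    exact: ler_norm.
  apply: (le_trans (ler_wpM2l (exprn_ge0 _ (ltW tp)) h1)).
  rewrite ler_pdivlMr// mulrCA -!mulrA ler_wpM2l//.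
  apply: le_trans (expn_mul_expN_le (w - 1) e0 tp).
  have -> : (w - 1 = (w - 2).+1)%N by lia.
  by rewrite exprS le_eqVlt; apply/orP; left; apply/eqP; ring.
Qed.

End Asymptotics.

(** Commuting partial derivatives, but as an equality of formal lists: [pair_dz] raises p and r
    together and leaves the coefficient p - r of [pair_dx] unchanged. It allows all three summands
    to be written with [comb3]. *)
Lemma pair_dz_dx (a b : nat) (l : pair_comb) :
  pair_dz b (pair_dx a l) = pair_dx a (pair_dz b l).
Proof.
rewrite /pair_dz /pair_dx map_flatten -!map_comp; congr flatten.
apply: eq_map => -[c [[p q] r]] /=.
have e : (p.+1%:R - r.+1%:R : rat) = p%:R - r%:R by rewrite -!natr1; ring.
by rewrite e; congr [:: (_, _); (_, _); (_, _)]; ring.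
Qed.

Lemma pair_dz_swap (b : nat) (l : pair_comb) :
  pair_dz b (pair_swap l) = pair_swap (pair_dz b l).
Proof.
by rewrite /pair_dz /pair_swap -!map_comp; apply: eq_map => -[c [[p q] r]].
Qed.

Lemma pair_dz_dy (a b : nat) (l : pair_comb) :
  pair_dz b (pair_dy a l) = pair_dy a (pair_dz b l).
Proof. by rewrite /pair_dy pair_dz_swap pair_dz_dx pair_dz_swap. Qed.

Lemma iter_op_comm (T : Type) (f g : nat -> T -> T) (m n : nat) (l : T) :
  (forall a b l, g b (f a l) = f a (g b l)) ->
  iter_op g m (iter_op f n l) = iter_op f n (iter_op g m l).
Proof.
move=> fg; have comm1 b k l' : g b (iter_op f k l') = iter_op f k (g b l').
  by elim: k => //= k <-; rewrite fg.
by elim: m => //= m ->; rewrite comm1.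
Qed.

Lemma comb2E a b c : comb2 a b c = comb3 a c b.
Proof. by rewrite /comb2 /comb3 (iter_op_comm _ _ _ pair_dz_dy). Qed.

Lemma comb1E a b c : comb1 a b c = comb3 b c a.
Proof.
rewrite /comb1 /comb3 (iter_op_comm _ _ _ pair_dz_dx).
by rewrite (iter_op_comm _ _ _ pair_dz_dy).
Qed.

(** At every step the exponent r of V equals the index a of the operator, so the coefficient r / a
    is 1. *)
Lemma iter_dz_start (c : nat) :
  iter_op pair_dz c pair_start = [:: (1, (c.+2, c.+2, c.+1))].
Proof.
by elim: c => //= c ->; rewrite /pair_dz/= mul1r divff.
Qed.

Lemma pair_ok_comb3 a b c : pair_ok (2 * (a + b + c).+2) (comb3 a b c).
Proof.
have -> : (2 * (a + b + c).+2 = 4 + c.*2 + b.*2 + a.*2)%N by lia.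
apply: pair_ok_iter; first exact: pair_ok_dx.
apply: pair_ok_iter; first exact: pair_ok_dy.
by apply: pair_ok_iter; first exact: pair_ok_dz.
Qed.

Lemma line_ok_tail_comb a b l r :
  line_ok (2 + l + b.*2 + a.*2) (tail_comb a b l r).
Proof.
apply: line_ok_iter; first exact: line_ok_dx.
apply: line_ok_iter; first exact: line_ok_dy.
by rewrite /line_ok/= andbT; lia.
Qed.

(** * Closed forms on the plane and their lattice sums *)

Section PlaneSums.
Variable R : realType.

Lemma is_derive_unique_near (f g : R -> R) (x e d d' : R) : 0 < e ->
  (forall y, `|y - x| < e -> f y = g y) -> is_derive x 1 f d ->
  is_derive x 1 g d' -> d = d'.
Proof.
move=> e0 fg df dg.
rewrite -(@derive_val _ _ _ _ _ _ _ df) -(@derive_val _ _ _ _ _ _ _ dg).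
apply: near_eq_derive; exists e => //= y /=.
by rewrite /ball/= distrC => /fg.
Qed.

(** The source of the cancellation of zeta(2w-2). Both sides obey the same recursions, because (1/y)
    d/dy is invariant under y -> -y; for a = b = 0 both are explicit, with [kap 1 = pi] on the left
    and V = x y / (x + y)^2 on the right. *)
Lemma line_int_pair_eval (a b c : nat) (x y : R) : 0 < x -> 0 < y ->
  line_int (tail_comb a b (2 * c.+1) 1) x y =
  (-1) ^+ c * pi * pair_eval (comb3 a b c) x (- y) 0.
Proof.
have Q0 (u v : R) : 0 < u -> 0 < v -> 0 ^+ 2 - (u - - v) ^+ 2 != 0.
  by move=> u0 v0; rewrite expr0n/= sub0r oppr_eq0 opprK expf_neq0// gt_eqF// addr_gt0.
have cancel (u v p q : R) (n : nat) : (0 < n)%N -> u != 0 ->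
    - (2 * u * n%:R) * p = v * (- (2 * u * n%:R) * q) -> p = v * q.
  move=> n0 u0; rewrite mulrCA; apply: mulfI.
  by rewrite oppr_eq0 !mulf_neq0// pnatr_eq0 -lt0n.
elim: a x y => [|a iha] x y x0 y0.
  elim: b y y0 => [|b ihb] y y0.
    rewrite /comb3 /= iter_dz_start /line_int /pair_eval !big_seq1 /=.
    rewrite rmorph1 !mul1r /pair_mon/= /pair_V expr0n/= sub0r opprK.
    have xn : x != 0 by rewrite gt_eqF.
    have yn : y != 0 by rewrite gt_eqF.
    have sn : x + y != 0 by rewrite gt_eqF// addr_gt0.
    have eN : (- y) ^- c.+2 = (-1) ^+ c * (y ^- c.+1 * y^-1).
      rewrite (exprNn y) invfM invr_sign !exprS !invfM; ring.
    have eX : x ^- c.+2 = x ^- c.+1 * x^-1 by rewrite exprSr invfM mulrC.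
    have eV : (x * - y / - (x + y) ^+ 2) ^+ c.+1 =
        x ^+ c.+1 * y ^+ c.+1 * (x + y) ^- (2 * c.+1).
      by rewrite mulrN invrN mulrNN expr_div_n (exprMn c.+1 x y) -exprM.
    rewrite eN eX eV !expr1.
    have sg2 : (-1) ^+ c * (-1) ^+ c = 1 :> R.
      by rewrite -exprD addnn -muln2 exprM sqrr_sign.
    have X0 := expf_neq0 c.+1 xn; have Y0 := expf_neq0 c.+1 yn.
    rewrite -[LHS]mul1r -[X in X * _ = _]sg2.
    move: ((-1) ^+ c) (x ^+ c.+1) (y ^+ c.+1) ((x + y) ^- (2 * c.+1)) X0 Y0.
    by move=> s X Y M X0 Y0; field; rewrite xn yn X0 Y0.
  apply: (cancel y _ _ _ b.+1) => //; first by rewrite gt_eqF.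
  have dl := is_derive_line_int_y (tail_comb 0 b (2 * c.+1) 1) (isT : (0 < b.+1)%N)
    (lt0r_neq0 y0) (lt0r_neq0 (addr_gt0 x0 y0)).
  have ny : - y != 0 by rewrite oppr_eq0 gt_eqF.
  have dp := is_derive_pair_y (comb3 0 b c) (isT : (0 < b.+1)%N)
    (lt0r_neq0 x0) ny (Q0 _ _ x0 y0).
  have dn : is_derive y 1 (fun y : R => - y) (-1) by exact: is_deriveNid.
  have dpc := @is_derive1_comp _ (fun v => pair_eval (comb3 0 b c) x v 0) (fun v => - v) y _ _ dp dn.
  have := is_derive_unique_near y0 _ dl (is_deriveZ ((-1) ^+ c * pi) dpc).
  rewrite /= => -> //.
    by rewrite /GRing.scale/=; ring.
  move=> v vy; rewrite ihb//; last exact: gt0_near y0 vy (lexx _).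
apply: (cancel x _ _ _ a.+1) => //; first by rewrite gt_eqF.
have dl := is_derive_line_int_x (tail_comb a b (2 * c.+1) 1) (isT : (0 < a.+1)%N)
  (lt0r_neq0 x0) (lt0r_neq0 (addr_gt0 x0 y0)).
have ny : - y != 0 by rewrite oppr_eq0 gt_eqF.
have dp := is_derive_pair_x (comb3 a b c) (isT : (0 < a.+1)%N)
  (lt0r_neq0 x0) ny (Q0 _ _ x0 y0).
have := is_derive_unique_near x0 _ dl (is_deriveZ ((-1) ^+ c * pi) dp).
rewrite /= => -> //.
by move=> v vx; rewrite iha//; exact: gt0_near x0 vx (lexx _).
Qed.

Lemma pair_eval_scale (n : nat) (l : pair_comb) (t x y z : R) : pair_ok n l ->
  t != 0 -> pair_eval l (x * t) (y * t) (z * t) = t ^- n * pair_eval l x y z.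
Proof.
move=> /allP okl t0; rewrite /pair_eval mulr_sumr.
apply: eq_big_seq => -[c [[p q] r]] /okl/= /and3P[_ _ /eqP <-].
rewrite [RHS]mulrCA; congr (_ * _); rewrite /pair_mon/=.
have -> : pair_V (x * t) (y * t) (z * t) = pair_V x y z.
  rewrite /pair_V (_ : (z * t) ^+ 2 - _ = (z ^+ 2 - (x - y) ^+ 2) * t ^+ 2); last by ring.
  rewrite invfM; have [->|d0] := eqVneq (z ^+ 2 - (x - y) ^+ 2) 0; first by rewrite invr0 !(mul0r, mulr0).
  by field; rewrite t0 d0.
by rewrite !exprMn !invfM exprD invfM; ring.
Qed.

Definition plane_eval (l : pair_comb) (x y : R) : R :=
  \sum_(m <- l) ratr m.1 * 4 ^- m.2.2 * (x ^- m.2.1.1 * y ^- m.2.1.2).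

Lemma pair_eval_plane (l : pair_comb) (x y : R) : x != 0 -> y != 0 ->
  pair_eval l x y (- (x + y)) = plane_eval l x y.
Proof.
move=> x0 y0; apply: eq_bigr => m _.
rewrite /pair_mon (_ : pair_V x y (- (x + y)) = 4^-1).
  by rewrite exprVn; ring.
rewrite /pair_V (_ : (- (x + y)) ^+ 2 - (x - y) ^+ 2 = 4 * (x * y)); last by ring.
by field; rewrite x0 y0.
Qed.

Definition zeta_odd (s : nat) : R := if odd s then 2 * zeta R s else 0.

Definition pair_zeta (l : pair_comb) : R :=
  \sum_(m <- l) ratr m.1 * 4 ^- m.2.2 * (zeta_odd m.2.1.1 * zeta_odd m.2.1.2).

(** The sum over all pairs factors. The antidiagonal n_2 = - n_1 is then removed; its terms are
    -(-1)^q |n|^-(p+q), as p + q is even. *)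
Lemma has_sum_pair_mon (p q : nat) : (2 <= p)%N -> (2 <= q)%N -> ~~ odd (p + q) ->
  has_sum (fun n : int * int => if n.1 + n.2 != 0 then
      Num.sg (n.1%:~R : R) * Num.sg n.2%:~R * (n.1%:~R ^- p * n.2%:~R ^- q) else 0)
    (zeta_odd p * zeta_odd q + (-1) ^+ q * (2 * zeta R (p + q))).
Proof.
move=> p2 q2 opq.
have full := has_sum_prod (has_sum_zeta_sg R p2) (has_sum_zeta_sg R q2).
have diag : has_sum (fun n : int * int => if n.1 + n.2 == 0 then
      Num.sg (n.1%:~R : R) * Num.sg n.2%:~R * (n.1%:~R ^- p * n.2%:~R ^- q) else 0)
      (- (-1) ^+ q * (2 * zeta R (p + q))).
  apply: (@has_sum_inj_supp _ _ _ _ (fun n : int => (n, - n))).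
  - by move=> x y [].
  - move=> [x y] nr /=; case: eqP => // xy; exfalso; apply: nr; exists x => //.
    by congr (_, _); apply/eqP; rewrite eq_sym -addr_eq0 addrC xy.
  - have pq2 : (2 <= p + q)%N by lia.
    have := has_sumZ (- (-1) ^+ q) (has_sum_zeta_norm R pq2).
    apply: eq_has_sum => // n /=; rewrite subrr eqxx mulrNz sgrN.
    have [->|n0] := eqVneq n 0.
      by rewrite sgr0 !mul0r normr0 expr0n (_ : (p + q == 0)%N = false) ?invr0 ?mulr0//; lia.
    rewrite (exprNn n%:~R q) invfM invr_sign.
    have -> : `|n%:~R : R| ^- (p + q) = n%:~R ^- (p + q).
      rewrite -normrX ger0_norm// -(odd_double_half (p + q)) (negbTE opq) add0n.
      by rewrite -muln2 mulnC exprM exprn_ge0// sqr_ge0.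
    have s2 : Num.sg (n%:~R : R) * Num.sg n%:~R = 1.
      by rewrite -expr2 sqr_sg intr_eq0 n0.
    rewrite exprD invfM mulrN s2; ring.
have := has_sumB full diag; apply: eq_has_sum.
  move=> [x y] /=; case: eqP => _ /=; last by rewrite subr0; ring.
  by apply/eqP; rewrite subr_eq0; apply/eqP; ring.
by rewrite /zeta_odd; ring.
Qed.

(** The signs (-1)^q left by the antidiagonals assemble to the plane form evaluated at (1, -1). *)
Lemma has_sum_plane_eval (n : nat) (l : pair_comb) : pair_ok n l -> ~~ odd n ->
  has_sum (fun n : int * int => if n.1 + n.2 != 0 then
      Num.sg (n.1%:~R : R) * Num.sg n.2%:~R * plane_eval l n.1%:~R n.2%:~R else 0)
    (pair_zeta l + 2 * zeta R n * plane_eval l 1 (-1)).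
Proof.
move=> okl on; elim: l okl => [_|m l ih /= /andP[/and3P[p2 q2 /eqP pq] okl]].
  apply: eq_has_sum (has_sum0 R _) => [x|]; rewrite /pair_zeta /plane_eval !big_nil.
    by rewrite !mulr0; case: ifP.
  by rewrite mulr0 addr0.
have opq : ~~ odd (m.2.1.1 + m.2.1.2) by rewrite pq.
have := has_sumD (has_sumZ (ratr m.1 * 4 ^- m.2.2) (has_sum_pair_mon p2 q2 opq)) (ih okl).
apply: eq_has_sum => [x|].
  by rewrite [plane_eval (m :: l)]/plane_eval big_cons; case: ifP => _; rewrite /plane_eval; ring.
rewrite [plane_eval (m :: l) _ _]/plane_eval [pair_zeta (m :: l)]/pair_zeta !big_cons.
rewrite -/(plane_eval l _ _) -/(pair_zeta l) pq expr1n invr1 mul1r.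
by rewrite [(-1) ^- _]invr_sign; ring.
Qed.

End PlaneSums.

(** * Asymptotics of the terms with exactly one vanishing n_r *)

Section TailSums.
Variable R : realType.

Lemma has_sum_seq_in (T : choiceType) (I : eqType) (r : seq I)
    (f : I -> T -> R) (s : I -> R) :
  (forall i, i \in r -> has_sum (f i) (s i)) ->
  has_sum (fun x => \sum_(i <- r) f i x) (\sum_(i <- r) s i).
Proof.
move=> fs; elim: r fs => [_|i r ih fs].
  by apply: (eq_has_sum _ _ (has_sum0 R T)) => [x|]; rewrite big_nil.
have fi := fs i (mem_head _ _).
have {}ih := ih (fun j jr => fs j (mem_behead (s := i :: r) jr)).
by apply: (eq_has_sum _ _ (has_sumD fi ih)) => [x|]; rewrite big_cons.
Qed.

Lemma asym_sum_in (I : eqType) (r : seq I) (f : I -> R -> R) (c : I -> R) :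
  (forall i, i \in r -> asym (f i) (c i)) ->
  asym (fun t => \sum_(i <- r) f i t) (\sum_(i <- r) c i).
Proof.
move=> fc; elim: r fc => [_|i r ih fc].
  by rewrite big_nil; apply: asym_near (asym0 R) => // t _; rewrite big_nil.
have fi := fc i (mem_head _ _).
have {}ih := ih (fun j jr => fc j (mem_behead (s := i :: r) jr)).
rewrite big_cons; apply: asym_near (asymD fi ih) => // t _.
by rewrite big_cons.
Qed.

Lemma esum_approx (T : choiceType) (f g h : T -> R) (sg sh : R) :
  (forall x, 0 <= f x) -> (forall x, 0 <= g x) -> (forall x, 0 <= h x) ->
  (forall x, `|f x - g x| <= h x) ->
  (\esum_(x in [set: T]) (g x)%:E = sg%:E)%E ->
  (\esum_(x in [set: T]) (h x)%:E = sh%:E)%E ->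
  exists s, (\esum_(x in [set: T]) (f x)%:E = s%:E)%E /\ `|s - sg| <= sh.
Proof.
move=> f0 g0 h0 fg gs hs.
have D (u v : T -> R) su sv : (forall x, 0 <= u x) -> (forall x, 0 <= v x) ->
    (\esum_(x in [set: T]) (u x)%:E = su%:E)%E ->
    (\esum_(x in [set: T]) (v x)%:E = sv%:E)%E ->
    (\esum_(x in [set: T]) (u x + v x)%:E = (su + sv)%:E)%E.
  move=> u0 v0 us vs; under eq_esum do rewrite EFinD.
  by rewrite esumD; [rewrite us vs|move=> *; rewrite lee_fin..].
have le1 : (\esum_(x in [set: T]) (f x)%:E <= (sg + sh)%:E)%E.
  rewrite -(D g h)//; apply: le_esum => x _; rewrite lee_fin.
  by have := fg x; rewrite ler_norml => /andP[]; lra.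
have [s sE] := esum_ge0_fin f0 le1; exists s; split => //.
have le2 : (sg%:E <= (s + sh)%:E)%E.
  rewrite -(D f h)// -gs; apply: le_esum => x _; rewrite lee_fin.
  by have := fg x; rewrite ler_norml => /andP[]; lra.
move: le1 le2; rewrite sE !lee_fin => le1 le2.
by rewrite ler_norml; apply/andP; split; lra.
Qed.

Lemma esum_pair (T T' : choiceType) (f : T -> T' -> \bar R) :
  (forall x y, 0 <= f x y)%E ->
  (\esum_(p in [set: T * T']) f p.1 p.2 =
   \esum_(x in [set: T]) \esum_(y in [set: T']) f x y)%E.
Proof.
move=> f0; rewrite (_ : [set: T * T'] = [set: T] `*`` (fun=> [set: T'])).
  by rewrite -(@esum_esum _ _ _ setT (fun=> setT) f).
by apply/seteqP; split.
Qed.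

(** By [tail_sum] with M = 2 |n| t the inner sum is 2 |n| t [kap r.+1] + O(1). Against (|n|
    t)^-(E+1) the main part sums to zeta(E) and the error to zeta(E+1), one power of t smaller. *)
Lemma has_sum_W (E r : nat) : (2 <= E)%N ->
  exists v : R -> R,
    (forall t, 1 <= t -> has_sum (fun p : int * int =>
       if (p.1 != 0) && (p.2 != 0) then
         (`|p.1%:~R| * t) ^- E.+1 *
         line_W (`|p.1%:~R| * t) (`|p.1%:~R| * t) p.2%:~R ^+ r.+1 else 0) (v t)) /\
    asym (fun t => t ^+ E * v t) (2 * kap R r.+1 * (2 * zeta R E)).
Proof.
move=> E2; have [C C0 tC] := tail_sum R r.
pose F (t : R) (n k : int) : R := if (n != 0) && (k != 0) then
  (`|n%:~R| * t) ^- E.+1 * line_W (`|n%:~R| * t) (`|n%:~R| * t) k%:~R ^+ r.+1 else 0.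
pose v (t : R) := fine (\esum_(p in [set: int * int]) (F t p.1 p.2)%:E)%E.
have kp0 : 0 <= kap R r.+1.
  have : (0%E <= (kap R r.+1 * 1 ^- (2 * r).+1)%:E)%E.
    by rewrite -integral_kap//; apply: integral_ge0 => x _; rewrite lee_fin inv_sqrD_ge0.
  by rewrite expr1n invr1 mulr1 lee_fin.
have n1 (n : int) : n != 0 -> 1 <= `|n%:~R : R|.
  by move=> n0; rewrite -intr_norm ler1z -gtz0_ge1 normr_gt0.
have F0 t n k : 0 < t -> 0 <= F t n k.
  move=> t0; rewrite /F; case: ifP => // _.
  apply: mulr_ge0; first by rewrite invr_ge0 exprn_ge0// mulr_ge0// ltW.
  by apply: exprn_ge0; rewrite /line_W divr_ge0 ?addr_ge0 ?sqr_ge0.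
have key t : 1 <= t -> exists s,
    (\esum_(p in [set: int * int]) (F t p.1 p.2)%:E = s%:E)%E /\
    `|s - t ^- E * (2 * kap R r.+1 * (2 * zeta R E))| <=
      t ^- E.+1 * (C * (2 * zeta R E.+1)).
  move=> t1; have t0 : 0 < t by exact: lt_le_trans t1.
  have inner n : exists s, (\esum_(k in [set: int]) (F t n k)%:E = s%:E)%E /\
      `|s - t ^- E * (2 * kap R r.+1) * `|n%:~R| ^- E| <=
        t ^- E.+1 * C * `|n%:~R| ^- E.+1.
    have [->|n0] := eqVneq n 0.
      exists 0; split; first by rewrite esum1// => k _; rewrite /F eqxx.
      rewrite normr0 !expr0n (_ : (E == 0)%N = false); last by lia.
      by rewrite invr0 !mulr0 subrr normr0.
    set y := `|n%:~R| * t; have y0 : 0 < y by rewrite mulr_gt0// normr_gt0 intr_eq0.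
    have M1 : 1 <= 2 * y.
      have : 1 <= y by rewrite mulr_ege1// n1.
      lra.
    have [s [hs sC]] := tC _ M1.
    have ye0 : 0 <= y ^- E.+1 by rewrite invr_ge0 exprn_ge0// ltW.
    exists (y ^- E.+1 * s); split.
      have := has_sumZ (y ^- E.+1) hs => /has_sum_esum <-.
        apply: eq_esum => k _; rewrite /F n0 /= /line_W -/y.
        case: ifP => _; last by rewrite mulr0.
        by rewrite (_ : y + y = 2 * y)//; ring.
      move=> k; rewrite mulr_ge0//; case: ifP => // _.
      by rewrite exprn_ge0// divr_ge0 ?addr_ge0 ?sqr_ge0.
    have yE : y ^- E.+1 * (2 * y * kap R r.+1) =
        t ^- E * (2 * kap R r.+1) * `|n%:~R| ^- E.
      rewrite exprS invfM (_ : y ^- E = t ^- E * `|n%:~R| ^- E).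
        move: (t ^- E) (`|n%:~R| ^- E) (kap R r.+1) => A B K.
        rewrite (_ : y^-1 * (A * B) * (2 * y * K) = y^-1 * y * (A * (2 * K) * B)).
          by rewrite mulVf ?mul1r// gt_eqF.
        by ring.
      by rewrite /y exprMn invfM mulrC.
    rewrite -yE -mulrBr normrM (ger0_norm ye0).
    apply: (le_trans (ler_wpM2l ye0 sC)).
    rewrite (_ : t ^- E.+1 * C * `|n%:~R| ^- E.+1 = y ^- E.+1 * C)//.
    by rewrite /y exprMn invfM; ring.
  pose s n := projT1 (cid (inner n)).
  have sE n : (\esum_(k in [set: int]) (F t n k)%:E = (s n)%:E)%E.
    by rewrite /s; case: cid => x [].
  have sC n : `|s n - t ^- E * (2 * kap R r.+1) * `|n%:~R| ^- E| <=
        t ^- E.+1 * C * `|n%:~R| ^- E.+1.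
    by rewrite /s; case: cid => x [].
  rewrite (@esum_pair _ _ (fun n k => (F t n k)%:E)); last first.
    by move=> n k; rewrite lee_fin F0.
  under eq_esum do rewrite sE.
  rewrite (mulrA (t ^- E)) (mulrA (t ^- E.+1)).
  have te0 m : 0 <= t ^- m by rewrite invr_ge0 exprn_ge0// ltW.
  apply: (esum_approx _ _ _ sC).
  - move=> n; rewrite -lee_fin -sE; apply: esum_ge0 => k _.
    by rewrite lee_fin F0.
  - by move=> n; rewrite !mulr_ge0// invr_ge0 exprn_ge0.
  - by move=> n; rewrite !mulr_ge0// invr_ge0 exprn_ge0.
  - apply: has_sum_esum; last exact/has_sumZ/has_sum_zeta_norm.
    by move=> n; rewrite !mulr_ge0// invr_ge0 exprn_ge0.
  - apply: has_sum_esum; last by apply/has_sumZ/has_sum_zeta_norm; lia.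
    by move=> n; rewrite !mulr_ge0// invr_ge0 exprn_ge0.
exists v; split.
  move=> t t1; have [s [sE _]] := key t t1; rewrite /v sE.
  by apply: has_sum_nneg => // p; apply: F0; exact: lt_le_trans t1.
apply: (@asym_le _ _ _ (C * (2 * zeta R E.+1)) 1) => // t t1.
have t0 : 0 < t by exact: lt_le_trans t1.
have [s [sE sC]] := key t t1; rewrite /v sE /=.
have tE : 0 < t ^+ E by rewrite exprn_gt0.
rewrite -(ler_pM2l (x := t ^- E)) ?invr_gt0// -[X in X * `|_|](gtr0_norm (x := t ^- E)) ?invr_gt0//.
rewrite -normrM mulrBr mulKf ?gt_eqF//; apply: (le_trans sC).
by rewrite exprS invfM le_eqVlt; apply/orP; left; apply/eqP; ring.
Qed.

Definition tail_term (a b c : nat) (t : R) (p : int * int) : R :=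
  if (p.1 != 0) && (p.2 != 0) then
    tail_value (tail_comb a b) c p.2%:~R (`|p.1%:~R| * t) (`|p.1%:~R| * t)
  else 0.

Lemma line_mon_diag (m : nat * nat * nat * nat) (y k : R) : y != 0 ->
  line_mon m y y k = 2 ^- m.1.2.+1 * y ^- (m.1.1.1 + m.1.1.2 + m.1.2).+1 *
    line_W y y k ^+ m.2.
Proof.
move=> y0; rewrite /line_mon (_ : (y + y) = 2 * y); last by ring.
by rewrite (exprMn _ 2 y) -addnS !exprD !invfM; ring.
Qed.

(** A factor W is created only with a coefficient proportional to r, which is 0 at the start; such
    entries remain in the list with coefficient 0. *)
Lemma tail_comb_zero (a b l : nat) :
  all (fun m => (m.1 == 0) || (m.2.2 == 0%N)) (tail_comb a b l 0).
Proof.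
have hx n L : all (fun m : rat * (nat * nat * nat * nat) => (m.1 == 0) || (m.2.2 == 0%N)) L ->
    all (fun m => (m.1 == 0) || (m.2.2 == 0%N)) (line_dx n L).
  move=> /allP okl; apply/allP => m /flattenP[s /mapP[[c [[[p q] i] r]] /okl /= h3 ->]].
  case/orP: h3 => /eqP ->; rewrite !inE => /or3P[] /eqP -> /=;
    by rewrite ?(mulr0, mul0r) eqxx ?orbT.
have hs L : all (fun m : rat * (nat * nat * nat * nat) => (m.1 == 0) || (m.2.2 == 0%N)) (line_swap L) =
    all (fun m => (m.1 == 0) || (m.2.2 == 0%N)) L.
  by rewrite /line_swap all_map; apply: eq_all => -[c [[[p q] i] r]].
rewrite /tail_comb; elim: a => /= [|a iha]; last exact: hx.
by elim: b => /= [//|b ihb]; rewrite hs; apply: hx; rewrite hs.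
Qed.

Lemma tail_comb_pos (a b l : nat) : all (fun m => 0 < m.2.2)%N (tail_comb a b l 1).
Proof.
have hx n L : all (fun m : rat * (nat * nat * nat * nat) => 0 < m.2.2)%N L ->
    all (fun m => 0 < m.2.2)%N (line_dx n L).
  move=> /allP okl; apply/allP => m /flattenP[s /mapP[[c [[[p q] i] r]] /okl /= h3 ->]].
  by rewrite !inE => /or3P[] /eqP -> /=.
have hs L : all (fun m : rat * (nat * nat * nat * nat) => 0 < m.2.2)%N (line_swap L) =
    all (fun m => 0 < m.2.2)%N L.
  by rewrite /line_swap all_map; apply: eq_all => -[c [[[p q] i] r]].
rewrite /tail_comb; elim: a => /= [|a iha]; last exact: hx.
by elim: b => /= [//|b ihb]; rewrite hs; apply: hx; rewrite hs.
Qed.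

(** Only the last partial fraction matters. The others contain no W and factor into zeta values
    times t^-e_i, where E - e_i = 2 (c - i) - 1 is positive, so t^E turns them into positive powers
    of t. *)
Lemma asym_tail (a b c : nat) : (0 < c)%N ->
  exists s : R -> R,
    (forall t, 1 <= t -> has_sum (tail_term a b c t) (s t)) /\
    asym (fun t => t ^+ (2 * (a + b + c).+1) * s t)
      (pi * ((-1) ^+ c * (2 * zeta R (2 * (a + b + c).+1) *
        line_int (tail_comb a b (2 * c) 1) 1 1))).
Proof.
move=> c0; set E := (2 * (a + b + c).+1)%N.
have E2 : (2 <= E)%N by lia.
pose v r := projT1 (cid (has_sum_W r E2)).
have vs r t : 1 <= t -> has_sum (fun p : int * int =>
       if (p.1 != 0) && (p.2 != 0) then
         (`|p.1%:~R| * t) ^- E.+1 *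
         line_W (`|p.1%:~R| * t) (`|p.1%:~R| * t) p.2%:~R ^+ r.+1 else 0) (v r t).
  by rewrite /v; case: cid => x [hx _] /= t1; exact: hx.
have va r : asym (fun t => t ^+ E * v r t) (2 * kap R r.+1 * (2 * zeta R E)).
  by rewrite /v; case: cid => x [].
pose e (i : nat) := (2 * (a + b + i)).+3.
pose L i := tail_comb a b (2 * i) 0.
pose La := tail_comb a b (2 * c) 1.
pose s1 (i : nat) (t : R) : R := (-1) ^+ i * (\sum_(m <- L i) ratr m.1 * 2 ^- m.2.1.2.+1) *
   (t ^- e i * (2 * zeta R (e i) * (2 * zeta R (2 * (c - i))))).
pose s2 (t : R) : R := \sum_(m <- La) ratr m.1 * 2 ^- m.2.1.2.+1 * v m.2.2.-1 t.
exists (fun t => pi * (\sum_(i < c) s1 i t + (-1) ^+ c * s2 t)); split.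
  move=> t t1; have t0 : 0 < t by exact: lt_le_trans t1.
  have h1 (i : 'I_c) : has_sum (fun p : int * int => if (p.1 != 0) && (p.2 != 0) then
      (-1) ^+ i * p.2%:~R ^- (2 * (c - i)) *
      line_eval (L i) (`|p.1%:~R| * t) (`|p.1%:~R| * t) p.2%:~R else 0) (s1 i t).
    have ic := ltn_ord i.
    have e2 : (2 <= e i)%N by rewrite /e.
    have k2 : (2 <= 2 * (c - i))%N by lia.
    have := has_sumZ ((-1) ^+ i * (\sum_(m <- L i) ratr m.1 * 2 ^- m.2.1.2.+1) * t ^- e i)
      (has_sum_prod (has_sum_zeta_norm R e2) (has_sum_zeta_norm R k2)).
    apply: eq_has_sum => [[n k]|]; last by rewrite /s1; ring.
    rewrite /=; have [->|n0] := eqVneq n 0.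
      by rewrite normr0 expr0n/= invr0 mul0r mulr0.
    have [->|k0] := eqVneq k 0.
      by rewrite normr0 expr0n (_ : (2 * (c - i) == 0)%N = false) ?invr0 ?mulr0//; lia.
    have kE : `|k%:~R : R| ^- (2 * (c - i)) = k%:~R ^- (2 * (c - i)).
      by rewrite exprM real_normK ?num_real// -exprM.
    have y0 : `|n%:~R| * t != 0 :> R by rewrite mulf_neq0 ?normr_eq0 ?intr_eq0// gt_eqF.
    rewrite /= kE.
    have -> : line_eval (L i) (`|n%:~R| * t) (`|n%:~R| * t) k%:~R =
       (\sum_(m <- L i) ratr m.1 * 2 ^- m.2.1.2.+1) * (`|n%:~R| ^- e i * t ^- e i).
      rewrite /line_eval mulr_suml; apply: eq_big_seq => m mL.
      have /allP/(_ m mL)/orP[/eqP ->|/eqP m0] := tail_comb_zero a b (2 * i).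
        by rewrite rmorph0 !mul0r.
      have /allP/(_ m mL)/eqP mE := line_ok_tail_comb a b (2 * i) 0.
      rewrite line_mon_diag// m0 expr0 mulr1 mE.
      have -> : (2 + 2 * i + b.*2 + a.*2).+1 = e i by rewrite /e; lia.
      by rewrite exprMn invfM; ring.
    by ring.
  have h2 : has_sum (fun p : int * int => if (p.1 != 0) && (p.2 != 0) then
      line_eval La (`|p.1%:~R| * t) (`|p.1%:~R| * t) p.2%:~R else 0) (s2 t).
    have := @has_sum_seq_in _ _ La (fun m p => ratr m.1 * 2 ^- m.2.1.2.+1 *
      (if (p.1 != 0) && (p.2 != 0) then
         (`|p.1%:~R| * t) ^- E.+1 *
         line_W (`|p.1%:~R| * t) (`|p.1%:~R| * t) p.2%:~R ^+ m.2.2.-1.+1 else 0))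
      (fun m => ratr m.1 * 2 ^- m.2.1.2.+1 * v m.2.2.-1 t)
      (fun m _ => has_sumZ _ (vs _ _ t1)).
    apply: eq_has_sum => // -[n k] /=.
    have [->|n0] := eqVneq n 0; first by rewrite big1// => m _; rewrite mulr0.
    have [->|k0] /= := eqVneq k 0; first by rewrite big1// => m _; rewrite mulr0.
    have y0 : `|n%:~R| * t != 0 :> R by rewrite mulf_neq0 ?normr_eq0 ?intr_eq0// gt_eqF.
    apply: eq_big_seq => m mL.
    have /allP/(_ m mL) m0 := tail_comb_pos a b (2 * c).
    have /allP/(_ m mL)/eqP mE := line_ok_tail_comb a b (2 * c) 1.
    rewrite line_mon_diag// mE prednK//.
    have -> : (2 + 2 * c + b.*2 + a.*2)%N = E by rewrite /E; lia.
    by ring.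
  have := has_sumZ pi (has_sumD (has_sum_seq (index_enum 'I_c) h1) (has_sumZ ((-1) ^+ c) h2)).
  apply: eq_has_sum => // -[n k]; rewrite /tail_term /=.
  case: ifP => _; last by rewrite mulr0 addr0 big1 ?mulr0.
  by [].
pose g1 (i : nat) (t : R) := t ^+ E * s1 i t.
have a1 (i : 'I_c) : asym (g1 i) 0.
  have ic := ltn_ord i.
  have := asymZ ((-1) ^+ i * (\sum_(m <- L i) ratr m.1 * 2 ^- m.2.1.2.+1) *
    (2 * zeta R (e i) * (2 * zeta R (2 * (c - i)))))
    (asym_expn R (n := E - e i) ltac:(rewrite /E /e; lia)).
  rewrite mulr0; apply: (asym_near ltr01) => t t1.
  have t0 : t != 0 by rewrite gt_eqF// (lt_le_trans _ t1).
  rewrite /g1 /s1 {2}(_ : E = E - e i + e i)%N; last by rewrite /E /e; lia.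
  rewrite exprD; have := expf_neq0 (e i) t0; move: (t ^+ e i) => T T0.
  by field.
have a2 : asym (fun t => t ^+ E * s2 t)
    (\sum_(m <- La) ratr m.1 * 2 ^- m.2.1.2.+1 * (2 * kap R m.2.2 * (2 * zeta R E))).
  have := @asym_sum_in _ La (fun m t => ratr m.1 * 2 ^- m.2.1.2.+1 * (t ^+ E * v m.2.2.-1 t))
     (fun m => ratr m.1 * 2 ^- m.2.1.2.+1 * (2 * kap R m.2.2 * (2 * zeta R E))).
  move=> h; apply: (asym_near ltr01 _ (h _)) => [t _|m mL].
    by rewrite /s2 mulr_sumr; apply: eq_bigr => m _; ring.
  have /allP/(_ m mL) m0 := tail_comb_pos a b (2 * c).
  by have := asymZ (ratr m.1 * 2 ^- m.2.1.2.+1) (va m.2.2.-1); rewrite prednK.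
have := asymZ pi (asymD (asym_sum (index_enum 'I_c) a1) (asymZ ((-1) ^+ c) a2)).
rewrite big1// add0r.
have -> : \sum_(m <- La) ratr m.1 * 2 ^- m.2.1.2.+1 * (2 * kap R m.2.2 * (2 * zeta R E)) =
   2 * zeta R E * line_int La 1 1.
  rewrite /line_int mulr_sumr; apply: eq_bigr => m _.
  rewrite !expr1n !invr1 (_ : 1 + 1 = 2)// exprS invfM.
  by move: (2 ^- _) => A; field.
apply: (asym_near ltr01) => t _; rewrite /g1 -mulr_sumr; ring.
Qed.

End TailSums.

(** * The terms with all n_r nonzero *)

Section GenericModes.
Variable R : realType.
Notation mu := (@lebesgue_measure R).

(** The sum of the two last arguments is -(m_3 + n_3 tau), and only its square enters. *)
Definition mode_fun (a b c : nat) (t : R) (n m : int * int) (tau : R) : R :=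
  box_fun a b c (n.1%:~R * t) (n.2%:~R * t) ((- (n.1 + n.2))%:~R * t)
    (m.1%:~R + n.1%:~R * tau) (m.2%:~R + n.2%:~R * tau).

Definition mode_integral (a b c : nat) (t : R) (n : int * int) : \bar R :=
  (\int[mu]_(tau in `[0%R, 1%R]%classic)
     \esum_(m in [set: int * int]) (mode_fun a b c t n m tau)%:E)%E.

Definition generic (n : int * int) : bool :=
  [&& n.1 != 0, n.2 != 0 & n.1 + n.2 != 0].

Definition plane_value (a b c : nat) (n : int * int) : R :=
  let n1 : R := n.1%:~R in let n2 : R := n.2%:~R in
  let n3 : R := (- (n.1 + n.2))%:~R in
  pi ^+ 2 * (Num.sg n1 * Num.sg n2 * plane_eval (comb3 a b c) n1 n2 +
             Num.sg n1 * Num.sg n3 * plane_eval (comb3 a c b) n1 n3 +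
             Num.sg n2 * Num.sg n3 * plane_eval (comb3 b c a) n2 n3).

Definition generic_sum (a b c : nat) : R :=
  let E := (2 * (a + b + c).+2)%N in
  let term l := pair_zeta R l + 2 * zeta R E * plane_eval l 1 (-1) in
  pi ^+ 2 * (term (comb3 a b c) + term (comb3 a c b) + term (comb3 b c a)).

(** In each of the three sums the signs vanish when one of the two paired indices is 0, and the
    condition that their sum is nonzero excludes the third, so all three have their support in the
    same set [generic]. *)
Lemma has_sum_plane_value a b c :
  has_sum (fun n => if generic n then plane_value a b c n else 0)
    (generic_sum a b c).
Proof.
have ok3 := pair_ok_comb3 a b c.
have ok2 := pair_ok_comb3 a c b; have ok1 := pair_ok_comb3 b c a.
rewrite (_ : a + c + b = a + b + c)%N in ok2; last by lia.
rewrite (_ : b + c + a = a + b + c)%N in ok1; last by lia.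
have oE : ~~ odd (2 * (a + b + c).+2) by lia.
have h3 := has_sum_plane_eval R ok3 oE.
have b2 : bijective (fun n : int * int => (n.1, - (n.1 + n.2))).
  by exists (fun n => (n.1, - (n.1 + n.2))) => -[x y] /=; congr (_, _); lia.
have b1 : bijective (fun n : int * int => (n.2, - (n.1 + n.2))).
  by exists (fun n => (- (n.1 + n.2), n.1)) => -[x y] /=; congr (_, _); lia.
have h2 := has_sum_bij b2 (has_sum_plane_eval R ok2 oE).
have h1 := has_sum_bij b1 (has_sum_plane_eval R ok1 oE).
have := has_sumZ (pi ^+ 2) (has_sumD (has_sumD h3 h2) h1).
apply: eq_has_sum => // -[x y]; rewrite /generic /plane_value /=.
have -> : x - (x + y) = - y by lia.
have -> : y - (x + y) = - x by lia.
rewrite !oppr_eq0; have [->|x0] /= := eqVneq x 0.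
  by rewrite !add0r !sgr0 !mul0r addr0; case: eqP => _ //=; rewrite ?addr0 ?mulr0// ?mul0r ?mulr0.
have [->|y0] /= := eqVneq y 0.
  by rewrite !sgr0 !(mulr0, mul0r) addr0; case: eqP => _ //=; rewrite ?addr0 ?mulr0// ?mul0r ?mulr0.
have [xy|//] /= := eqVneq (x + y) 0.
by rewrite xy oppr0 sgr0 !mulr0 !mul0r !addr0 mulr0.
Qed.

Lemma box_integral_plane a b c (t : R) (n : int * int) : 0 < t -> generic n ->
  box_integral a.+1 b.+1 c.+1 (n.1%:~R * t) (n.2%:~R * t)
    ((- (n.1 + n.2))%:~R * t) =
  (t ^- (2 * (a + b + c).+2) * plane_value a b c n)%:E.
Proof.
case: n => x y t0 /and3P[/= x0 y0 xy0]; have tn : t != 0 by rewrite gt_eqF.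
have z0 : (- (x + y))%:~R != 0 :> R by rewrite intr_eq0 oppr_eq0.
have xn : x%:~R != 0 :> R by rewrite intr_eq0.
have yn : y%:~R != 0 :> R by rewrite intr_eq0.
have sum0 : x%:~R + y%:~R + (- (x + y))%:~R = 0 :> R.
  by rewrite -!intrD subrr.
rewrite box_integralE; last first.
  rewrite /near_plane -!mulrDl sum0 mul0r normr0.
  by split; rewrite mulr_gt0// normr_gt0 mulf_neq0.
congr EFin; rewrite /box_value /plane_value /= comb1E comb2E.
have st (u : R) : Num.sg (u * t) = Num.sg u by rewrite sgrM (gtr0_sg t0) mulr1.
rewrite !st.
have ok3 := pair_ok_comb3 a b c.
have ok2 := pair_ok_comb3 a c b; have ok1 := pair_ok_comb3 b c a.
rewrite (_ : a + c + b = a + b + c)%N in ok2; last by lia.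
rewrite (_ : b + c + a = a + b + c)%N in ok1; last by lia.
rewrite (pair_eval_scale _ _ _ ok3)// (pair_eval_scale _ _ _ ok2)//.
rewrite (pair_eval_scale _ _ _ ok1)//.
have e3 : (- (x + y))%:~R = - (x%:~R + y%:~R) :> R by rewrite mulrNz intrD.
have e2 : y%:~R = - (x%:~R + (- (x + y))%:~R) :> R.
  by apply/eqP; rewrite -addr_eq0 addrA (addrC y%:~R) sum0.
have e1 : x%:~R = - (y%:~R + (- (x + y))%:~R) :> R.
  by apply/eqP; rewrite -addr_eq0 addrA sum0.
rewrite -(pair_eval_plane _ xn yn) -e3.
rewrite -(pair_eval_plane _ xn z0) -e2.
rewrite -(pair_eval_plane _ yn z0) -e1.
ring.
Qed.

Lemma mode_fun_ge0 a b c t n m tau : 0 <= mode_fun a b c t n m tau.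
Proof. exact: box_fun_ge0. Qed.

Lemma measurable_mode_fun a b c t n m (D : set R) :
  measurable_fun D (mode_fun a b c t n m).
Proof.
apply: measurable_funTS.
have mx (k j : int) : measurable_fun [set: R] (fun tau : R => k%:~R + j%:~R * tau : R).
  by apply: measurable_funD => //; exact: measurable_funM.
have mi (N : R) (e : nat) (f : R -> R) : measurable_fun [set: R] f ->
    measurable_fun [set: R] (fun tau => (f tau ^+ 2 + N ^+ 2) ^- e).
  move=> mf; apply: measurable_inv_ge0 => //.
    by move=> x; rewrite exprn_ge0// addr_ge0// sqr_ge0.
  by apply: measurable_funX; apply: measurable_funD => //; exact: measurable_funX.
apply: measurable_funM; first apply: measurable_funM; apply: mi => //.
exact: measurable_funD.
Qed.

Lemma measurable_mode_sum a b c t n (D : set R) :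
  measurable_fun D (fun tau => \esum_(m in [set: int * int]) (mode_fun a b c t n m tau)%:E)%E.
Proof.
apply: (@measurable_esum _ _ _ _ (int * int)%type
  (fun m tau => (mode_fun a b c t n m tau)%:E)).
  by move=> m; apply/measurable_EFinP; exact: measurable_mode_fun.
by move=> m x; rewrite lee_fin mode_fun_ge0.
Qed.

Lemma mode_sum_ge0 a b c t n tau :
  (0 <= \esum_(m in [set: int * int]) (mode_fun a b c t n m tau)%:E)%E.
Proof. by apply: esum_ge0 => m _; rewrite lee_fin mode_fun_ge0. Qed.

Lemma mode_integral_ge0 a b c t n : (0 <= mode_integral a b c t n)%E.
Proof. by apply: integral_ge0 => tau _; exact: mode_sum_ge0. Qed.

Lemma mode_integral_generic a b c (t : R) (n : int * int) : 0 < t -> generic n ->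
  let K := (1 + 3 / t) ^+ (2 * (a + b + c).+3) in
  let B := t ^- (2 * (a + b + c).+2) * plane_value a b c n in
  exists s, [/\ mode_integral a.+1 b.+1 c.+1 t n = s%:E, s <= K * B, B <= K * s & 0 <= B].
Proof.
move=> t0 gn K B.
have BE := box_integral_plane a b c t0 gn; rewrite -/B in BE.
have B0 : 0 <= B.
  by rewrite -lee_fin -BE; apply: integral_ge0 => p _; rewrite lee_fin box_fun_ge0.
have K0 : 0 < K by rewrite exprn_gt0// ltr_wpDr// divr_ge0// ltW.
have /and3P[n10 n20 n30] := gn.
have n3 : - (n.1 + n.2) != 0 by rewrite oppr_eq0.
have sum0 : n.1 + n.2 + - (n.1 + n.2) = 0 by rewrite subrr.
have KE : (2 * (a.+1 + b.+1 + c.+1) = 2 * (a + b + c).+3)%N by lia.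
have pt tau : 0 <= tau <= 1 ->
    (\esum_(m in [set: int * int]) (mode_fun a.+1 b.+1 c.+1 t n m tau)%:E <= (K * B)%:E)%E /\
    ((K^-1 * B)%:E <= \esum_(m in [set: int * int]) (mode_fun a.+1 b.+1 c.+1 t n m tau)%:E)%E.
  move=> tau01; have [s [sE sK Ks]] := lattice_sum_box n10 n20 n3 sum0 tau01 t0 BE.
  rewrite KE in sK Ks.
  have -> : (\esum_(m in [set: int * int]) (mode_fun a.+1 b.+1 c.+1 t n m tau)%:E = s%:E)%E by [].
  by rewrite !lee_fin; split => //; rewrite ler_pdivrMl.
have m01 : mu `[0%R, 1%R]%classic = 1%E.
  by rewrite lebesgue_measure_itv/= lte_fin ltr01 -EFinB subr0.
have le1 : (mode_integral a.+1 b.+1 c.+1 t n <= (K * B)%:E)%E.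
  rewrite -[leRHS]mule1 -m01 -integral_cst//.
  apply: ge0_le_integral => //.
  - by move=> x _; exact: mode_sum_ge0.
  - exact: measurable_mode_sum.
  - by move=> x; rewrite /= in_itv/= => /pt[].
have le2 : ((K^-1 * B)%:E <= mode_integral a.+1 b.+1 c.+1 t n)%E.
  rewrite -[leLHS]mule1 -m01 -integral_cst//.
  apply: ge0_le_integral => //.
  - by move=> x _; rewrite lee_fin mulr_ge0// invr_ge0 ltW.
  - exact: measurable_mode_sum.
  - by move=> x; rewrite /= in_itv/= => /pt[].
have [s sE] : exists s, mode_integral a.+1 b.+1 c.+1 t n = s%:E.
  have := mode_integral_ge0 a.+1 b.+1 c.+1 t n; move: le1.
  by case: mode_integral => [s| |]// _ _; exists s.
exists s; split => //; move: le1 le2; rewrite sE !lee_fin// => _.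
by rewrite ler_pdivrMl.
Qed.

Lemma asym_generic a b c :
  exists s : R -> R,
    (forall t, 1 <= t -> (\esum_(n in [set: int * int])
      (if generic n then mode_integral a.+1 b.+1 c.+1 t n else 0) = (s t)%:E)%E) /\
    asym (fun t => t ^+ (2 * (a + b + c).+2) * s t) (generic_sum a b c).
Proof.
set E := (2 * (a + b + c).+2)%N; set S := generic_sum a b c.
have hS := has_sum_plane_value a b c; rewrite -/S in hS.
pose s (t : R) := fine (\esum_(n in [set: int * int])
      (if generic n then mode_integral a.+1 b.+1 c.+1 t n else 0))%E.
have key t : 1 <= t -> exists x, [/\ (\esum_(n in [set: int * int])
      (if generic n then mode_integral a.+1 b.+1 c.+1 t n else 0) = x%:E)%E,
      x <= (1 + 3 / t) ^+ (2 * (a + b + c).+3) * (t ^- E * S),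
      t ^- E * S <= (1 + 3 / t) ^+ (2 * (a + b + c).+3) * x & 0 <= S].
  move=> t1; have t0 : 0 < t by exact: lt_le_trans t1.
  set K := _ ^+ (2 * (a + b + c).+3).
  have K0 : 0 < K by rewrite exprn_gt0// ltr_wpDr// divr_ge0// ltW.
  pose B n := if generic n then t ^- E * plane_value a b c n else 0.
  pose i n := if pselect (generic n) is left gn then
    projT1 (cid (mode_integral_generic a b c t0 gn)) else 0.
  have iP n : [/\ (if generic n then mode_integral a.+1 b.+1 c.+1 t n else 0)%E = (i n)%:E,
     i n <= K * B n, B n <= K * i n & 0 <= B n].
    rewrite /i /B; case: pselect => [gn|/negP/negbTE ->]; last by rewrite mulr0.
    by rewrite gn; case: cid.
  have i0 n : 0 <= i n.
    rewrite -lee_fin; have [<- _ _ _] := iP n; case: ifP => // _; exact: mode_integral_ge0.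
  have BS : (\esum_(n in [set: int * int]) (B n)%:E = (t ^- E * S)%:E)%E.
    apply: has_sum_esum; first by move=> n; have [] := iP n.
    have := has_sumZ (t ^- E) hS; apply: eq_has_sum => // n.
    by rewrite /B; case: ifP => //; rewrite mulr0.
  have B0 n : 0 <= B n by have [] := iP n.
  have S0 : 0 <= S.
    have : (0 <= \esum_(n in [set: int * int]) (B n)%:E)%E.
      by apply: esum_ge0 => n _; rewrite lee_fin.
    by rewrite BS lee_fin pmulr_rge0// invr_gt0 exprn_gt0.
  have le1 : (\esum_(n in [set: int * int]) (i n)%:E <= (K * (t ^- E * S))%:E)%E.
    rewrite -(esumZl (ltW K0) B0 BS); apply: le_esum => n _; rewrite lee_fin.
    by have [] := iP n.
  have [x xE] := esum_ge0_fin i0 le1.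
  exists x; split => //.
  - by rewrite -xE; apply: eq_esum => n _; have [] := iP n.
  - by move: le1; rewrite xE lee_fin.
  - rewrite -lee_fin -BS -(esumZl (ltW K0) i0 xE); apply: le_esum => n _.
    by rewrite lee_fin; have [] := iP n.
exists s; split.
  by move=> t t1; have [x [xE _ _ _]] := key t t1; rewrite /s xE.
pose N := (2 * (a + b + c).+3)%N; pose C : R := 2 ^+ N - 1.
have C0 : 0 <= C by rewrite subr_ge0 exprn_ege1// ler1n.
(* From t = 3 on, 3/t <= 1 and hence K - 1 <= 3 C / t; the factor 2^N bounds the K that enters when
   y is estimated by K S. *)
apply: (@asym_le _ _ _ (3 * C * 2 ^+ N * S) 3) => // t t3.
have t1 : 1 <= t by apply: le_trans t3; rewrite ler1n.
have t0 : 0 < t by exact: lt_le_trans t1.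
have [x [xE xK Kx S0]] := key t t1; rewrite /s xE /=.
have tE : 0 < t ^+ E by rewrite exprn_gt0.
move: xK Kx; rewrite -/N; set K := _ ^+ N => xK Kx.
have v01 : 0 <= 3 / t <= 1.
  by apply/andP; split; [rewrite divr_ge0// ltW|rewrite ler_pdivrMr// mul1r].
have KC : K <= 1 + C * (3 / t) by exact: expn1D_le.
have K2 : K <= 2 ^+ N.
  apply: lerXn2r; rewrite ?nnegrE ?addr_ge0//; first by case/andP: v01.
  by case/andP: v01 => _; lra.
have K0 : 0 <= K by rewrite exprn_ge0// addr_ge0//; case/andP: v01.
pose y := t ^+ E * x.
have yK : y <= K * S.
  have := ler_wpM2l (ltW tE) xK.
  by rewrite (_ : t ^+ E * (K * (t ^- E * S)) = K * S)//; field; rewrite gt_eqF.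
have Ky : S <= K * y.
  have := ler_wpM2l (ltW tE) Kx.
  by rewrite mulVKf ?gt_eqF// mulrCA.
have v0 : 0 <= C * (3 / t) by rewrite mulr_ge0// divr_ge0// ltW.
have y0 : 0 <= y.
  have : 0 <= K * y by exact: le_trans Ky.
  by rewrite pmulr_rge0// exprn_gt0// ltr_wpDr//; case/andP: v01.
have p1 : (1 : R) <= 2 ^+ N by rewrite exprn_ege1// ler1n.
have u1 : y <= S + C * (3 / t) * (2 ^+ N * S).
  apply: (le_trans yK); apply: (le_trans (ler_wpM2r S0 KC)).
  rewrite mulrDl mul1r lerD2l ler_wpM2l//.
  by rewrite ler_peMl.
have u2 : S <= y + C * (3 / t) * (2 ^+ N * S).
  apply: (le_trans Ky); apply: (le_trans (ler_wpM2r y0 KC)).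
  rewrite mulrDl mul1r lerD2l ler_wpM2l//.
  by apply: (le_trans yK); rewrite ler_wpM2r.
rewrite -/y (_ : 3 * C * 2 ^+ N * S / t = C * (3 / t) * (2 ^+ N * S)); last by ring.
by rewrite ler_norml; apply/andP; split; lra.
Qed.

End GenericModes.

(** * The constant mode *)

Section ConstantMode.
Variable R : realType.
Notation mu := (@lebesgue_measure R).
Local Open Scope complex_scope.

Lemma propagatorE (t1 t2 : R) (m n : int) :
  propagator (t1 +i* t2) (m, n) =
  t2 / pi * ((m%:~R + n%:~R * t1) ^+ 2 + (n%:~R * t2) ^+ 2)^-1.
Proof.
rewrite /propagator /=.
have -> : m%:~R + n%:~R * (t1 +i* t2) =
    (m%:~R + n%:~R * t1) +i* (n%:~R * t2) :> R[i].
  rewrite -(rmorph_int (real_complex R) m) -(rmorph_int (real_complex R) n).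
  by apply/eqP; rewrite eq_complex /=; apply/andP; split; apply/eqP; ring.
rewrite /ComplexField.Normc.normc sqr_sqrtr ?addr_ge0 ?sqr_ge0//.
by rewrite invfM; ring.
Qed.

(** Unlike [esumZl] this covers infinite sums, so convergence at an individual tau_1 need not be
    known. *)
Lemma esumZl_ereal (T : choiceType) (f : T -> R) (c : R) : 0 < c ->
  (forall x, 0 <= f x) ->
  (\esum_(x in [set: T]) (c * f x)%:E = c%:E * \esum_(x in [set: T]) (f x)%:E)%E.
Proof.
have le (g : T -> R) (d : R) : 0 <= d -> (forall x, 0 <= g x) ->
   (\esum_(x in [set: T]) (d * g x)%:E <= d%:E * \esum_(x in [set: T]) (g x)%:E)%E.
  move=> d0 g0; apply: ge_ereal_sup => /= _ [X [finX XI] <-].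
  have -> : (\sum_(x \in X) (d * g x)%:E = d%:E * \sum_(x \in X) (g x)%:E)%E.
    rewrite !fsbig_finite//= ge0_sume_distrr//.
    by move=> i _; rewrite lee_fin.
  rewrite lee_wpmul2l ?lee_fin//.
  by apply: ereal_sup_ubound; exists X.
move=> c0 f0; apply/eqP; rewrite eq_le le ?(ltW c0)//=.
have cn : c != 0 by rewrite gt_eqF.
have := le (fun x => c * f x) c^-1.
rewrite invr_ge0 (ltW c0) => /(_ isT) h.
have {}h := h (fun x => mulr_ge0 (ltW c0) (f0 x)).
have := @lee_wpmul2l R c%:E; rewrite lee_fin (ltW c0) => /(_ isT _ _ h).
rewrite muleA -EFinM mulfV// mul1e => h2; apply: le_trans h2.
by under [X in (_ <= _ * X)%E]eq_esum do rewrite mulrA mulVf// mul1r.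
Qed.

(** The independent momenta as ((n_1, n_2), (m_1, m_2)), so that n becomes the outer and m the inner
    summation index. *)
Definition momentum_of (q : (int * int) * (int * int)) :
    (int * int) * (int * int) * (int * int) :=
  ((q.2.1, q.1.1), (q.2.2, q.1.2), (- (q.2.1 + q.2.2), - (q.1.1 + q.1.2))).

Lemma summandE (a b c : nat) (t1 t2 : R) (q : (int * int) * (int * int)) :
  let p := momentum_of q in
  propagator (t1 +i* t2) p.1.1 ^+ a * propagator (t1 +i* t2) p.1.2 ^+ b *
    propagator (t1 +i* t2) p.2 ^+ c =
  (t2 / pi) ^+ (a + b + c) * mode_fun a b c t2 q.1 q.2 t1.
Proof.
case: q => -[n1 n2] [m1 m2] /=; rewrite !propagatorE /mode_fun /box_fun /=.
have -> : ((- (m1 + m2))%:~R + (- (n1 + n2))%:~R * t1) ^+ 2 =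
  (m1%:~R + n1%:~R * t1 + (m2%:~R + n2%:~R * t1)) ^+ 2.
  by rewrite !mulrNz !intrD; ring.
move: (t2 / pi) => k.
by rewrite (exprMn a k) (exprMn b k) (exprMn c k) !exprVn !(exprD k); ring.
Qed.

Lemma modular_graph_CE (a b c : nat) (t1 t2 : R) :
  (0 < a)%N -> (0 < b)%N -> (0 < c)%N -> 0 < t2 ->
  modular_graph_C a b c (t1 +i* t2) =
  fine (((t2 / pi) ^+ (a + b + c))%:E *
    \esum_(n in [set: int * int]) \esum_(m in [set: int * int])
      (mode_fun a b c t2 n m t1)%:E)%E.
Proof.
move=> a0 b0 c0 t0; rewrite /modular_graph_C; congr fine.
have k0 : 0 < (t2 / pi) ^+ (a + b + c) by rewrite exprn_gt0// divr_gt0// pi_gt0.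
have mf0 n m : (0 <= (mode_fun a b c t2 n m t1)%:E)%E.
  by rewrite lee_fin mode_fun_ge0.
rewrite -(esum_pair mf0) -esumZl_ereal//; last by move=> q; exact: mode_fun_ge0.
rewrite esum_mkcond (@esum_inj_supp _ _ _ _ momentum_of).
- apply: eq_esum => q _; rewrite -summandE.
  case: ifPn => // /negP nq; congr EFin; apply/esym/eqP.
  have z (p : int * int) (e : nat) : (0 < e)%N -> p = 0 ->
      propagator (t1 +i* t2) p ^+ e = 0.
    move=> e0 ->; rewrite propagatorE mul0r mul0r addr0 expr0n/= addr0 invr0 mulr0.
    by rewrite expr0n gtn_eqF.
  rewrite !mulf_eq0; apply/negPn/negP; rewrite !negb_or => /andP[/andP[h1 h2] h3].
  apply: nq; rewrite inE; split.
  + by apply: contraNneq h1 => /z ->.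
  + by apply: contraNneq h2 => /z ->.
  + by apply: contraNneq h3 => /z ->.
  + by rewrite /momentum_of /=; congr (_, _); rewrite /= subrr.
- move=> [[n1 n2] [m1 m2]] [[n1' n2'] [m1' m2']].
  by rewrite /momentum_of/= => -[-> -> -> ->].
- move=> [[[m1 n1] [m2 n2]] [m3 n3]] nr; case: ifPn => //; rewrite inE.
  case=> /= _ _ _ [h1 h2]; exfalso; apply: nr.
  exists ((n1, n2), (m1, m2)) => //; rewrite /momentum_of /=.
  have -> : - (m1 + m2) = m3 by apply/eqP; rewrite eq_sym -addr_eq0 addrC h1.
  by have -> : - (n1 + n2) = n3 by apply/eqP; rewrite eq_sym -addr_eq0 addrC h2.
Qed.

(** A finite integral makes f finite almost everywhere, which replaces a proof that the lattice sum
    converges at every tau_1. *)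
Lemma integral_fine (D : set R) (f : R -> \bar R) (s : R) : measurable D ->
  measurable_fun D f -> (forall x, (0 <= f x)%E) ->
  (\int[mu]_(x in D) f x = s%:E)%E ->
  (\int[mu]_(x in D) (fine (f x))%:E = s%:E)%E.
Proof.
move=> mD mf f0 fs; rewrite -fs.
have fint : mu.-integrable D f.
  apply/integrableP; split => //.
  under eq_integral do rewrite gee0_abs//.
  by rewrite fs ltry.
apply: ge0_ae_eq_integral => //.
- apply/measurable_EFinP; apply: measurableT_comp => //.
- by move=> x _; rewrite lee_fin fine_ge0.
- have : {ae mu, forall x, D x -> f x \is a fin_num} by exact: (integrable_ae _ fint).
  move=> [N [mN N0 subN]]; exists N; split => // x /= nx; apply: subN => /= h.
  by apply: nx => Dx; rewrite fineK// h.
Qed.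

Lemma constant_modeE (a b c : nat) (t s : R) :
  (0 < a)%N -> (0 < b)%N -> (0 < c)%N -> 0 < t ->
  (\esum_(n in [set: int * int]) mode_integral a b c t n = s%:E)%E ->
  constant_mode a b c t = (t / pi) ^+ (a + b + c) * s.
Proof.
move=> a0 b0 c0 t0 hs; rewrite /constant_mode /Rintegral.
under eq_integral do rewrite modular_graph_CE//.
have mS : measurable_fun (`[0, 1]%classic : set R) (fun tau : R =>
    \esum_(n in [set: int * int]) \esum_(m in [set: int * int])
      (mode_fun a b c t n m tau)%:E)%E.
  apply: (@measurable_esum _ _ _ _ (int * int)%type (fun n tau =>
    \esum_(m in [set: int * int]) (mode_fun a b c t n m tau)%:E)%E).
    by move=> n; exact: measurable_mode_sum.
  by move=> n x; exact: mode_sum_ge0.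
have S0 (tau : R) : (0 <= \esum_(n in [set: int * int]) \esum_(m in [set: int * int])
      (mode_fun a b c t n m tau)%:E)%E.
  by apply: esum_ge0 => n _; exact: mode_sum_ge0.
have k0 : 0 <= (t / pi) ^+ (a + b + c) by rewrite exprn_ge0// divr_ge0 ?pi_ge0// ltW.
rewrite (@integral_fine _ _ ((t / pi) ^+ (a + b + c) * s))//.
- exact: measurable_funeM.
- by move=> x; rewrite mule_ge0.
- rewrite ge0_integralZl_EFin// EFinM; congr (_ * _)%E.
  rewrite -hs.
  apply: (@integral_esum _ _ _ mu `[0, 1]%classic (int * int)%type (fun n tau =>
    \esum_(m in [set: int * int]) (mode_fun a b c t n m tau)%:E)%E) => //.
  + by move=> n; exact: measurable_mode_sum.
  + by move=> n x; exact: mode_sum_ge0.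
Qed.

End ConstantMode.

(** * The terms with some n_r equal to zero *)

Section DegenerateModes.
Variable R : realType.
Notation mu := (@lebesgue_measure R).

Definition line_fun (a b c : nat) (k N x : R) : R :=
  k ^- (2 * c) * ((x ^+ 2 + N ^+ 2) ^- a * ((x + k) ^+ 2 + N ^+ 2) ^- b).

Lemma line_fun_ge0 a b c k N x : 0 <= line_fun a b c k N x.
Proof. by rewrite !mulr_ge0 ?inv_sqrD_ge0// invr_ge0 mulnC exprM sqr_ge0. Qed.

Lemma continuous_line_fun a b c k N : N != 0 -> continuous (line_fun a b c k N).
Proof.
move=> N0 x.
have ci (e : nat) (j : R) : {for x, continuous (fun x : R => ((x + j) ^+ 2 + N ^+ 2) ^- e)}.
  apply: cvgV; first by rewrite expf_neq0// gt_eqF// sqrD_gt0.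
  have d : is_derive x 1 (fun x : R => (x + j) ^+ 2 + N ^+ 2) (2 * (x + j)).
    by apply: is_derive_eq; rewrite /GRing.scale/= ?expr1; ring.
  have := is_derive_continuous (is_derive_expn_log e
    (u := 2 * (x + j) / ((x + j) ^+ 2 + N ^+ 2)) (f := fun x => (x + j) ^+ 2 + N ^+ 2) (x := x) _).
  apply; rewrite mulrC divfK//; by rewrite gt_eqF// sqrD_gt0.
have ca : {for x, continuous (fun x : R => (x ^+ 2 + N ^+ 2) ^- a)}.
  rewrite (_ : (fun x : R => _) = (fun x => ((x + 0) ^+ 2 + N ^+ 2) ^- a)); first exact: (ci a 0).
  by apply/funext => y; rewrite addr0.
exact: (@continuousM _ _ (fun=> k ^- (2 * c)) _ x (@cst_continuous _ _ _ x)
  (@continuousM _ _ _ _ x ca (ci b k))).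
Qed.

Lemma integral_unfold (a b c : nat) (n : int) (N : R) : n != 0 -> N != 0 ->
  ((\int[mu]_(tau in `[0%R, 1%R]%classic) \esum_(p in [set: int * int])
     (line_fun a b c p.1%:~R N (p.2%:~R + n%:~R * tau))%:E) =
   \esum_(k in [set: int]) tail_integral c a b k%:~R N N)%E.
Proof.
move=> n0 N0.
have maff (k : R) (m : int) : continuous (fun tau : R => line_fun a b c k N (m%:~R + n%:~R * tau)).
  move=> x; apply: (@continuous_comp _ _ _ (fun tau : R => m%:~R + n%:~R * tau) (line_fun a b c k N)).
    have dF : is_derive x 1 (fun x : R => m%:~R + n%:~R * x) n%:~R.
      by apply: is_derive_eq; rewrite /GRing.scale/= !(add0r, mul1r, mulr1).
    exact: is_derive_continuous dF.
  exact: continuous_line_fun.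
have -> : ((\int[mu]_(tau in `[0%R, 1%R]%classic) \esum_(p in [set: int * int])
     (line_fun a b c p.1%:~R N (p.2%:~R + n%:~R * tau))%:E) =
   \esum_(p in [set: int * int]) \int[mu]_(tau in `[0%R, 1%R]%classic)
     (line_fun a b c p.1%:~R N (p.2%:~R + n%:~R * tau))%:E)%E.
  apply: (@integral_esum _ _ _ mu `[0, 1]%classic (int * int)%type (fun p tau =>
    (line_fun a b c p.1%:~R N (p.2%:~R + n%:~R * tau))%:E)) => //.
  - move=> p; apply/measurable_EFinP/measurable_funTS.
    by apply: continuous_measurable_fun; exact: maff.
  - by move=> p tau; rewrite lee_fin line_fun_ge0.
rewrite (@esum_pair _ _ _ (fun k m => \int[mu]_(tau in `[0%R, 1%R]%classic)
     (line_fun a b c k%:~R N (m%:~R + n%:~R * tau))%:E)%E); last first.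
  by move=> k m; apply: integral_ge0 => x _; rewrite lee_fin line_fun_ge0.
apply: eq_esum => k _.
rewrite (unfold_line n0 (continuous_line_fun (N := N) N0))//.
by move=> x; exact: line_fun_ge0.
Qed.

(** Here n_3 = 0 and k = m_3, whose propagator does not involve tau_1. Setting m_1 = m and m_2 = -(k
    + m) makes m the index that is unfolded; the two lemmas on the axes do the same with k = m_2 and
    k = m_1. *)
Lemma mode_integral_antidiag a b c (t : R) (n : int) : n != 0 -> 0 < t ->
  mode_integral a b c t (n, - n) =
  (\esum_(k in [set: int]) tail_integral c a b k%:~R (`|n%:~R| * t) (`|n%:~R| * t))%E.
Proof.
move=> n0 t0; have N0 : `|n%:~R| * t != 0 :> R.
  by rewrite mulf_neq0 ?normr_eq0 ?intr_eq0// gt_eqF.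
rewrite -(integral_unfold _ _ _ n0 N0); apply: eq_integral => tau _.
have be : set_bij [set: int * int] [set: int * int]
    (fun p : int * int => (p.2, - (p.1 + p.2))).
  split => //.
  - by move=> [x y] [x' y'] _ _ /= [-> /oppr_inj /addIr ->].
  - by move=> [x y] _; exists (- (x + y), x) => //=; congr (_, _); lia.
rewrite (reindex_esum _ _ _ _ be); apply: eq_esum => -[k m] _ /=.
congr EFin; rewrite /mode_fun /box_fun /line_fun /= subrr oppr0 mul0r expr0n/= addr0.
have -> : m%:~R + n%:~R * tau + ((- (k + m))%:~R + (- n)%:~R * tau) = - k%:~R :> R.
  by rewrite !mulrNz intrD; ring.
have -> : (- (k + m))%:~R + (- n)%:~R * tau = - (m%:~R + n%:~R * tau + k%:~R) :> R.
  by rewrite !mulrNz intrD; ring.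
rewrite !sqrrN mulrNz mulNr sqrrN -exprM.
have -> : (`|n%:~R| * t) ^+ 2 = (n%:~R * t) ^+ 2 :> R.
  by rewrite !exprMn real_normK ?num_real.
ring.
Qed.

Lemma mode_integral_axis2 a b c (t : R) (n : int) : n != 0 -> 0 < t ->
  mode_integral a b c t (n, 0) =
  (\esum_(k in [set: int]) tail_integral b a c k%:~R (`|n%:~R| * t) (`|n%:~R| * t))%E.
Proof.
move=> n0 t0; have N0 : `|n%:~R| * t != 0 :> R.
  by rewrite mulf_neq0 ?normr_eq0 ?intr_eq0// gt_eqF.
rewrite -(integral_unfold _ _ _ n0 N0); apply: eq_integral => tau _.
have be : set_bij [set: int * int] [set: int * int]
    (fun p : int * int => (p.2, p.1)).
  split => //; first by move=> [x y] [x' y'] _ _ /= [-> ->].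
  by move=> [x y] _; exists (y, x).
rewrite (reindex_esum _ _ _ _ be); apply: eq_esum => -[k m] _ /=.
congr EFin; rewrite /mode_fun /box_fun /line_fun /=.
rewrite !mul0r !addr0 expr0n/= addr0 mulrNz mulNr sqrrN -exprM.
have -> : (`|n%:~R| * t) ^+ 2 = (n%:~R * t) ^+ 2 :> R.
  by rewrite !exprMn real_normK ?num_real.
ring.
Qed.

Lemma mode_integral_axis1 a b c (t : R) (n : int) : n != 0 -> 0 < t ->
  mode_integral a b c t (0, n) =
  (\esum_(k in [set: int]) tail_integral a b c k%:~R (`|n%:~R| * t) (`|n%:~R| * t))%E.
Proof.
move=> n0 t0; have N0 : `|n%:~R| * t != 0 :> R.
  by rewrite mulf_neq0 ?normr_eq0 ?intr_eq0// gt_eqF.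
rewrite -(integral_unfold _ _ _ n0 N0); apply: eq_integral => tau _.
apply: eq_esum => -[k m] _ /=.
congr EFin; rewrite /mode_fun /box_fun /line_fun /=.
rewrite !mul0r !add0r !addr0 expr0n/= addr0 mulrNz mulNr sqrrN -exprM.
have -> : (`|n%:~R| * t) ^+ 2 = (n%:~R * t) ^+ 2 :> R.
  by rewrite !exprMn real_normK ?num_real.
rewrite (addrC k%:~R) mulrA; ring.
Qed.

Lemma esum_tail_integral (a b c : nat) (t s : R) : (0 < c)%N -> 0 < t ->
  has_sum (tail_term a b c t) s ->
  (\esum_(n in [set: int]) (if n != 0%R then \esum_(k in [set: int])
     tail_integral c a.+1 b.+1 k%:~R (`|n%:~R| * t) (`|n%:~R| * t) else 0) = s%:E)%E.
Proof.
move=> c0 t0 hs.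
have tE (n k : int) : n != 0 ->
    tail_integral c a.+1 b.+1 k%:~R (`|n%:~R| * t) (`|n%:~R| * t) =
    (tail_term a b c t (n, k))%:E.
  move=> n0; have y0 : 0 < `|n%:~R : R| * t by rewrite mulr_gt0// normr_gt0 intr_eq0.
  (* For k = 0 the factor k^(-2c) is 0 because c > 0, in agreement with the excluded zero
     momentum. *)
  rewrite /tail_term /= n0 /=; have [->|k0] := eqVneq k 0.
    rewrite /tail_integral; under eq_integral do rewrite expr0n muln_eq0/= gtn_eqF// invr0 mul0r.
    by rewrite integral0.
  by rewrite tail_integralE// intr_eq0.
have t_ge0 p : 0 <= tail_term a b c t p.
  case: p => n k; have [->|n0] := eqVneq n 0; first by rewrite /tail_term eqxx.
  rewrite -lee_fin -tE//; apply: integral_ge0 => x _.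
  by rewrite lee_fin; exact: line_fun_ge0.
rewrite -(has_sum_esum t_ge0 hs).
transitivity (\esum_(p in [set: int * int]) (tail_term a b c t (p.1, p.2))%:E)%E; last first.
  by apply: eq_esum => -[].
rewrite (@esum_pair _ _ _ (fun n k => (tail_term a b c t (n, k))%:E)); last first.
  by move=> n k; rewrite lee_fin.
apply: eq_esum => n _; case: ifPn => [n0|/negPn/eqP ->].
  by apply: eq_esum => k _; rewrite tE.
by rewrite esum1// => k _; rewrite /tail_term eqxx.
Qed.

(** With n = 0 neither tau_1 nor t occurs. For convergence, the first two factors are at most
    |m_r|^-2 and the third is at most 1. *)
Lemma mode_integral_zero (a b c : nat) : exists Z : R, forall t,
  mode_integral a.+1 b.+1 c.+1 t (0, 0) = Z%:E.
Proof.
pose z (m : int * int) : R := box_fun a.+1 b.+1 c.+1 0 0 0 m.1%:~R m.2%:~R.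
have z0 m : 0 <= z m by exact: box_fun_ge0.
have n1 (n : int) : n != 0 -> 1 <= `|n%:~R : R|.
  by move=> n0; rewrite -intr_norm ler1z -gtz0_ge1 normr_gt0.
have pow (n : int) (e : nat) : (n%:~R ^+ 2) ^- e.+1 <= `|n%:~R : R| ^- 2.
  have [->|n0] := eqVneq n 0; first by rewrite normr0 !expr0n/= !invr0.
  have p := n1 n n0; have pp : 0 < `|n%:~R : R| by exact: lt_le_trans p.
  rewrite -(real_normK (num_real (n%:~R : R))) lef_pV2 ?posrE ?exprn_gt0//.
  by rewrite (exprS _ e) ler_peMr ?exprn_ge0// exprn_ege1// exprn_ege1.
have pow1 (n : int) (e : nat) : (n%:~R ^+ 2) ^- e.+1 <= (1 : R).
  have [->|n0] := eqVneq n 0; first by rewrite !expr0n/= invr0.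
  apply: (le_trans (pow n e)); rewrite invf_le1 ?exprn_ege1 ?n1//.
  by rewrite exprn_gt0// normr_gt0 intr_eq0.
have fin : (\esum_(m in [set: int * int]) (z m)%:E <=
    (2 * zeta R 2 * (2 * zeta R 2))%:E)%E.
  have hz := has_sum_zeta_norm R (leqnn 2).
  rewrite -(has_sum_esum _ (has_sum_prod hz hz)); last first.
    by move=> p; rewrite mulr_ge0// invr_ge0 exprn_ge0.
  apply: le_esum => -[m1 m2] _; rewrite lee_fin /z /box_fun /= expr0n/= !addr0.
  rewrite -intrD -[leRHS]mulr1.
  have ge0 (n : int) (e : nat) : 0 <= (n%:~R ^+ 2 : R) ^- e by rewrite invr_ge0 exprn_ge0 ?sqr_ge0.
  by apply: ler_pM; rewrite ?mulr_ge0// ler_pM.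
have [Z ZE] := esum_ge0_fin z0 fin.
exists Z => t; rewrite /mode_integral.
transitivity (\int[mu]_(tau in `[0%R, 1%R]%classic) (cst Z%:E) tau)%E.
  apply: eq_integral => tau _; rewrite /= -ZE; apply: eq_esum => m _.
  by rewrite /mode_fun /z /= addr0 oppr0 !mul0r !addr0.
have mu1 : mu (`[0, 1]%classic : set R) = 1%E.
  by rewrite lebesgue_measure_itv/= lte_fin ltr01 -EFinB subr0.
by rewrite integral_cst//= -[RHS]mule1 -mu1.
Qed.

(** Two vanishing n_r force the third to vanish, so the five cases exhaust the lattice without
    overlap. *)
Lemma esum_modes (a b c : nat) (t : R) :
  (\esum_(n in [set: int * int]) mode_integral a b c t n =
   mode_integral a b c t (0%R, 0%R) +
   \esum_(n in [set: int]) (if n != 0%R then mode_integral a b c t (n, 0%R) else 0) +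
   \esum_(n in [set: int]) (if n != 0%R then mode_integral a b c t (0%R, n) else 0) +
   \esum_(n in [set: int]) (if n != 0%R then mode_integral a b c t (n, - n)%R else 0) +
   \esum_(n in [set: int * int])
     (if generic n then mode_integral a b c t n else 0))%E.
Proof.
set f := mode_integral a b c t.
have f0 n : (0 <= f n)%E by exact: mode_integral_ge0.
pose sel (P : int * int -> bool) n := (if P n then f n else 0)%E.
have sel0 P n : (0 <= sel P n)%E by rewrite /sel; case: ifP.
have supp (e : int -> int * int) (P : int * int -> bool) : injective e ->
    (forall n, P n -> range e n) -> (forall n, P (e n) = (n != 0)) ->
    (\esum_(n in [set: int]) (if n != 0%R then f (e n) else 0) =
     \esum_(n in [set: int * int]) sel P n)%E.
  move=> einj Pe PE; rewrite (esum_inj_supp einj).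
    by apply: eq_esum => n _; rewrite /sel PE.
  by move=> n nr; rewrite /sel; case: ifP => // /Pe.
rewrite (supp (fun n => (n, 0)) (fun n => (n.1 != 0) && (n.2 == 0))); first last.
- by move=> n; rewrite /= ?eqxx andbT.
- by move=> [x y] /= /andP[_ /eqP ->]; exists x.
- by move=> x y [].
rewrite (supp (fun n => (0, n)) (fun n => (n.1 == 0) && (n.2 != 0))); first last.
- by move=> n; rewrite /= ?eqxx.
- by move=> [x y] /= /andP[/eqP -> _]; exists y.
- by move=> x y [].
rewrite (supp (fun n => (n, - n)) (fun n => (n.1 != 0) && (n.1 + n.2 == 0))); first last.
- by move=> n; rewrite /= subrr eqxx andbT.
- move=> [x y] /= /andP[_ /eqP xy]; exists x => //; congr (_, _).
  by apply/eqP; rewrite eq_sym -addr_eq0 addrC xy.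
- by move=> x y [].
have -> : f (0, 0) = (\esum_(n in [set: int * int]) sel (pred1 (0%R, 0%R)) n)%E.
  rewrite (@esum_inj_supp _ _ _ _ (fun _ : unit => (0, 0))).
  - rewrite (_ : [set: unit] = [set tt]); last by apply/seteqP; split => // -[].
    by rewrite esum_set1 /sel/= ?eqxx.
  - by move=> [] [].
  - by move=> n nr; rewrite /sel; case: ifP => // /eqP nE; exfalso; apply: nr; exists tt.
have g0 n : (0 <= if generic n then f n else 0)%E by exact: (sel0 generic).
rewrite -!esumD; try by move=> n _; rewrite ?adde_ge0.
apply: eq_esum => -[x y] _; rewrite /sel /generic /= xpair_eqE.
have [->|x0] := eqVneq x 0; have [->|y0] := eqVneq y 0;
  rewrite /= ?eqxx ?(negbTE x0) ?(negbTE y0) ?adde0 ?add0e ?addr0 ?(negbTE x0) ?adde0//.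
by case: ifP => xy; rewrite ?adde0 ?add0e.
Qed.

End DegenerateModes.

(** * Rational combinations of products of two odd zeta values *)

Section OddZetaProducts.
Variables (R : realType) (w : nat).

Definition odd_zeta_products (x : R) : Prop := exists gamma : nat -> rat,
  x = \sum_(1 <= k < (w - 3).+1)
      2^-1 * ratr (gamma k) * zeta R (2 * k + 1) * zeta R (2 * w - 2 * k - 3).

Lemma odd_zeta_products0 : odd_zeta_products 0.
Proof.
exists (fun=> 0); rewrite big1// => k _.
by rewrite rmorph0 mulr0 !mul0r.
Qed.

Lemma odd_zeta_productsD x y :
  odd_zeta_products x -> odd_zeta_products y -> odd_zeta_products (x + y).
Proof.
move=> [g ->] [h ->]; exists (fun k => g k + h k); rewrite -big_split/=.
by apply: eq_bigr => k _; rewrite rmorphD/=; ring.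
Qed.

Lemma odd_zeta_productsZ (r : rat) x :
  odd_zeta_products x -> odd_zeta_products (ratr r * x).
Proof.
move=> [g ->]; exists (fun k => r * g k); rewrite big_distrr/=.
by apply: eq_bigr => k _; rewrite rmorphM/=; ring.
Qed.

Lemma odd_zeta_products_zeta (k : nat) : (1 <= k <= w - 3)%N ->
  odd_zeta_products (zeta R (2 * k + 1) * zeta R (2 * w - 2 * k - 3)).
Proof.
move=> /andP[k1 kw]; exists (fun j => if j == k then 2 else 0).
rewrite (bigD1_seq k) ?iota_uniq//=; last by rewrite mem_index_iota k1 ltnS.
rewrite eqxx big1 ?addr0; last by move=> j /negbTE ->; rewrite rmorph0 mulr0 !mul0r.
by rewrite rmorph_nat mulVf ?pnatr_eq0// mul1r.
Qed.

(** Odd exponents that are at least 2 are at least 3; with sum 2w - 2 they are 2k + 1 and 2w - 2k -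
    3 for some k between 1 and w - 3. *)
Lemma odd_zeta_products_pair (l : pair_comb) : (2 < w)%N ->
  pair_ok (2 * w - 2) l -> odd_zeta_products (pair_zeta R l).
Proof.
move=> w2 /allP lok; rewrite /pair_zeta big_seq.
elim/big_rec: _ => [|[q [[m n] r]] x /lok /= /and3P[m2 n2 /eqP mn] hx].
  exact: odd_zeta_products0.
apply: odd_zeta_productsD => //; rewrite /zeta_odd.
have [om|_] := boolP (odd m); last by rewrite !(mul0r, mulr0); exact: odd_zeta_products0.
have [on|_] := boolP (odd n); last by rewrite !(mul0r, mulr0); exact: odd_zeta_products0.
have -> : ratr q * 4 ^- r * (2 * zeta R m * (2 * zeta R n)) =
    ratr (q * 4 ^- r * 4) * (zeta R m * zeta R n).
  by rewrite !rmorphM/= fmorphV rmorphXn/= !rmorph_nat; ring.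
have [k mE] : exists k, m = (2 * k + 1)%N.
  by exists m./2; rewrite -[LHS]odd_double_half om mul2n addnC.
have -> : n = (2 * w - 2 * k - 3)%N by lia.
rewrite mE; apply/odd_zeta_productsZ/odd_zeta_products_zeta.
have : n != 2 by apply: contraTneq on => ->.
lia.
Qed.

End OddZetaProducts.

(** * Assembling the constant term *)

Section ConstantTerm.
Variable R : realType.
Notation mu := (@lebesgue_measure R).

(** The point (1, -1, 0) lies on the plane, so [line_int_pair_eval] at (1, 1) yields the plane form.
    The signs (-1)^(c+1) and (-1)^c multiply to -1, which gives the exact opposite of the
    antidiagonal term in [generic_sum]. *)
Lemma asym_tail_mode (a b c : nat) : exists s : R -> R,
  (forall t, 1 <= t -> (\esum_(n in [set: int]) (if n != 0%R then \esum_(k in [set: int])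
     tail_integral c.+1 a.+1 b.+1 k%:~R (`|n%:~R| * t) (`|n%:~R| * t) else 0) = (s t)%:E)%E) /\
  asym (fun t => t ^+ (2 * (a + b + c).+2) * s t)
    (- (pi ^+ 2 * (2 * zeta R (2 * (a + b + c).+2) * plane_eval (comb3 a b c) 1 (- 1)))).
Proof.
have [s [hs sA]] := asym_tail R a b (ltn0Sn c).
exists s; split=> [t t1|].
  by rewrite (esum_tail_integral _ _ (hs t t1))//; exact: lt_le_trans t1.
rewrite addnS in sA; rewrite (_ : - _ = pi * ((-1) ^+ c.+1 * (2 * zeta R (2 * (a + b + c).+2) *
       line_int (tail_comb a b (2 * c.+1) 1) 1 1)))//.
rewrite line_int_pair_eval// -(@pair_eval_plane R _ 1 (-1)) ?oppr_eq0 ?oner_eq0//.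
rewrite subrr oppr0 (exprS _ c).
have -> (x y p : R) : p * (-1 * (-1) ^+ c * (2 * x * ((-1) ^+ c * p * y))) =
    - ((-1) ^+ c * (-1) ^+ c) * (p ^+ 2 * (2 * x * y)) by ring.
by rewrite -expr2 sqrr_sign mulN1r.
Qed.

(** With w the sum of the three exponents, t^(w-2) (t/pi)^w = pi^-w t^(2w-2), and the pi^2 of the
    double integrals reduces pi^-w to pi^-(w-2). *)
Lemma asym_constant_mode (a b c : nat) :
  asym (fun t => t ^+ (a.+1 + b.+1 + c.+1 - 2) * constant_mode a.+1 b.+1 c.+1 t)
    (pi ^- (a + b + c).+1 * (pair_zeta R (comb3 a b c) + pair_zeta R (comb3 a c b) +
      pair_zeta R (comb3 b c a))).
Proof.
have [Z hZ] := mode_integral_zero R a b c.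
have [s1 [hs1 A1]] := asym_tail_mode a b c.
have [s2 [hs2 A2]] := asym_tail_mode a c b.
have [s3 [hs3 A3]] := asym_tail_mode b c a.
have [s4 [hs4 A4]] := asym_generic R a b c.
set E := (2 * (a + b + c).+2)%N in A1 A4.
rewrite (_ : (2 * (a + c + b).+2)%N = E) in A2; last by rewrite /E; lia.
rewrite (_ : (2 * (b + c + a).+2)%N = E) in A3; last by rewrite /E; lia.
have A0 := asymZ Z (asym_expn R (isT : (0 < E)%N)).
have := asymZ (pi ^- (a + b + c).+3) (asymD (asymD (asymD (asymD A0 A1) A2) A3) A4).
rewrite (_ : pi ^- (a + b + c).+3 * _ = pi ^- (a + b + c).+1 *
  (pair_zeta R (comb3 a b c) + pair_zeta R (comb3 a c b) + pair_zeta R (comb3 b c a))); last first.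
  rewrite /generic_sum -/E !exprS !invfM; have p0 : pi != 0 :> R by rewrite gt_eqF// pi_gt0.
  by move: p0; generalize (pi : R) => p p0; field; rewrite expf_neq0.
move=> A; apply: (asym_near ltr01 _ A) => t t1.
have t0 : 0 < t by exact: lt_le_trans t1.
have := esum_modes a.+1 b.+1 c.+1 t.
have ifE (f g : int -> \bar R) : (forall n, n != 0 -> f n = g n) ->
    (\esum_(n in [set: int]) (if n != 0%R then f n else 0) =
     \esum_(n in [set: int]) (if n != 0%R then g n else 0))%E.
  by move=> fg; apply: eq_esum => n _; case: ifP => // /fg.
rewrite (ifE _ _ (fun n n0 => mode_integral_axis2 _ _ _ n0 t0)) hs2//.
rewrite (ifE _ _ (fun n n0 => mode_integral_axis1 _ _ _ n0 t0)) hs3//.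
rewrite (ifE _ _ (fun n n0 => mode_integral_antidiag _ _ _ n0 t0)) hs1//.
rewrite hZ hs4// -!EFinD => /(constant_modeE (ltn0Sn a) (ltn0Sn b) (ltn0Sn c) t0) ->.
have -> : (a.+1 + b.+1 + c.+1 = (a + b + c).+3)%N by lia.
rewrite exprMn exprVn !subSS subn0.
have -> : E = ((a + b + c).+1 + (a + b + c).+3)%N by rewrite /E; lia.
rewrite exprD; ring.
Qed.

End ConstantTerm.

Theorem theorem1p2 (R : realType) (a1 a2 a3 w : nat)
    (ha1 : (0 < a1)%N) (ha2 : (0 < a2)%N) (ha3 : (0 < a3)%N)
    (hw : w = (a1 + a2 + a3)%N) (c_2_minus_w : R)
    (hc : is_c_2_minus_w a1 a2 a3 c_2_minus_w) :
  exists gamma : nat -> rat,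
    c_2_minus_w =
    \sum_(1 <= k < (w - 3).+1)
      2^-1 * ratr (gamma k) * zeta R (2 * k + 1) * zeta R (2 * w - 2 * k - 3).
Proof.
rewrite -/(odd_zeta_products w c_2_minus_w).
case: a1 a2 a3 ha1 ha2 ha3 hw hc => [//|a] [//|b] [//|c] _ _ _ hw hc.
have w2 : (2 < a.+1 + b.+1 + c.+1)%N by lia.
have := asym_uniq (asym_is_c w2 hc) (asym_constant_mode R a b c).
have p0 : (4 * pi) ^+ (a.+1 + b.+1 + c.+1 - 2) != 0 :> R.
  by rewrite expf_neq0// gt_eqF// mulr_gt0// pi_gt0.
(* The factor (4 pi)^(w-2) of the Laurent normalisation cancels pi^-(w-2) and leaves the rational
   number 4^(w-2). *)
move=> /(canRL (divfK p0)) ->.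
have -> : (a.+1 + b.+1 + c.+1 - 2 = (a + b + c).+1)%N by lia.
rewrite (exprMn (a + b + c).+1) mulrC -mulrA.
rewrite (mulrA (pi ^+ _)) mulfV ?expf_neq0 ?gt_eqF ?pi_gt0// mul1r.
have -> : 4 ^+ (a + b + c).+1 = ratr (4 ^+ (a + b + c).+1) :> R.
  by rewrite rmorphXn rmorph_nat.
have pair x y z : (x + y + z = a + b + c)%N ->
    odd_zeta_products w (pair_zeta R (comb3 x y z)).
  move=> xyz; apply: odd_zeta_products_pair; first by rewrite hw.
  rewrite (_ : 2 * w - 2 = 2 * (x + y + z).+2)%N; first exact: pair_ok_comb3.
  by rewrite hw xyz; lia.
by apply/odd_zeta_productsZ/odd_zeta_productsD; [apply: odd_zeta_productsD|]; apply: pair; lia.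
Qed.
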